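(* Let $\mathbb{G}$ be a compact quantum group with a faithful Haar state $\phi$ and let $\mathbb{D}$ be a quantum homogeneous space of $\mathbb{G}$ in the sense of Podleś. Let $(N,\Delta_N)$ be the von Neumann version of $\mathbb{D}$. Then $(N,\Delta_N)$ is a quantum homogeneous space of $\mathbb{G}$ (QHS) and its $C^*$-algebraic version coincides with $\mathbb{D}$.
   Context: Compact quantum groups. A compact quantum group $\mathbb{G}=(A,\Delta)$ is a unital $C^*$-algebra $A=C_0(\mathbb{G})$ with a unital coassociative $*$-homomorphism $\Delta=\Delta_{\mathbb{G}}:A\to A\otimes A$ such that $[\Delta(A)(A\otimes 1)]=A\otimes A=[\Delta(A)(1\otimes A)]$. The Haar state is the unique state $\phi$ with $(\phi\otimes\iota)\Delta(a)=\phi(a)1=(\iota\otimes\phi)\Delta(a)$. When $\phi$ is faithful, $L^2(\mathbb{G})$ is its GNS space with GNS map $\Lambda_\phi$, $A$ is viewed as acting on $L^2(\mathbb{G})$, and $L^\infty(\mathbb{G})$ is the strong closure of $A$, so $\mathbb{G}$ is also a locally compact quantum group. Conventions. $\mathcal{K}(L^2(\mathbb{G}))$ denotes the compact operators, $\otimes$ is the minimal tensor product of $C^*$-algebras, $\mathrm{M}(A)$ is the multiplier algebra, $\mathrm{Mor}(A,B)$ is the set of nondegenerate $*$-homomorphisms $A\to \mathrm{M}(B)$, and $[\,\cdot\,]$ denotes closed linear span. $\mathcal{L}(L^2(\mathbb{G})\otimes D)$ is the algebra of adjointable operators on the Hilbert $D$-module $L^2(\mathbb{G})\otimes D$, identified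 with $\mathrm{M}(\mathcal{K}(L^2(\mathbb{G}))\otimes D)$. $\mathbb{G}$-$C^*$-algebra. A pair $\mathbb{D}=(C_0(\mathbb{D}),\Delta_{\mathbb{D}})$ where $C_0(\mathbb{D})$ is a $C^*$-algebra and $\Delta_{\mathbb{D}}\in\mathrm{Mor}(C_0(\mathbb{D}),C_0(\mathbb{G})\otimes C_0(\mathbb{D}))$ is injective, satisfies $(\iota\otimes\Delta_{\mathbb{D}})\circ\Delta_{\mathbb{D}}=(\Delta_{\mathbb{G}}\otimes\iota)\circ\Delta_{\mathbb{D}}$, and is continuous: $[\Delta_{\mathbb{D}}(C_0(\mathbb{D}))(C_0(\mathbb{G})\otimes 1)]=C_0(\mathbb{G})\otimes C_0(\mathbb{D})$. Quantum homogeneous space in the sense of Podleś (QHSP). A unital $\mathbb{G}$-$C^*$-algebra $\mathbb{D}$ (i.e. $C_0(\mathbb{D})$ unital) with $\{d\in C_0(\mathbb{D}):\Delta_{\mathbb{D}}(d)=1\otimes d\}=\mathbb{C}1$. Von Neumann version of a QHSP. Define the state $\rho$ on $C_0(\mathbb{D})$ by $(\phi\otimes\iota)\Delta_{\mathbb{D}}(d)=\rho(d)1$; it is faithful and invariant, $(\iota\otimes\rho)\Delta_{\mathbb{D}}(d)=\rho(d)1$. Let $L^2(\mathbb{D})$ be its GNS space with GNS map $\Lambda_\rho$, and view $C_0(\mathbb{D})\subset B(L^2(\mathbb{D}))$. The formula $U_{\mathbb{D}}(\Lambda_\phi(a)\otimes\Lambda_\rho(d))=(\Lambda_\phi\otimes\Lambda_\rho)(\Delta_{\mathbb{D}}(d)(a\otimes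 1))$ defines a unitary on $L^2(\mathbb{G})\otimes L^2(\mathbb{D})$ with $\Delta_{\mathbb{D}}(d)=U_{\mathbb{D}}(1\otimes d)U_{\mathbb{D}}^*$. Then $N$ is the strong closure of $C_0(\mathbb{D})$ in $B(L^2(\mathbb{D}))$ and $\Delta_N:N\to L^\infty(\mathbb{G})\bar\otimes N$, $\Delta_N(x)=U_{\mathbb{D}}(1\otimes x)U_{\mathbb{D}}^*$. Coaction on a von Neumann algebra. A (left) coaction of $\mathbb{G}$ on $N$ is an injective normal unital $*$-homomorphism $\Delta_N:N\to L^\infty(\mathbb{G})\bar\otimes N$ with $(\iota\otimes\Delta_N)\circ\Delta_N=(\Delta_{\mathbb{G}}\otimes\iota)\circ\Delta_N$. It is ergodic if $\{x\in N:\Delta_N(x)=1\otimes x\}=\mathbb{C}1$. Strictness. A unital $*$-homomorphism $\pi:N\to\mathcal{L}(\mathcal{E})$ ($\mathcal{E}$ a Hilbert $C^*$-module) is strict if it is $*$-strongly continuous on the unit ball of $N$: for every uniformly bounded $*$-strongly convergent net $x_i\in N$ and every $v\in\mathcal{E}$, the nets $\pi(x_i)v$ and $\pi(x_i^* )v$ converge in norm (to the values at the limit). Quantum homogeneous space (QHS). A von Neumann algebra $N$ with an ergodic coaction $\Delta_N:N\to L^\infty(\mathbb{G})\bar\otimes N$ is a QHS of $\mathbb{G}$ if there exists a $\mathbb{G}$-$C^*$-algebra $\mathbb{D}$ such that: (1) $C_0(\mathbb{D})$ is a strongly dense $C^*$-subalgebra of $N$; (2) $\Delta_{\mathbb{D}}$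 is the restriction of $\Delta_N$ to $C_0(\mathbb{D})$; (3) $\Delta_N(N)\subset \mathrm{M}(\mathcal{K}(L^2(\mathbb{G}))\otimes C_0(\mathbb{D}))$ and the map $\Delta_N:N\to\mathcal{L}(L^2(\mathbb{G})\otimes C_0(\mathbb{D}))$ is strict. Such a $\mathbb{D}$ is unique and is called the $C^*$-algebraic version of $(N,\Delta_N)$. *)

(* Defs.v *)
From HB Require Import structures.
From mathcomp Require Import all_boot all_order all_algebra.
From mathcomp Require Import all_classical all_reals topology normedtype.
From mathcomp Require Import complex sesquilinear.

Set Implicit Arguments.
Unset Strict Implicit.
Unset Printing Implicit Defensive.

Import Order.TTheory GRing.Theory Num.Theory.
Import numFieldNormedType.Exports.

Local Open Scope classical_set_scope.
Local Open Scope complex_scope.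
Local Open Scope ring_scope.

(* C*-algebras and von Neumann algebras are concrete throughout: sets of
   bounded operators on a Hilbert space, operators being plain functions
   satisfying [bop].  By Gelfand-Naimark this is no loss of generality, and the
   minimal tensor product of C*-algebras is then the spatial one.
   Several objects characterised by a unique existence statement (adjoints,
   tensor products of operators, slice maps...) are selected by [xget]; its
   default value is never reached on the arguments of interest. *)

Record hilbert (R : realType) := Hilbert {
  hilbert_sort :> completeNormedModType R[i];
  inner : {dot hilbert_sort for (@Num.conj R[i])};
  inner_norm : forall x, inner x x = `|x| ^+ 2 }.
Arguments inner {R h}.

Definition lspan (R : realType) (V : lmodType R[i]) (S : set V) : set V :=
  [set v | exists (n : nat) (c : 'I_n -> R[i]) (s : 'I_n -> V),
     (forall i, S (s i)) /\ v = \sum_(i < n) c i *: s i].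

(* A model of the Hilbert space tensor product; it is determined up to a unique
   unitary compatible with [tens]. *)
Record htensor (R : realType) (H K : hilbert R) := HTensor {
  htensor_space :> hilbert R;
  tens : H -> K -> htensor_space;
  tens_linear_l : forall k, linear (tens^~ k);
  tens_linear_r : forall h, linear (tens h);
  tens_inner : forall h h' k k',
    inner (tens h k) (tens h' k') = inner h h' * inner k k';
  tens_total :
    closure (lspan [set v | exists h k, v = tens h k]) = setT }.

Section Operators.
Variable R : realType.
Implicit Types H K L : hilbert R.

Definition bop H K (T : H -> K) : Prop := linear T /\ continuous T.

Definition opnorm H K (T : H -> K) : R :=
  sup [set complex.Re `|T x| | x in [set x : H | `|x| <= 1]].

Definition adj H K (T : H -> K) : K -> H :=
  xget (fun=> 0)
    [set S | bop S /\ forall x y, inner (T x) y = inner x (S y)].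

Definition unitary H K (U : H -> K) : Prop :=
  [/\ bop U, U \o adj U = id & adj U \o U = id].

Definition compact_op H K : set (H -> K) :=
  [set T | bop T /\ precompact (T @` [set x : H | `|x| <= 1])].

Definition nclosure H K (S : set (H -> K)) : set (H -> K) :=
  [set T | bop T /\
     forall e : R, 0 < e -> exists2 s, S s & opnorm (T - s) < e].

Definition cspan H K (S : set (H -> K)) : set (H -> K) := nclosure (lspan S).

(* The strong operator topology is the topology of pointwise convergence. *)
Definition sclosure H K (S : set (H -> K)) : set (H -> K) :=
  [set T | bop T /\ closure (S : set {ptws H -> K}) T].

Definition opmul H K L (S : set (K -> L)) (T : set (H -> K)) : set (H -> L) :=
  [set X | exists s t, [/\ S s, T t & X = s \o t]].

Definition scalars H : set (H -> H) := [set T | exists c : R[i], T = c *: id].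

Definition star_algebra H (A : set (H -> H)) : Prop :=
  [/\ A `<=` @bop H H, A 0,
      forall (c : R[i]) a b, A a -> A b -> A (c *: a + b),
      forall a b, A a -> A b -> A (a \o b) &
      forall a, A a -> A (adj a)].

Definition cstar_algebra H (A : set (H -> H)) : Prop :=
  star_algebra A /\ nclosure A `<=` A.

Definition von_neumann_algebra H (N : set (H -> H)) : Prop :=
  [/\ star_algebra N, N id & sclosure N `<=` N].

Definition nondegenerate_on H (A : set (H -> H)) : Prop :=
  closure (lspan [set v | exists a h, A a /\ v = a h]) = setT.

(* The multiplier algebra of a C*-algebra acting nondegenerately. *)
Definition mult H (A : set (H -> H)) : set (H -> H) :=
  [set x | bop x /\ forall a, A a -> A (x \o a) /\ A (a \o x)].

Definition star_hom H K (A : set (H -> H)) (f : (H -> H) -> (K -> K)) : Prop :=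
  [/\ forall a, A a -> bop (f a),
      forall (c : R[i]) a b, A a -> A b -> f (c *: a + b) = c *: f a + f b,
      forall a b, A a -> A b -> f (a \o b) = f a \o f b &
      forall a, A a -> f (adj a) = adj (f a)].

Definition mor H K (A : set (H -> H)) (B : set (K -> K))
    (f : (H -> H) -> (K -> K)) : Prop :=
  [/\ star_hom A f, forall a, A a -> mult B (f a) &
      cspan (opmul (f @` A) B) = B].

Definition selfadjoint H (T : H -> H) : Prop := bop T /\ adj T = T.

Definition ople H (S T : H -> H) : Prop := forall v, 0 <= inner (T v - S v) v.

Definition oplub H (X : set (H -> H)) (T : H -> H) : Prop :=
  [/\ selfadjoint T, forall x, X x -> ople x T &
      forall T', selfadjoint T' -> (forall x, X x -> ople x T') -> ople T T'].

Definition normal_map H K (N : set (H -> H)) (f : (H -> H) -> (K -> K)) :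
    Prop :=
  forall X T, X !=set0 -> X `<=` N `&` @selfadjoint H ->
    (forall x y, X x -> X y -> exists z, [/\ X z, ople x z & ople y z]) ->
    N T -> oplub X T -> oplub (f @` X) (f T).

Definition state H (A : set (H -> H)) (phi : (H -> H) -> R[i]) : Prop :=
  [/\ forall (c : R[i]) a b, A a -> A b -> phi (c *: a + b) = c * phi a + phi b,
      forall a, A a -> 0 <= phi (adj a \o a) & phi id = 1].

Definition faithful H (A : set (H -> H)) (phi : (H -> H) -> R[i]) : Prop :=
  forall a, A a -> phi (adj a \o a) = 0 -> a = 0.

Definition is_gns H K (A : set (H -> H)) (phi : (H -> H) -> R[i])
    (Lam : (H -> H) -> K) (pi : (H -> H) -> (K -> K)) : Prop :=
  [/\ forall (c : R[i]) a b, A a -> A b -> Lam (c *: a + b) = c *: Lam a + Lam b,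
      forall a b, A a -> A b -> inner (Lam a) (Lam b) = phi (adj b \o a),
      closure (Lam @` A) = setT,
      star_hom A pi &
      forall a b, A a -> A b -> pi a (Lam b) = Lam (a \o b)].

End Operators.

Section TensorProducts.
Variable R : realType.
(* A choice of a tensor product for each pair of Hilbert spaces. *)
Variable tp : forall H K : hilbert R, htensor H K.
Implicit Types H K L : hilbert R.

Definition optens H H' K K' (S : H -> H') (T : K -> K') :
    tp H K -> tp H' K' :=
  xget (fun=> 0)
    [set X | bop X /\ forall h k, X (tens _ h k) = tens _ (S h) (T k)].

Definition tassoc H K L : tp (tp H K) L -> tp H (tp K L) :=
  xget (fun=> 0)
    [set X | bop X /\ forall h k l,
       X (tens _ (tens _ h k) l) = tens _ h (tens _ k l)].

Definition elem_tens H K (A : set (H -> H)) (B : set (K -> K)) :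
    set (tp H K -> tp H K) :=
  [set X | exists a b, [/\ A a, B b & X = optens a b]].

Definition ctens H K (A : set (H -> H)) (B : set (K -> K)) :
    set (tp H K -> tp H K) := cspan (elem_tens A B).

Definition vntens H K (M : set (H -> H)) (N : set (K -> K)) :
    set (tp H K -> tp H K) := sclosure (lspan (elem_tens M N)).

(* The Hilbert B-module H (x) B, realised as the closed span in B(K, H (x) K)
   of the operators k |-> h (x) b k; the norm of the module is then the
   operator norm, and M(K(H) (x) B) acts on it by composition. *)
Definition hmodule H K (B : set (K -> K)) : set (K -> tp H K) :=
  cspan [set v | exists h b, B b /\ v = (fun k => tens (tp H K) h (b k))].

Definition lslice H K (A : set (H -> H)) (B : set (K -> K))
    (phi : (H -> H) -> R[i]) : (tp H K -> tp H K) -> (K -> K) :=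
  xget (fun=> fun=> 0)
    [set E | [/\ forall (c : R[i]) x y, ctens A B x -> ctens A B y ->
                   E (c *: x + y) = c *: E x + E y,
                 forall x, ctens A B x -> bop (E x),
                 exists C : R, forall x, ctens A B x ->
                   opnorm (E x) <= C * opnorm x &
                 forall a b, A a -> B b -> E (optens a b) = phi a *: b]].

Definition rslice H K (A : set (H -> H)) (B : set (K -> K))
    (psi : (K -> K) -> R[i]) : (tp H K -> tp H K) -> (H -> H) :=
  xget (fun=> fun=> 0)
    [set E | [/\ forall (c : R[i]) x y, ctens A B x -> ctens A B y ->
                   E (c *: x + y) = c *: E x + E y,
                 forall x, ctens A B x -> bop (E x),
                 exists C : R, forall x, ctens A B x ->
                   opnorm (E x) <= C * opnorm x &
                 forall a b, A a -> B b -> E (optens a b) = psi b *: a]].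

Definition gns_tens H K H' K' (A : set (H -> H)) (B : set (K -> K))
    (Lam : (H -> H) -> H') (Lam' : (K -> K) -> K') :
    (tp H K -> tp H K) -> tp H' K' :=
  xget (fun=> 0)
    [set E | [/\ forall (c : R[i]) x y, ctens A B x -> ctens A B y ->
                   E (c *: x + y) = c *: E x + E y,
                 exists C : R, forall x, ctens A B x ->
                   complex.Re `|E x| <= C * opnorm x &
                 forall a b, A a -> B b ->
                   E (optens a b) = tens _ (Lam a) (Lam' b)]].

(* *-homomorphisms out of M(A (x) B) with prescribed values on elementary
   tensors: for nondegenerate f this is the extension of f (x) iota (resp.
   iota (x) f) to multipliers. *)
Definition is_tens_id H H' K (A : set (H -> H)) (B : set (K -> K))
    (f : (H -> H) -> (H' -> H'))
    (F : (tp H K -> tp H K) -> (tp H' K -> tp H' K)) : Prop :=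
  star_hom (mult (ctens A B)) F /\
  forall a b, A a -> B b -> F (optens a b) = optens (f a) b.

Definition is_id_tens H K K' (A : set (H -> H)) (B : set (K -> K))
    (f : (K -> K) -> (K' -> K'))
    (F : (tp H K -> tp H K) -> (tp H K' -> tp H K')) : Prop :=
  star_hom (mult (ctens A B)) F /\
  forall a b, A a -> B b -> F (optens a b) = optens a (f b).

(* (iota (x) Delta_D) Delta_D = (Delta_G (x) iota) Delta_D *)
Definition coassociative H K (A : set (H -> H))
    (DeltaG : (H -> H) -> (tp H H -> tp H H))
    (D : set (K -> K)) (DeltaD : (K -> K) -> (tp H K -> tp H K)) : Prop :=
  exists F1 F2, [/\ is_tens_id A D DeltaG F1, is_id_tens A D DeltaD F2 &
    forall d, D d ->
      tassoc (H := H) (K := H) (L := K) \o F1 (DeltaD d) =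
      F2 (DeltaD d) \o tassoc (H := H) (K := H) (L := K)].

Definition compact_quantum_group H (A : set (H -> H))
    (DeltaG : (H -> H) -> (tp H H -> tp H H)) : Prop :=
  [/\ cstar_algebra A /\ A id,
      [/\ star_hom A DeltaG, DeltaG id = id &
          forall a, A a -> ctens A A (DeltaG a)],
      coassociative A DeltaG A DeltaG,
      cspan (opmul (DeltaG @` A) [set optens a id | a in A]) = ctens A A &
      cspan (opmul (DeltaG @` A) [set optens id a | a in A]) = ctens A A].

Definition haar_state H (A : set (H -> H))
    (DeltaG : (H -> H) -> (tp H H -> tp H H)) (phi : (H -> H) -> R[i]) : Prop :=
  state A phi /\
  forall a, A a -> lslice A A phi (DeltaG a) = phi a *: id /\
                   rslice A A phi (DeltaG a) = phi a *: id.

Definition G_cstar_algebra H K (A : set (H -> H))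
    (DeltaG : (H -> H) -> (tp H H -> tp H H))
    (D : set (K -> K)) (DeltaD : (K -> K) -> (tp H K -> tp H K)) : Prop :=
  [/\ cstar_algebra D /\ nondegenerate_on D,
      mor D (ctens A D) DeltaD,
      set_inj D DeltaD,
      coassociative A DeltaG D DeltaD &
      cspan (opmul (DeltaD @` D) [set optens a id | a in A]) = ctens A D].

Definition podles_QHS H K (A : set (H -> H))
    (DeltaG : (H -> H) -> (tp H H -> tp H H))
    (D : set (K -> K)) (DeltaD : (K -> K) -> (tp H K -> tp H K)) : Prop :=
  [/\ G_cstar_algebra A DeltaG D DeltaD, D id &
      [set d | D d /\ DeltaD d = optens id d] = @scalars R K].

Definition equivariant_iso H K K' (A : set (H -> H))
    (D : set (K -> K)) (DeltaD : (K -> K) -> (tp H K -> tp H K))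
    (D' : set (K' -> K')) (DeltaD' : (K' -> K') -> (tp H K' -> tp H K'))
    (pi : (K -> K) -> (K' -> K')) : Prop :=
  [/\ star_hom D pi, set_inj D pi, pi @` D = D' &
      exists F, is_id_tens A D pi F /\
        forall d, D d -> DeltaD' (pi d) = F (DeltaD d)].

(* C_0(D) acts on K, and its GNS space L^2(D) for rho is K'; pi is the GNS
   representation through which C_0(D) is viewed inside B(L^2(D)). *)
Definition von_neumann_version H K K' (A : set (H -> H))
    (phi : (H -> H) -> R[i]) (Lphi : (H -> H) -> H)
    (D : set (K -> K)) (DeltaD : (K -> K) -> (tp H K -> tp H K))
    (pi : (K -> K) -> (K' -> K'))
    (N : set (K' -> K')) (DeltaN : (K' -> K') -> (tp H K' -> tp H K')) : Prop :=
  exists rho (Lrho : (K -> K) -> K') (U : tp H K' -> tp H K'),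
  [/\ state D rho /\
        forall d, D d -> lslice A D phi (DeltaD d) = rho d *: id,
      is_gns D rho Lrho pi,
      unitary U /\
        forall a d, A a -> D d ->
          U (tens _ (Lphi a) (Lrho d)) =
          gns_tens A D Lphi Lrho (DeltaD d \o optens a id),
      N = sclosure (pi @` D) &
      forall x, N x -> DeltaN x = U \o optens id x \o adj U].

Definition Linf H (A : set (H -> H)) : set (H -> H) := sclosure A.

(* DG, F1 and F2 are the normal maps Delta_G on L^oo(G), Delta_G (x) iota and
   iota (x) Delta_N; normality makes them unique. *)
Definition vn_coassociative H K (A : set (H -> H))
    (DeltaG : (H -> H) -> (tp H H -> tp H H))
    (N : set (K -> K)) (DeltaN : (K -> K) -> (tp H K -> tp H K)) : Prop :=
  exists DG F1 F2,
  [/\ [/\ star_hom (Linf A) DG, normal_map (Linf A) DG &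
          forall a, A a -> DG a = DeltaG a],
      [/\ star_hom (vntens (Linf A) N) F1, normal_map (vntens (Linf A) N) F1 &
          forall m n, Linf A m -> N n -> F1 (optens m n) = optens (DG m) n],
      [/\ star_hom (vntens (Linf A) N) F2, normal_map (vntens (Linf A) N) F2 &
          forall m n, Linf A m -> N n -> F2 (optens m n) = optens m (DeltaN n)] &
      forall x, N x ->
        tassoc (H := H) (K := H) (L := K) \o F1 (DeltaN x) =
        F2 (DeltaN x) \o tassoc (H := H) (K := H) (L := K)].

Definition vn_coaction H K (A : set (H -> H))
    (DeltaG : (H -> H) -> (tp H H -> tp H H))
    (N : set (K -> K)) (DeltaN : (K -> K) -> (tp H K -> tp H K)) : Prop :=
  [/\ von_neumann_algebra N,
      star_hom N DeltaN /\ DeltaN id = id,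
      set_inj N DeltaN /\ normal_map N DeltaN,
      forall x, N x -> vntens (Linf A) N (DeltaN x) &
      vn_coassociative A DeltaG N DeltaN].

Definition ergodic H K (N : set (K -> K))
    (DeltaN : (K -> K) -> (tp H K -> tp H K)) : Prop :=
  [set x | N x /\ DeltaN x = optens id x] = @scalars R K.

(* Strictness of Delta_N : N -> L(H (x) B), with nets rendered as families
   indexed by a filtered type. *)
Definition strict H K (N : set (K -> K)) (B : set (K -> K))
    (DeltaN : (K -> K) -> (tp H K -> tp H K)) : Prop :=
  forall (I : Type) (F : set_system I), ProperFilter F ->
  forall (x : I -> (K -> K)) (y : K -> K) (C : R),
    (forall i, N (x i)) -> N y -> (forall i, opnorm (x i) <= C) ->
    (forall k, x i k @[i --> F] --> y k) ->
    (forall k, adj (x i) k @[i --> F] --> adj y k) ->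
  forall v : K -> tp H K, hmodule B v ->
    opnorm ((DeltaN (x i) \o v) - (DeltaN y \o v)) @[i --> F] --> (0 : R) /\
    opnorm ((DeltaN (adj (x i)) \o v) - (DeltaN (adj y) \o v)) @[i --> F]
      --> (0 : R).

Definition cstar_version H K (A : set (H -> H))
    (DeltaG : (H -> H) -> (tp H H -> tp H H))
    (N : set (K -> K)) (DeltaN : (K -> K) -> (tp H K -> tp H K))
    (D : set (K -> K)) (DeltaD : (K -> K) -> (tp H K -> tp H K)) : Prop :=
  [/\ G_cstar_algebra A DeltaG D DeltaD,
      D `<=` N /\ sclosure D = N,
      forall d, D d -> DeltaD d = DeltaN d,
      forall x, N x -> mult (ctens (@compact_op R H H) D) (DeltaN x) &
      strict N D DeltaN].

Definition QHS H K (A : set (H -> H))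
    (DeltaG : (H -> H) -> (tp H H -> tp H H))
    (N : set (K -> K)) (DeltaN : (K -> K) -> (tp H K -> tp H K)) : Prop :=
  [/\ vn_coaction A DeltaG N DeltaN, ergodic N DeltaN &
      exists D DeltaD, cstar_version A DeltaG N DeltaN D DeltaD].

End TensorProducts.

(* Main.v *)
(* The idea is that the whole situation is implemented by unitaries.  With
   L1 = Lambda_phi(1) and xi = Lambda_rho(1), the map f(x) = U (1 (x) x) U^* is
   defined on all bounded operators and is a multiple of the identity
   representation (an [ampl]); such maps are normal, carry strong closures into
   strong closures, and two of them that agree on pi(D) agree on N.  On pi(D) the
   map f is (iota (x) pi) Delta_D, where iota (x) pi is realised as a corner of
   iota (x) Delta_D, and iterated slices transfer the coassociativity of Delta_D.

   The multiplier and strictness properties rest on two facts.  First, for x in N,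
   f(x)(L1 (x) eta) = V (x xi (x) eta) for an isometry V independent of x, so that
   f(x)(L1 (x) .) lies in the Hilbert module and depends continuously on x xi.
   Secondly, f(x) commutes with a' (x) 1 for a' in A', and L1 is cyclic for A': if p
   is the projection onto the orthogonal of A' L1, then p lies in A'', the slices of
   Delta_G(p) lie in A and annihilate the separating vector L1, hence vanish.  So
   the statement at L1 propagates to all of L^2(G).

   If D' is another C*-version, then D' contains 1 because the L1-slices of
   Delta_N(D') are scalars, and an element of D' is a limit of L1-slices of sums of
   Delta_N(d_j)(a_j (x) 1), each of which lies in pi(D) by the multiplier property;
   the argument is symmetric in D' and pi(D). *)
Require Import Defs.
From HB Require Import structures.
From mathcomp Require Import all_boot all_order all_algebra.
From mathcomp Require Import all_classical all_reals topology normedtype.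
From mathcomp Require Import complex sesquilinear ring lra.

Set Implicit Arguments.
Unset Strict Implicit.
Unset Printing Implicit Defensive.

Import Order.TTheory GRing.Theory Num.Theory.
Import numFieldNormedType.Exports.

Local Open Scope classical_set_scope.
Local Open Scope complex_scope.
Local Open Scope ring_scope.

(** * Hilbert spaces and bounded operators *)
Section NormLayer.
Variable R : realType.
Local Notation C := R[i].

(** Strong approximants of x in N may be unbounded, and an infinite amplification is not strongly
    continuous on unbounded sets. Two devices stand in for Kaplansky density. The bicommutant
    theorem is proved directly inside an amplification; and f(x) is approximated at a given vector w
    and at Vz xi simultaneously, where Vz is an isometry intertwining x and f(x), so that a single b
    controls both f(x) w and x xi.

    The treatment of implemented actions keeps the algebra B0 that generates N apart from the
    coefficient algebra B. It thus serves for A acting on itself, at a stage where L1 is not yet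
    known to be cyclic for A', for pi(D), and for an unknown C*-version D'.

    D acts on K while N acts on L^2(D), and no map iota (x) pi is given; coassociativity of Delta_D
    supplies it because pi is equivalent to a subrepresentation of Delta_D. Faithfulness of rho is
    not among the data either: it comes from injectivity of Delta_D and cyclicity of L1 for A', and
    makes pi isometric with closed image. *)

Definition nrm (V : normedZmodType C) (x : V) : R := complex.Re `|x|.

(** Norms over [R[i]] take values in [R[i]]. The real-valued [nrm] carries the estimates, so that
    [lra] and [nra] can close them; this lemma is the bridge back. *)
Lemma nrmE (V : normedZmodType C) (x : V) : (nrm x)%:C = `|x|.
Proof. by rewrite /nrm RRe_real // ger0_real. Qed.

Lemma nrm_ge0 (V : normedZmodType C) (x : V) : 0 <= nrm x.
Proof. by rewrite -ler0c nrmE. Qed.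

Lemma nrm0 (V : normedZmodType C) : nrm (0 : V) = 0.
Proof. by rewrite /nrm normr0. Qed.

Lemma nrm_eq0 (V : normedZmodType C) (x : V) : nrm x = 0 -> x = 0.
Proof. by move=> x0; apply/eqP; rewrite -normr_eq0 -nrmE x0. Qed.

Lemma nrm_gt0 (V : normedZmodType C) (x : V) : x != 0 -> 0 < nrm x.
Proof.
move=> x0; rewrite lt_neqAle nrm_ge0 andbT eq_sym.
by apply: contra_neq x0; exact: nrm_eq0.
Qed.

Lemma nrmN (V : normedZmodType C) (x : V) : nrm (- x) = nrm x.
Proof. by rewrite /nrm normrN. Qed.

Lemma nrmB (V : normedZmodType C) (x y : V) : nrm (x - y) = nrm (y - x).
Proof. by rewrite /nrm distrC. Qed.

Lemma ler_nrmD (V : normedZmodType C) (x y : V) :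
  nrm (x + y) <= nrm x + nrm y.
Proof. by rewrite -lecR rmorphD /= !nrmE ler_normD. Qed.

Lemma ler_nrmB (V : normedZmodType C) (x y : V) :
  nrm (x - y) <= nrm x + nrm y.
Proof. by rewrite -(nrmN y) ler_nrmD. Qed.

Lemma ler_nrm_trans (V : normedZmodType C) (y x z : V) :
  nrm (x - z) <= nrm (x - y) + nrm (y - z).
Proof.
have -> : x - z = (x - y) + (y - z) by rewrite addrA subrK.
exact: ler_nrmD.
Qed.

Lemma ler_nrm_sub (V : normedZmodType C) (x y : V) :
  nrm x <= nrm (x - y) + nrm y.
Proof. by rewrite -{1}(subrK y x) ler_nrmD. Qed.

Lemma nrmZ (V : normedModType C) (c : C) (x : V) : nrm (c *: x) = nrm c * nrm x.
Proof. by apply: complexI; rewrite rmorphM /= !nrmE normrZ. Qed.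

Lemma nrmR (a : R) : nrm (a%:C) = `|a|.
Proof. by rewrite /nrm /= expr0n /= addr0 sqrtr_sqr. Qed.

Lemma nrmZR (V : normedModType C) (a : R) (x : V) : 0 <= a ->
  nrm (a%:C *: x) = a * nrm x.
Proof. by move=> a0; rewrite nrmZ nrmR ger0_norm. Qed.

Lemma ler_Re_nrm (c : C) : complex.Re c <= nrm c.
Proof.
have := normc_ge_Re c; rewrite -nrmE lecR => h.
exact: le_trans (ler_norm _) h.
Qed.

Lemma nrm_conj (c : C) : nrm (Num.conj c) = nrm c.
Proof. by rewrite /nrm norm_conjC. Qed.

Lemma nrm_sqC (c : C) : ((nrm c) ^+ 2)%:C = c * Num.conj c.
Proof. by rewrite rmorphXn /= nrmE normCK. Qed.

Lemma nrm_le0 (V : normedZmodType C) (x : V) :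
  (forall e : R, 0 < e -> nrm x <= e) -> x = 0.
Proof.
move=> h; apply: nrm_eq0; apply/eqP; rewrite eq_le nrm_ge0 andbT.
by apply/ler_addgt0Pr => e e0; rewrite add0r h.
Qed.

Lemma nbhs_nrmP (V : normedModType C) (x : V) (P : set V) :
  nbhs x P <-> exists2 e : R, 0 < e & forall y, nrm (x - y) < e -> P y.
Proof.
split.
  move=> /nbhs_ballP [e /= e0 h]; exists (complex.Re e).
    by rewrite -ltcR RRe_real // ger0_real // ltW.
  move=> y xy; apply: h; rewrite -ball_normE /ball_ /=.
  by rewrite -nrmE -(RRe_real (ger0_real (ltW e0))) ltcR.
move=> [e e0 h]; apply/nbhs_ballP; exists e%:C; first by rewrite /= ltcR.
by move=> y; rewrite -ball_normE /ball_ /= -nrmE ltcR => /h.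
Qed.

Lemma closure_nrmP (V : normedModType C) (S : set V) (x : V) :
  closure S x <-> forall e : R, 0 < e -> exists2 y, S y & nrm (x - y) < e.
Proof.
split=> [cl e e0|h B /nbhs_nrmP [e e0 eB]].
  have /cl [y [Sy xy]] : nbhs x [set y | nrm (x - y) < e].
    by apply/nbhs_nrmP; exists e.
  by exists y.
by have [y Sy xy] := h e e0; exists y; split=> //; exact: eB.
Qed.

Lemma closureT_nrmP (V : normedModType C) (S : set V) :
  closure S = setT <->
  forall x (e : R), 0 < e -> exists2 y, S y & nrm (x - y) < e.
Proof.
split=> [SE x|h]; first by apply/closure_nrmP; rewrite SE.
by rewrite -subTset => x _; apply/closure_nrmP; exact: h.
Qed.

Lemma cvg_nrmP (V : normedModType C) (F : set_system V) (x : V) :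
  Filter F ->
  F --> x <-> forall e : R, 0 < e -> F [set y | nrm (x - y) < e].
Proof.
move=> FF; split=> [Fx e e0|h B /nbhs_nrmP [e e0 eB]].
  by apply: Fx; apply/nbhs_nrmP; exists e.
by apply: filterS (h e e0) => y; exact: eB.
Qed.

Lemma cauchy_nrm_cvg (V : completeNormedModType C) (F : set_system V) :
  ProperFilter F ->
  (forall e : R, 0 < e -> exists2 B, F B &
     forall y z, B y -> B z -> nrm (y - z) < e) ->
  exists x : V, F --> x.
Proof.
move=> FF h; apply/cvg_ex; apply: cauchy_cvg; apply/cauchyP => e e0.
have e0' : 0 < complex.Re e by rewrite -ltcR RRe_real // ger0_real // ltW.
have [B FB Bh] := h _ e0'.
have [y By] := filter_ex FB.
exists y; apply: filterS FB => z Bz.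
rewrite -ball_normE /ball_ /= -nrmE -(RRe_real (ger0_real (ltW e0))) ltcR.
exact: Bh.
Qed.

Lemma cauchy_seq_cvg (V : completeNormedModType C) (u : nat -> V) :
  (forall e : R, 0 < e -> exists N, forall m n, (N <= m)%N -> (N <= n)%N ->
     nrm (u m - u n) < e) ->
  exists x : V, forall e : R, 0 < e -> exists N, forall n, (N <= n)%N ->
     nrm (x - u n) < e.
Proof.
move=> h; have [|x ux] := @cauchy_nrm_cvg V (u @ \oo) _.
  move=> e e0; have [N hN] := h e e0.
  exists [set u n | n in [set n | (N <= n)%N]].
    by exists N => //= n /= Nn; exists n.
  by move=> _ _ [m Nm <-] [n Nn <-]; apply: hN.
exists x => e e0; have /cvg_nrmP /(_ e e0) [N _ hN] := ux.
by exists N => n Nn; apply: hN.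
Qed.

End NormLayer.
Arguments ler_nrm_trans {R V} y x z.

(** * Inner products and the Cauchy-Schwarz inequality *)

Section Inner.
Variables (R : realType) (H : hilbert R).
Local Notation C := R[i].
Implicit Types x y z : H.

Lemma inDl x y z : inner (x + y) z = inner x z + inner y z.
Proof. exact: linearDl. Qed.
Lemma inDr x y z : inner z (x + y) = inner z x + inner z y.
Proof. exact: linearDr. Qed.
Lemma inNl x y : inner (- x) y = - inner x y.
Proof. exact: linearNl. Qed.
Lemma inNr x y : inner x (- y) = - inner x y.
Proof. exact: linearNr. Qed.
Lemma inBl x y z : inner (x - y) z = inner x z - inner y z.
Proof. by rewrite inDl inNl. Qed.
Lemma inBr x y z : inner z (x - y) = inner z x - inner z y.
Proof. by rewrite inDr inNr. Qed.
Lemma in0l x : inner 0 x = 0.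
Proof. exact: linear0l. Qed.
Lemma in0r x : inner x 0 = 0.
Proof. exact: linear0r. Qed.
Lemma inZl (c : C) x y : inner (c *: x) y = c * inner x y.
Proof. by rewrite linearZl. Qed.
Lemma inZr (c : C) x y : inner x (c *: y) = Num.conj c * inner x y.
Proof. by rewrite linearZr. Qed.
Lemma inC x y : inner y x = Num.conj (inner x y).
Proof. by rewrite hermC expr0 mul1r. Qed.
Lemma in_sumr (I : finType) (F : I -> H) y :
  inner y (\sum_i F i) = \sum_i inner y (F i).
Proof. by elim/big_ind2: _ => [|? ? ? ? <- <-|] //; rewrite ?in0r ?inDr. Qed.

Lemma in_nrm x : inner x x = (nrm x ^+ 2)%:C.
Proof. by rewrite inner_norm -nrmE rmorphXn. Qed.

Definition rin x y : R := complex.Re (inner x y).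

Lemma rin_sq x : rin x x = nrm x ^+ 2.
Proof. by rewrite /rin in_nrm. Qed.
Lemma rinC x y : rin y x = rin x y.
Proof. by rewrite /rin inC; case: (inner x y). Qed.
Lemma rinDl x y z : rin (x + y) z = rin x z + rin y z.
Proof. by rewrite /rin inDl raddfD. Qed.
Lemma rinDr x y z : rin z (x + y) = rin z x + rin z y.
Proof. by rewrite /rin inDr raddfD. Qed.
Lemma rinNl x y : rin (- x) y = - rin x y.
Proof. by rewrite /rin inNl raddfN. Qed.
Lemma rinNr x y : rin x (- y) = - rin x y.
Proof. by rewrite /rin inNr raddfN. Qed.
Lemma rinZl (a : R) x y : rin (a%:C *: x) y = a * rin x y.
Proof. by rewrite /rin inZl; case: (inner x y) => b c /=; rewrite mul0r subr0. Qed.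
Lemma rinZr (a : R) x y : rin x (a%:C *: y) = a * rin x y.
Proof. by rewrite rinC rinZl rinC. Qed.

Lemma nrm_sqD x y : nrm (x + y) ^+ 2 = nrm x ^+ 2 + 2 * rin x y + nrm y ^+ 2.
Proof. by rewrite -!rin_sq !(rinDl, rinDr) (rinC x y); ring. Qed.
Lemma nrm_sqB x y : nrm (x - y) ^+ 2 = nrm x ^+ 2 - 2 * rin x y + nrm y ^+ 2.
Proof. by rewrite nrm_sqD rinNr nrmN; ring. Qed.

Lemma rin_CS x y : rin x y <= nrm x * nrm y.
Proof.
have [->|y0] := eqVneq y 0; first by rewrite /rin in0r nrm0 mulr0.
have [->|x0] := eqVneq x 0; first by rewrite /rin in0l nrm0 mul0r.
(* This vector vanishes in the equality case; its squared norm expands to 2|x||y|(|x||y| -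
   Re(x,y)). *)
have := sqr_ge0 (nrm ((nrm y)%:C *: x - (nrm x)%:C *: y)).
rewrite nrm_sqB !nrmZR ?nrm_ge0// rinZl rinZr => h.
have := mulr_gt0 (nrm_gt0 x0) (nrm_gt0 y0); nra.
Qed.

Lemma in_CS x y : nrm (inner x y) <= nrm x * nrm y.
Proof.
set c := inner x y; have [c0|c0] := eqVneq c 0.
  by rewrite c0 nrm0 mulr_ge0 ?nrm_ge0.
have nc := nrm_gt0 c0.
(* Rotating x by the conjugate of c makes the inner product equal to |c|^2, so the real inequality
   applies. *)
have := rin_CS (Num.conj c *: x) y.
rewrite /rin inZl -/c mulrC -nrm_sqC /= nrmZ nrm_conj expr2 -mulrA ler_pM2l //.
Qed.

Lemma in_eq0 x : (forall y, inner x y = 0) -> x = 0.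
Proof.
move=> h; apply: nrm_eq0; have := h x; rewrite in_nrm => /(congr1 (@complex.Re R)) /=.
by move/eqP; rewrite sqrf_eq0 => /eqP.
Qed.

Lemma in_inj x y : (forall z, inner x z = inner y z) -> x = y.
Proof.
move=> h; apply/eqP; rewrite -subr_eq0; apply/eqP/in_eq0 => z.
by rewrite inBl h subrr.
Qed.

Lemma parallelogram x y :
  nrm (x + y) ^+ 2 + nrm (x - y) ^+ 2 = 2 * (nrm x ^+ 2 + nrm y ^+ 2).
Proof. by rewrite nrm_sqD nrm_sqB; ring. Qed.

Lemma in_total_eq0 (S : set H) x :
  closure (lspan S) = setT -> (forall s, S s -> inner x s = 0) -> x = 0.
Proof.
move=> /closureT_nrmP tot h.
have xs v : lspan S v -> inner x v = 0.
  move=> [n [c [s [Ss ->]]]]; rewrite in_sumr big1 // => i _.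
  by rewrite inZr h ?mulr0.
apply: nrm_eq0; apply/eqP; rewrite eq_le nrm_ge0 andbT.
apply/ler_addgt0Pr => e e0; rewrite add0r.
have [y Sy xy] := tot x e e0.
have [->|x0] := eqVneq x 0; first by rewrite nrm0 ltW.
have nx := nrm_gt0 x0.
have : nrm x ^+ 2 = rin x (x - y).
  by rewrite rinDr rinNr rin_sq /rin xs //= subr0.
have := rin_CS x (x - y); nra.
Qed.

End Inner.

(* Linear identities between vectors are reduced to ring identities in C by
   pairing with an arbitrary vector. *)
Ltac hring :=
  apply: in_inj => ?; rewrite ?(inDl, inNl, inZl, in0l); ring.

(** * Bounded operators and the operator norm *)

Section Bop.
Variable R : realType.
Local Notation C := R[i].
Implicit Types H K L : hilbert R.

Lemma bopP H K (T : H -> K) :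
  bop T <-> linear T /\ exists2 c : R, 0 <= c & forall x, nrm (T x) <= c * nrm x.
Proof.
split=> [[lT cT]|[lT [c c0 Tc]]].
  split=> //; pose f := GRing.isLinear.Build _ _ _ _ T lT.
  have T0 : T 0 = 0 by have := lT (-1) 0 0; rewrite !scaleN1r oppr0 addr0 addNr.
  have TZ a x : T (a *: x) = a *: T x by have := lT a x 0; rewrite T0 !addr0.
  have /nbhs_nrmP [d d0 hd] : nbhs (0 : H) (T @^-1` [set y | nrm (0 - y) < 1]).
    apply: (cT 0); rewrite T0; apply/nbhs_nrmP; exists 1 => //.
  exists (2 / d); first by rewrite divr_ge0 // ltW.
  move=> x; have [->|x0] := eqVneq x 0; first by rewrite T0 !nrm0 mulr0.
  have nx := nrm_gt0 x0.
  (* The vector a x has norm d/2, so |T(a x)| < 1 and |T x| < 1/a = (2/d)|x|. *)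
  pose a := d / (2 * nrm x).
  have a0 : 0 < a by rewrite divr_gt0 // mulr_gt0.
  have : nrm (0 - (a%:C *: x)) < d.
    rewrite sub0r nrmN nrmZR ?(ltW a0) // /a.
    have -> : d / (2 * nrm x) * nrm x = d / 2 by field; rewrite gt_eqF.
    lra.
  move/hd => /=; rewrite sub0r nrmN TZ nrmZR ?(ltW a0) // => h.
  have : nrm (T x) < a^-1 by rewrite -(ltr_pM2l a0) divff ?gt_eqF.
  rewrite /a invf_div => /ltW h2; apply: le_trans h2 _.
  by rewrite mulrAC.
split=> // x; apply/cvg_nrmP => e e0.
have c1 : 0 < c + 1 by lra.
apply/nbhs_nrmP; exists (e / (c + 1)); first by rewrite divr_gt0.
move=> y; rewrite ltr_pdivlMr // => xy /=.
have -> : T x - T y = T (x - y).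
  by rewrite addrC -scaleN1r -lT scaleN1r addrC.
have := Tc (x - y); have := nrm_ge0 (x - y); nra.
Qed.

Lemma bopD H K (T : H -> K) x y : bop T -> T (x + y) = T x + T y.
Proof. by move=> [lT _]; have := lT 1 x y; rewrite !scale1r. Qed.
Lemma bop0 H K (T : H -> K) : bop T -> T 0 = 0.
Proof. by move=> [lT _]; have := lT (-1) 0 0; rewrite !scaleN1r oppr0 addr0 addNr. Qed.
Lemma bopZ H K (T : H -> K) c x : bop T -> T (c *: x) = c *: T x.
Proof. by move=> bT; have [lT _] := bT; have := lT c x 0; rewrite (bop0 bT) !addr0. Qed.
Lemma bopN H K (T : H -> K) x : bop T -> T (- x) = - T x.
Proof. by move=> bT; rewrite -scaleN1r (bopZ _ _ bT) scaleN1r. Qed.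
Lemma bopB H K (T : H -> K) x y : bop T -> T (x - y) = T x - T y.
Proof. by move=> bT; rewrite bopD // bopN. Qed.
Lemma bop_sum H K (T : H -> K) (I : finType) (F : I -> H) : bop T ->
  T (\sum_i F i) = \sum_i T (F i).
Proof.
move=> bT; apply: (big_morph T) => [x y|]; [exact: bopD|exact: bop0].
Qed.

Lemma bop_bound H K (T : H -> K) (c : R) :
  linear T -> (forall x, nrm (T x) <= c * nrm x) -> bop T.
Proof.
move=> lT Tc; apply/bopP; split=> //; exists `|c|; first exact: normr_ge0.
move=> x; apply: le_trans (Tc x) _; rewrite ler_wpM2r ?nrm_ge0 //.
exact: ler_norm.
Qed.

Lemma bop_isom H K (T : H -> K) :
  linear T -> (forall x, nrm (T x) = nrm x) -> bop T.
Proof. by move=> lT Tc; apply: (bop_bound (c := 1)) => // x; rewrite mul1r Tc. Qed.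

Lemma bop_id H : bop (@id H).
Proof. by apply: bop_isom. Qed.

Lemma bop_cst0 H K : bop (0 : H -> K).
Proof.
apply: (bop_bound (c := 0)) => [a x y|x]; first by rewrite scaler0 addr0.
by rewrite nrm0 mul0r.
Qed.

Lemma bop_comp H K L (S : K -> L) (T : H -> K) : bop S -> bop T -> bop (S \o T).
Proof.
move=> /bopP [lS [c c0 Sc]] /bopP [lT [d d0 Td]].
apply: (bop_bound (c := c * d)) => [a x y|x /=]; first by rewrite /= lT lS.
by apply: le_trans (Sc _) _; rewrite -mulrA ler_wpM2l.
Qed.

Lemma bop_lc H K (a : C) (S T : H -> K) : bop S -> bop T -> bop (a *: S + T).
Proof.
move=> /bopP [lS [c c0 Sc]] /bopP [lT [d d0 Td]].
apply: (bop_bound (c := nrm a * c + d)) => [b x y|x /=].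
  rewrite /= !fctE lS lT !scalerDr !scalerA (mulrC b) !addrA; congr (_ + _).
  by rewrite -!addrA; congr (_ + _); rewrite addrC.
rewrite fctE; apply: le_trans (ler_nrmD _ _) _; rewrite mulrDl lerD // nrmZ -mulrA.
by rewrite ler_wpM2l ?nrm_ge0.
Qed.

Lemma bop_add H K (S T : H -> K) : bop S -> bop T -> bop (S + T).
Proof. by move=> bS bT; rewrite -[S]scale1r; exact: bop_lc. Qed.
Lemma bop_scale H K (a : C) (T : H -> K) : bop T -> bop (a *: T).
Proof. by move=> bT; rewrite -[_ *: _]addr0; apply: bop_lc => //; exact: bop_cst0. Qed.
Lemma bop_opp H K (T : H -> K) : bop T -> bop (- T).
Proof. by move=> bT; rewrite -scaleN1r; exact: bop_scale. Qed.
Lemma bop_sub H K (S T : H -> K) : bop S -> bop T -> bop (S - T).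
Proof. by move=> bS bT; apply: bop_add => //; exact: bop_opp. Qed.
Lemma opnorm_has_sup H K (T : H -> K) : bop T ->
  has_sup [set complex.Re `|T x| | x in [set x : H | `|x| <= 1]].
Proof.
move=> /bopP [lT [c c0 Tc]]; split; first by exists (nrm (T 0)), 0 => //=; rewrite normr0.
exists c => _ [x /= x1 <-]; apply: le_trans (Tc x) _.
have : nrm x <= 1 by rewrite -lecR nrmE.
have := nrm_ge0 x; nra.
Qed.

Lemma opnorm_ge0 H K (T : H -> K) : bop T -> 0 <= opnorm T.
Proof.
move=> bT; apply: le_trans (nrm_ge0 (T 0)) _.
by apply: sup_upper_bound (opnorm_has_sup bT) _ _; exists 0 => //=; rewrite normr0.
Qed.

Lemma ler_opnorm H K (T : H -> K) x : bop T -> nrm (T x) <= opnorm T * nrm x.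
Proof.
move=> bT; have [->|x0] := eqVneq x 0; first by rewrite bop0 // !nrm0 mulr0.
have nx := nrm_gt0 x0.
rewrite -ler_pdivrMr // mulrC -nrmZR ?invr_ge0 ?nrm_ge0 // -bopZ //.
apply: sup_upper_bound (opnorm_has_sup bT) _ _; exists ((nrm x)^-1%:C *: x) => //=.
by rewrite -nrmE (lecR _ 1) nrmZR ?invr_ge0 ?nrm_ge0 // mulVf ?gt_eqF.
Qed.

Lemma opnorm_le H K (T : H -> K) (c : R) : 0 <= c ->
  (forall x, nrm (T x) <= c * nrm x) -> opnorm T <= c.
Proof.
move=> c0 Tc; apply: ge_sup; first by exists (nrm (T 0)), 0 => //=; rewrite normr0.
move=> _ [x /= x1 <-]; apply: le_trans (Tc x) _.
have : nrm x <= 1 by rewrite -lecR nrmE.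
have := nrm_ge0 x; nra.
Qed.

Lemma opnormD H K (S T : H -> K) : bop S -> bop T ->
  opnorm (S + T) <= opnorm S + opnorm T.
Proof.
move=> bS bT; apply: opnorm_le => [|x]; first by rewrite addr_ge0 // opnorm_ge0.
by rewrite mulrDl; apply: le_trans (ler_nrmD _ _) _; rewrite lerD // ler_opnorm.
Qed.

Lemma opnorm0 H K : opnorm (0 : H -> K) = 0.
Proof.
apply/eqP; rewrite eq_le opnorm_ge0 ?andbT; last exact: bop_cst0.
by apply: opnorm_le => // x; rewrite nrm0 mul0r.
Qed.

Lemma opnorm_eq0 H K (T : H -> K) : bop T -> opnorm T = 0 -> T = 0.
Proof.
move=> bT T0; apply/funext => x; apply: nrm_eq0; apply/eqP.
by rewrite eq_le nrm_ge0 andbT; have := ler_opnorm x bT; rewrite T0 mul0r.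
Qed.

Lemma opnorm_le0 H K (T : H -> K) : bop T ->
  (forall e : R, 0 < e -> opnorm T <= e) -> T = 0.
Proof.
move=> bT h; apply: opnorm_eq0 => //; apply/eqP; rewrite eq_le opnorm_ge0 // andbT.
by apply/ler_addgt0Pr => e e0; rewrite add0r h.
Qed.

Lemma opnormN H K (T : H -> K) : opnorm (- T) = opnorm T.
Proof.
rewrite /opnorm; congr sup; apply/seteqP; split=> _ [x x1 <-]; exists x => //;
by rewrite ?fctE normrN.
Qed.

Lemma opnormBC H K (S T : H -> K) : opnorm (S - T) = opnorm (T - S).
Proof. by rewrite -opnormN opprB. Qed.

Lemma opnormZ H K (a : C) (T : H -> K) : bop T ->
  opnorm (a *: T) <= nrm a * opnorm T.
Proof.
move=> bT; apply: opnorm_le => [|x]; first by rewrite mulr_ge0 ?nrm_ge0 ?opnorm_ge0.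
by rewrite fctE nrmZ -mulrA ler_wpM2l ?nrm_ge0 ?ler_opnorm.
Qed.

Lemma opnormM H K L (S : K -> L) (T : H -> K) : bop S -> bop T ->
  opnorm (S \o T) <= opnorm S * opnorm T.
Proof.
move=> bS bT; apply: opnorm_le => [|x]; first by rewrite mulr_ge0 ?opnorm_ge0.
apply: le_trans (ler_opnorm _ bS) _.
by rewrite -mulrA ler_wpM2l ?opnorm_ge0 ?ler_opnorm.
Qed.

Lemma opnorm_trans H K (S T U : H -> K) : bop S -> bop T -> bop U ->
  opnorm (S - U) <= opnorm (S - T) + opnorm (T - U).
Proof.
move=> bS bT bU; have -> : S - U = (S - T) + (T - U) by rewrite addrA subrK.
by apply: opnormD; apply: bop_sub.
Qed.

Lemma bop_lspan_eq H K (S : set H) (T U : H -> K) : bop T -> bop U ->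
  (forall s, S s -> T s = U s) -> forall v, lspan S v -> T v = U v.
Proof.
move=> bT bU TU v [n [c [s [Ss ->]]]].
by rewrite !bop_sum //; apply: eq_bigr => i _; rewrite !bopZ // TU.
Qed.

Lemma bop_total_eq H K (S : set H) (T U : H -> K) :
  closure (lspan S) = setT -> bop T -> bop U ->
  (forall s, S s -> T s = U s) -> T = U.
Proof.
move=> /closureT_nrmP tot bT bU TU; apply/funext => x.
have bD := bop_sub bT bU.
apply/eqP; rewrite -subr_eq0; apply/eqP/nrm_le0 => e e0.
have c0 : 0 < opnorm (T - U) + 1 by have := opnorm_ge0 bD; lra.
have [|y Sy xy] := tot x (e / (opnorm (T - U) + 1)); first by rewrite divr_gt0.
have -> : T x - U x = (T - U) (x - y).
  by rewrite bopB // !fctE (bop_lspan_eq bT bU TU Sy) subrr subr0.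
move: xy; rewrite ltr_pdivlMr // => xy.
have := ler_opnorm (x - y) bD; have := nrm_ge0 (x - y).
have := opnorm_ge0 bD; nra.
Qed.

End Bop.

Section LspanGen.
Variable (R : realType).
Local Notation C := R[i].

Lemma lspan_self (V : lmodType C) (S : set V) : S `<=` lspan S.
Proof.
move=> v Sv; exists 1%N, (fun=> 1), (fun=> v); split=> //.
by rewrite big_ord1 scale1r.
Qed.

Lemma lspan0 (V : lmodType C) (S : set V) : lspan S 0.
Proof. by exists 0%N, (fun=> 0), (fun=> 0); split=> [[]|] //; rewrite big_ord0. Qed.

Lemma lspan_lc (V : lmodType C) (S : set V) (a : C) u v :
  lspan S u -> lspan S v -> lspan S (a *: u + v).
Proof.
move=> [n [c [s [Ss ->]]]] [m [d [t [St ->]]]].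
exists (n + m)%N, (fun i => match fintype.split i with inl j => a * c j | inr j => d j end),
  (fun i => match fintype.split i with inl j => s j | inr j => t j end); split.
  by move=> i; case: splitP.
rewrite big_split_ord /=; congr (_ + _).
  rewrite scaler_sumr; apply: eq_bigr => i _.
  by rewrite (unsplitK (inl i)) scalerA.
by apply: eq_bigr => i _; rewrite (unsplitK (inr i)).
Qed.

Lemma lspan_min (V : lmodType C) (S T : set V) :
  T 0 -> (forall a u v, T u -> T v -> T (a *: u + v)) -> S `<=` T ->
  lspan S `<=` T.
Proof.
move=> T0 Tl ST v [n [c [s [Ss ->]]]].
by elim/big_rec: _ => [|i w _ Tw] //; apply: Tl => //; exact: ST.
Qed.

Lemma lspan_mono (V : lmodType C) (S T : set V) : S `<=` T -> lspan S `<=` lspan T.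
Proof.
move=> ST; apply: lspan_min; [exact: lspan0|exact: lspan_lc|].
by move=> v /ST; exact: lspan_self.
Qed.

End LspanGen.

(** * Orthogonal projections onto closures of subspaces *)

Section Projection.
Variables (R : realType) (H : hilbert R).
Local Notation C := R[i].
Implicit Types (S : set H).

Definition subspace S := S 0 /\ forall (a : C) u v, S u -> S v -> S (a *: u + v).

Lemma subspaceD S u v : subspace S -> S u -> S v -> S (u + v).
Proof. by move=> [_ h] Su Sv; rewrite -[u]scale1r; exact: h. Qed.
Lemma subspaceZ S (a : C) u : subspace S -> S u -> S (a *: u).
Proof. by move=> [S0 h] Su; rewrite -[_ *: _]addr0; exact: h. Qed.
Lemma subspaceB S u v : subspace S -> S u -> S v -> S (u - v).
Proof. by move=> sS Su Sv; rewrite addrC -scaleN1r; case: sS => _; exact. Qed.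

Lemma subspace_lspan (S : set H) : subspace (lspan S).
Proof. by split; [exact: lspan0|exact: lspan_lc]. Qed.

Lemma subspace_closure S : subspace S -> subspace (closure S).
Proof.
move=> [S0 Sl]; split; first exact: subset_closure.
move=> a u v /closure_nrmP Su /closure_nrmP Sv; apply/closure_nrmP => e e0.
have a1 : 0 < nrm a + 1 by have := nrm_ge0 a; lra.
have [|u' Su' uu'] := Su (e / 2 / (nrm a + 1)); first by rewrite !divr_gt0.
have [|v' Sv' vv'] := Sv (e / 2); first by rewrite divr_gt0.
exists (a *: u' + v'); first exact: Sl.
have -> : a *: u + v - (a *: u' + v') = a *: (u - u') + (v - v').
  by rewrite scalerBr opprD addrACA.
apply: le_lt_trans (ler_nrmD _ _) _; rewrite nrmZ.
move: uu'; rewrite ltr_pdivlMr //.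
have := nrm_ge0 a; have := nrm_ge0 (u - u'); nra.
Qed.

Lemma closure_closure_nrm S x :
  (forall e : R, 0 < e -> exists2 y, closure S y & nrm (x - y) < e) -> closure S x.
Proof.
move=> h; apply/closure_nrmP => e e0.
have [|y /closure_nrmP cy xy] := h (e / 2); first by rewrite divr_gt0.
have [|z Sz yz] := cy (e / 2); first by rewrite divr_gt0.
exists z => //; apply: le_lt_trans (ler_nrm_trans y x z) _; lra.
Qed.

(** S is not assumed closed: near-minimisers of the distance to x, taken inside S, form a Cauchy
    filter by the parallelogram law, and its limit p lies in the closure. Orthogonality is the
    variational inequality at p. *)
Lemma proj_ex S : subspace S -> forall x,
  exists p, closure S p /\ forall s, S s -> inner (x - p) s = 0.
Proof.
move=> sS x; have [S0 Sl] := sS.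
pose E := [set nrm (x - s) ^+ 2 | s in S].
have Ei : has_inf E.
  split; first by exists (nrm (x - 0) ^+ 2), 0.
  by exists 0 => _ [s Ss <-]; rewrite sqr_ge0.
pose d := inf E.
have dS s : S s -> d <= nrm (x - s) ^+ 2.
  by move=> Ss; apply: inf_lbound; [case: Ei|exists s].
pose B e := [set s | S s /\ nrm (x - s) ^+ 2 < d + e].
have PF : ProperFilter (filter_from [set e : R | 0 < e] B).
  apply: filter_from_proper; last first.
    move=> e /= e0; have [_ [s Ss <-] h] := inf_adherent e0 Ei.
    by exists s; split.
  apply: filter_from_filter; first by exists 1; rewrite /= ltr01.
  move=> e f /= e0 f0; exists (Num.min e f); first by rewrite lt_min e0.
  move=> s [Ss h]; split; split=> //; apply: lt_le_trans h _; rewrite lerD2l ge_min lexx ?orbT //.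
have [|p Fp] := cauchy_nrm_cvg (F := filter_from [set e : R | 0 < e] B).
  (* The midpoint of s and t has squared distance at least d, so the parallelogram law gives |s -
     t|^2 < 2(2d + 2 e^2/4) - 4d = e^2. *)
  move=> e e0; exists (B (e ^+ 2 / 4)); first by exists (e ^+ 2 / 4) => //=; rewrite divr_gt0 ?exprn_gt0.
  move=> s t [Ss hs] [St ht].
  rewrite -(ltr_pXn2r (n := 2)) ?nnegrE ?nrm_ge0 ?ltW //.
  have := parallelogram (x - s) (x - t).
  have -> : x - s - (x - t) = t - s by hring.
  have -> : x - s + (x - t) = (2 : R)%:C *: (x - (1 / 2 : R)%:C *: (s + t)).
    rewrite scalerBr scalerA -rmorphM /= (_ : 2 * (1 / 2) = 1 :> R); last by field.
    rewrite scale1r (_ : (2:R)%:C = 1 + 1) ?scalerDl ?scale1r; last by rewrite -rmorphD.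
    by rewrite opprD addrACA.
  rewrite nrmZR ?ler0n // exprMn (nrmB s t).
  have := dS ((1 / 2 : R)%:C *: (s + t)) (subspaceZ _ sS (subspaceD sS Ss St)).
  lra.
have FB (e : R) : 0 < e -> exists2 s, B e s & nrm (p - s) < e.
  move=> e0; have /cvg_nrmP /(_ e e0) [f /= f0 hf] := Fp.
  have e2 : 0 < Num.min e f by rewrite lt_min e0.
  have [_ [s Ss <-] h] := inf_adherent e2 Ei.
  have [h1 h2] : nrm (x - s) ^+ 2 < d + e /\ nrm (x - s) ^+ 2 < d + f.
    by split; apply: lt_le_trans h _; rewrite lerD2l ge_min lexx ?orbT.
  by exists s; [|apply: hf].
have clp : closure S p.
  by apply/closure_nrmP => e e0; have [s [Ss _] ps] := FB e e0; exists s.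
exists p; split=> //.
have key s : S s -> d <= nrm (x - p - s) ^+ 2.
  move=> Ss; apply/ler_addgt0Pr => e e0.
  have [n0 n1] := (nrm_ge0 (x - p - s), nrm_ge0 (x - p - s)).
  (* When |p - t| < 1, one has |x - t - s|^2 <= |x - p - s|^2 + M |p - t|. *)
  pose M := 2 * nrm (x - p - s) + 1; have M0 : 0 < M by rewrite /M; lra.
  have [|t [St _] pt] := FB (Num.min 1 (e / M)); first by rewrite lt_min ltr01 divr_gt0.
  have := dS _ (subspaceD sS St Ss).
  have -> : x - (t + s) = (p - t) + (x - p - s).
    by hring.
  move/le_trans; apply.
  have h := ler_nrmD (p - t) (x - p - s).
  have n2 := nrm_ge0 (p - t + (x - p - s)).
  have n3 := nrm_ge0 (p - t).
  have [h1 h2] : nrm (p - t) < 1 /\ nrm (p - t) * M < e.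
    by move: pt; rewrite lt_min => /andP[-> ]; rewrite ltr_pdivlMr.
  rewrite /M in h2; nra.
have xp : nrm (x - p) ^+ 2 <= d.
  apply/ler_addgt0Pr => e e0.
  pose M := 2 * nrm (x - p) + 3.
  have n0 := nrm_ge0 (x - p).
  have M0 : 0 < M by rewrite /M; lra.
  have e1 : 0 < Num.min 1 (e / M) by rewrite lt_min ltr01 divr_gt0.
  have [s [Ss hs] ps] := FB _ e1.
  have h := ler_nrm_trans s x p; rewrite (nrmB s p) in h.
  have n2 := nrm_ge0 (x - s); have n3 := nrm_ge0 (p - s).
  have h3 := ler_nrm_trans p x s.
  set f := Num.min 1 (e / M) in e1 hs ps.
  have [h1 h2] : f <= 1 /\ f * M <= e.
    split; first by rewrite ge_min lexx.
    by rewrite -ler_pdivlMr // ge_min lexx orbT.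
  rewrite /M in h2; nra.
have re0 s : S s -> rin (x - p) s = 0.
  move=> Ss; have [s0|s0] := eqVneq s 0; first by rewrite s0 /rin in0r.
  have ns := nrm_gt0 s0.
  (* The real t that minimises |x - p - t s|; minimality of p forces it to be 0. *)
  pose t := rin (x - p) s / nrm s ^+ 2.
  have := key _ (subspaceZ t%:C sS Ss).
  rewrite (nrm_sqB (x - p)) rinZr nrmZ nrmR exprMn real_normK ?num_real // => h.
  have ts : t * nrm s ^+ 2 = rin (x - p) s by rewrite /t divfK // gt_eqF // exprn_gt0.
  have : t ^+ 2 * nrm s ^+ 2 = t * rin (x - p) s by rewrite -ts; ring.
  have n2 : 0 < nrm s ^+ 2 by rewrite exprn_gt0.
  move=> ht; have : t ^+ 2 * nrm s ^+ 2 <= 0 by move: xp; lra.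
  rewrite pmulr_lle0 // => t0.
  have /eqP : t ^+ 2 == 0 by rewrite eq_le t0 sqr_ge0.
  by move/eqP; rewrite sqrf_eq0 => /eqP t00; rewrite -ts t00 mul0r.
(* The real part of the inner product against ['i *: s] is its imaginary part against s. *)
move=> s Ss; have h1 := re0 s Ss; have h2 := re0 _ (subspaceZ 'i sS Ss).
move: h1 h2; rewrite /rin inZr; case: (inner _ _) => a b /=.
by move=> -> h; congr (_ +i* _); lra.
Qed.

Definition proj S x : H :=
  xget 0 [set p | closure S p /\ forall s, S s -> inner (x - p) s = 0].

Variable S : set H.
Hypothesis sS : subspace S.

Lemma proj_cl x : closure S (proj S x).
Proof. by have /(xgetPex 0) [] := proj_ex sS x. Qed.
Arguments proj_cl : clear implicits.

Lemma proj_orth x s : S s -> inner (x - proj S x) s = 0.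
Proof. by have /(xgetPex 0) [_] := proj_ex sS x; apply. Qed.

Lemma orth_closure y s : (forall t, S t -> inner y t = 0) -> closure S s ->
  inner y s = 0.
Proof.
move=> h /closure_nrmP cs; apply: nrm_le0 => e e0.
have y1 : 0 < nrm y + 1 by have := nrm_ge0 y; lra.
have [|t St st] := cs (e / (nrm y + 1)); first by rewrite divr_gt0.
have -> : inner y s = inner y (s - t) by rewrite inBr (h _ St) subr0.
apply: le_trans (in_CS _ _) _; move: st; rewrite ltr_pdivlMr //.
have := nrm_ge0 (s - t); have := nrm_ge0 y; nra.
Qed.

Lemma proj_orthc x s : closure S s -> inner (x - proj S x) s = 0.
Proof. by move=> cs; apply: orth_closure cs => t; exact: proj_orth. Qed.

Lemma proj_uniq x p : closure S p -> (forall s, S s -> inner (x - p) s = 0) ->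
  proj S x = p.
Proof.
move=> cp h; apply/eqP; rewrite -subr_eq0; apply/eqP; apply: nrm_eq0.
set z := proj S x - p.
have cz : closure S z.
  exact: (subspaceB (subspace_closure sS) (proj_cl x) cp).
have : inner z z = 0.
  have -> : inner z z = inner (x - p) z - inner (x - proj S x) z.
    rewrite -inBl; congr (inner _ _); rewrite /z; hring.
  by rewrite proj_orthc // (orth_closure h cz) subrr.
rewrite in_nrm => /(congr1 (@complex.Re R)) /= /eqP.
by rewrite sqrf_eq0 => /eqP.
Qed.

Lemma proj_id x : closure S x -> proj S x = x.
Proof. by move=> cx; apply: proj_uniq => // s _; rewrite subrr in0l. Qed.

Lemma proj_sa x y : inner (proj S x) y = inner x (proj S y).
Proof.
have h1 : inner (x - proj S x) (proj S y) = 0 by apply: proj_orthc; exact: proj_cl.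
have h2 : inner (y - proj S y) (proj S x) = 0 by apply: proj_orthc; exact: proj_cl.
have {}h2 : inner (proj S x) (y - proj S y) = 0 by rewrite inC h2 conjC0.
move: h1 h2; rewrite inBl inBr => /eqP; rewrite subr_eq0 => /eqP ->.
by move/eqP; rewrite subr_eq0 => /eqP.
Qed.

Lemma bop_proj : bop (proj S).
Proof.
apply: (bop_bound (c := 1)) => [a x y|x].
  apply: proj_uniq.
    by case: (subspace_closure sS) => _; apply; exact: proj_cl.
  move=> s Ss; have -> : a *: x + y - (a *: proj S x + proj S y) =
    a *: (x - proj S x) + (y - proj S y) by rewrite scalerBr opprD addrACA.
  by rewrite inDl inZl !proj_orth // mulr0 addr0.
rewrite mul1r.
have : nrm (proj S x) ^+ 2 = rin x (proj S x).
  by rewrite -rin_sq /rin proj_sa (proj_id (proj_cl x)).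
have := rin_CS x (proj S x); have := nrm_ge0 (proj S x); have := nrm_ge0 x; nra.
Qed.

End Projection.
Arguments proj_cl {R H S} sS x.

(** * Riesz representation and adjoints *)

Section Riesz.
Variables (R : realType) (H : hilbert R).
Local Notation C := R[i].

(** Boundedness makes the kernel of f closed, so some z outside it is orthogonal to it; f(z) x -
    f(x) z lies in the kernel, and pairing it with z reads off f(x). *)
Lemma riesz (f : H -> C) (c : R) :
  (forall a x y, f (a *: x + y) = a * f x + f y) ->
  (forall x, nrm (f x) <= c * nrm x) -> exists y, forall x, f x = inner x y.
Proof.
move=> lf bf.
have f0 : f 0 = 0 by have := lf (-1) 0 0; rewrite scaleN1r oppr0 addr0 mulN1r addNr.
have fB x y : f (x - y) = f x - f y by rewrite addrC -scaleN1r lf mulN1r addrC.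
have [[x0 fx0]|] := pselect (exists x, f x != 0); last first.
  move=> nf; exists 0 => x; rewrite in0r; apply/eqP/negbNE/negP => fx.
  by apply: nf; exists x.
pose S := [set x | f x = 0].
have sS : subspace S by split=> // a u v fu fv; rewrite /S /= lf fu fv mulr0 addr0.
have fcl p : closure S p -> f p = 0.
  move=> /closure_nrmP cp; apply: nrm_le0 => e e0.
  have c1 : 0 < `|c| + 1 by rewrite ltr_pwDr.
  have [|y Sy py] := cp (e / (`|c| + 1)); first by rewrite divr_gt0.
  have -> : f p = f (p - y) by rewrite fB Sy subr0.
  apply: le_trans (bf _) _; move: py; rewrite ltr_pdivlMr //.
  have := ler_norm c; have := nrm_ge0 (p - y); nra.
pose z := x0 - proj S x0.
have fz : f z = f x0 by rewrite fB (fcl _ (proj_cl sS x0)) subr0.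
have zz : inner z z != 0.
  apply: contra_neq fx0; rewrite in_nrm => h; rewrite -fz.
  have /eqP : nrm z ^+ 2 = 0 by move/(congr1 (@complex.Re R)): h.
  by rewrite sqrf_eq0 => /eqP /nrm_eq0 ->.
exists (Num.conj (f z / inner z z) *: z) => x.
rewrite inZr conjCK.
have : inner (f z *: x - f x *: z) z = 0.
  rewrite inC (proj_orth sS) ?conjC0 // /S /= fB -[f z *: x]addr0 lf.
  by rewrite -[f x *: z]addr0 lf f0 !addr0 mulrC subrr.
rewrite inBl !inZl => /eqP; rewrite subr_eq0 => /eqP h.
by rewrite mulrAC h mulfK.
Qed.

End Riesz.

Section Adjoint.
Variable R : realType.
Local Notation C := R[i].
Implicit Types H K L : hilbert R.

Lemma adj_ex H K (T : H -> K) : bop T ->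
  exists S : K -> H, bop S /\ forall x y, inner (T x) y = inner x (S y).
Proof.
move=> bT.
have h y : exists z, forall x, inner (T x) y = inner x z.
  apply: (riesz (f := fun x => inner (T x) y) (c := opnorm T * nrm y)) => [a u v|x].
    by rewrite bopD // bopZ // inDl inZl.
  apply: le_trans (in_CS _ _) _; rewrite mulrAC ler_wpM2r ?nrm_ge0 //.
  exact: ler_opnorm.
have [S hS] := choice h; exists S; split=> //.
apply: (bop_bound (c := opnorm T)) => [a u v|y].
  apply: in_inj => z; rewrite !(inC z); congr (Num.conj _).
  by rewrite -hS inDr inZr !hS inDr inZr.
have : nrm (S y) ^+ 2 <= opnorm T * nrm (S y) * nrm y.
  rewrite -rin_sq /rin -hS; apply: le_trans (ler_Re_nrm _) _.
  apply: le_trans (in_CS _ _) _; rewrite ler_wpM2r ?nrm_ge0 //.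
  exact: ler_opnorm.
have [->|s0] := eqVneq (S y) 0.
  by rewrite nrm0 mulr_ge0 ?nrm_ge0 ?opnorm_ge0.
by have := nrm_gt0 s0; nra.
Qed.

Lemma adjP H K (T : H -> K) : bop T ->
  bop (adj T) /\ forall x y, inner (T x) y = inner x (adj T y).
Proof. by move=> /adj_ex /(xgetPex (fun=> 0)). Qed.

Lemma bop_adj H K (T : H -> K) : bop T -> bop (adj T).
Proof. by case/adjP. Qed.
Lemma adjE H K (T : H -> K) x y : bop T -> inner (T x) y = inner x (adj T y).
Proof. by case/adjP => _; apply. Qed.
Lemma adjEr H K (T : H -> K) x y : bop T -> inner (adj T x) y = inner x (T y).
Proof. by move=> bT; rewrite inC -adjE // -inC. Qed.

Lemma adj_uniq H K (T : H -> K) (S : K -> H) : bop T ->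
  (forall x y, inner (T x) y = inner x (S y)) -> adj T = S.
Proof.
move=> bT h; apply/funext => y; apply: in_inj => z.
by rewrite !(inC z) -h -adjE.
Qed.

Lemma adjK H K (T : H -> K) : bop T -> adj (adj T) = T.
Proof.
by move=> bT; apply: adj_uniq => [|x y]; [exact: bop_adj|exact: adjEr].
Qed.

Lemma adj_id H : adj (@id H) = id.
Proof. by apply: adj_uniq => //; exact: bop_id. Qed.

Lemma adj_comp H K L (S : K -> L) (T : H -> K) : bop S -> bop T ->
  adj (S \o T) = adj T \o adj S.
Proof.
move=> bS bT; apply: adj_uniq => [|x y /=]; first exact: bop_comp.
by rewrite adjE // adjE.
Qed.

Lemma adj_lc H K (a : C) (S T : H -> K) : bop S -> bop T ->
  adj (a *: S + T) = Num.conj a *: adj S + adj T.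
Proof.
move=> bS bT; apply: adj_uniq => [|x y]; first exact: bop_lc.
by rewrite !fctE inDl inZl inDr inZr conjCK !adjE.
Qed.

Lemma adj0 H K : adj (0 : H -> K) = 0.
Proof.
by apply: adj_uniq => [|x y]; [exact: bop_cst0|rewrite in0l in0r].
Qed.

Lemma adjD H K (S T : H -> K) : bop S -> bop T -> adj (S + T) = adj S + adj T.
Proof. by move=> bS bT; rewrite -[S in LHS]scale1r adj_lc // conjC1 scale1r. Qed.
Lemma adjZ H K (a : C) (T : H -> K) : bop T -> adj (a *: T) = Num.conj a *: adj T.
Proof.
move=> bT; rewrite -[_ *: T]addr0 adj_lc // ?adj0 ?addr0 //; exact: bop_cst0.
Qed.
Lemma adjN H K (T : H -> K) : bop T -> adj (- T) = - adj T.
Proof.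
move=> bT; apply: adj_uniq => [|x y]; first exact: bop_opp.
by rewrite !fctE inNl inNr adjE.
Qed.
Lemma adjB H K (S T : H -> K) : bop S -> bop T -> adj (S - T) = adj S - adj T.
Proof. by move=> bS bT; rewrite adjD ?adjN //; exact: bop_opp. Qed.

Lemma opnorm_adj_le H K (T : H -> K) : bop T -> opnorm (adj T) <= opnorm T.
Proof.
move=> bT; apply: opnorm_le => [|y]; first exact: opnorm_ge0.
have : nrm (adj T y) ^+ 2 <= opnorm T * nrm (adj T y) * nrm y.
  rewrite -rin_sq /rin -adjE //; apply: le_trans (ler_Re_nrm _) _.
  apply: le_trans (in_CS _ _) _; rewrite ler_wpM2r ?nrm_ge0 //.
  exact: ler_opnorm.
have [->|s0] := eqVneq (adj T y) 0.
  by rewrite nrm0 mulr_ge0 ?nrm_ge0 ?opnorm_ge0.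
by have := nrm_gt0 s0; nra.
Qed.

Lemma opnorm_adj H K (T : H -> K) : bop T -> opnorm (adj T) = opnorm T.
Proof.
move=> bT; apply/eqP; rewrite eq_le opnorm_adj_le //=.
by rewrite -{1}(adjK bT) opnorm_adj_le //; exact: bop_adj.
Qed.

Lemma nrm_adjM H K (T : H -> K) x : bop T ->
  nrm (T x) ^+ 2 = rin ((adj T \o T) x) x.
Proof. by move=> bT; rewrite -rin_sq /rin /= adjEr. Qed.

End Adjoint.

(** * Norm-closed spaces of operators and density arguments *)

Section ClosedSubspaces.
Variable R : realType.
Local Notation C := R[i].
Implicit Types H K L : hilbert R.

(** A density argument exhibits the good operators as such a set, which contains the [cspan] of
    every generating set it contains. *)
Definition nsub H K (P : set (H -> K)) :=
  [/\ P `<=` @bop R H K, P 0,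
      forall (a : C) S T, P S -> P T -> P (a *: S + T) & nclosure P `<=` P].

(** Maps between operator spaces are total functions that are meaningful only on [Dm], so bounded
    linearity is asked on [Dm] alone. *)
Definition blin H K H' K' (Dm : set (H -> K)) (f : (H -> K) -> (H' -> K')) :=
  [/\ forall T, Dm T -> bop (f T),
      forall (a : C) S T, Dm S -> Dm T -> f (a *: S + T) = a *: f S + f T &
      exists2 c : R, 0 <= c & forall T, Dm T -> opnorm (f T) <= c * opnorm T].

Lemma nsub_bop H K : nsub (@bop R H K).
Proof.
split=> //; [exact: bop_cst0|by move=> a S T; exact: bop_lc|by move=> T []].
Qed.

Lemma nsubD H K (P : set (H -> K)) S T : nsub P -> P S -> P T -> P (S + T).
Proof. by move=> [_ _ Pl _] PS PT; rewrite -[S]scale1r; exact: Pl. Qed.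
Lemma nsubZ H K (P : set (H -> K)) (a : C) T : nsub P -> P T -> P (a *: T).
Proof. by move=> [_ P0 Pl _] PT; rewrite -[_ *: T]addr0; exact: Pl. Qed.
Lemma nsubB H K (P : set (H -> K)) S T : nsub P -> P S -> P T -> P (S - T).
Proof. by move=> [_ _ Pl _] PS PT; rewrite addrC -scaleN1r; exact: Pl. Qed.

Lemma nclosure_self H K (S : set (H -> K)) : S `<=` @bop R H K -> S `<=` nclosure S.
Proof.
move=> Sb T ST; split=> [|e e0]; first exact: Sb.
by exists T => //; rewrite subrr opnorm0.
Qed.

Lemma nclosure_mono H K (S T : set (H -> K)) : S `<=` T -> nclosure S `<=` nclosure T.
Proof. by move=> ST X [bX h]; split=> // e /h [s /ST]; exists s. Qed.

Lemma nsub_nclosure H K (S : set (H -> K)) : S `<=` @bop R H K -> S 0 ->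
  (forall (a : C) u v, S u -> S v -> S (a *: u + v)) -> nsub (nclosure S).
Proof.
move=> Sb S0 Sl; split.
- by move=> T [].
- exact: nclosure_self.
- move=> a u v [bu hu] [bv hv]; split=> [|e e0]; first exact: bop_lc.
  have a1 : 0 < nrm a + 1 by have := nrm_ge0 a; lra.
  have [|u' Su' uu'] := hu (e / 2 / (nrm a + 1)); first by rewrite !divr_gt0.
  have [|v' Sv' vv'] := hv (e / 2); first by rewrite divr_gt0.
  exists (a *: u' + v'); first exact: Sl.
  have -> : a *: u + v - (a *: u' + v') = a *: (u - u') + (v - v').
    by rewrite scalerBr opprD addrACA.
  have bu' := bop_sub bu (Sb _ Su'); have bv' := bop_sub bv (Sb _ Sv').
  apply: le_lt_trans (opnormD (bop_scale a bu') bv') _.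
  have := opnormZ a bu'; move: uu'; rewrite ltr_pdivlMr //.
  have := nrm_ge0 a; have := opnorm_ge0 bu'; nra.
- move=> T [bT h]; split=> // e e0.
  have [|u [bu hu] Tu] := h (e / 2); first by rewrite divr_gt0.
  have [|v Sv uv] := hu (e / 2); first by rewrite divr_gt0.
  exists v => //; apply: le_lt_trans (opnorm_trans bT bu (Sb _ Sv)) _; lra.
Qed.

Lemma lspan_bop H K (S : set (H -> K)) : S `<=` @bop R H K -> lspan S `<=` @bop R H K.
Proof. by apply: lspan_min; [exact: bop_cst0|move=> a u v; exact: bop_lc]. Qed.

Lemma nsub_cspan H K (S : set (H -> K)) : S `<=` @bop R H K -> nsub (cspan S).
Proof.
by move=> Sb; apply: nsub_nclosure; [exact: lspan_bop|exact: lspan0|exact: lspan_lc].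
Qed.

Lemma cspan_self H K (S : set (H -> K)) : S `<=` @bop R H K -> S `<=` cspan S.
Proof.
move=> Sb T ST; apply: nclosure_self; [exact: lspan_bop|exact: lspan_self].
Qed.

Lemma cspan_min H K (S P : set (H -> K)) : nsub P -> S `<=` P -> cspan S `<=` P.
Proof.
move=> [Pb P0 Pl Pc] SP T cT; apply: Pc; apply: nclosure_mono cT.
exact: lspan_min.
Qed.

Lemma cspan_mono H K (S T : set (H -> K)) : S `<=` T -> cspan S `<=` cspan T.
Proof. by move=> ST; apply: nclosure_mono; exact: lspan_mono. Qed.

Lemma nsub_pre H K H' K' (Dm : set (H -> K)) (P : set (H' -> K')) f :
  nsub Dm -> nsub P -> blin Dm f -> nsub [set T | Dm T /\ P (f T)].
Proof.
move=> [Db D0 Dl Dc] [Pb P0 Pl Pc] [fb fl [c c0 fc]]; split.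
- by move=> T [/Db].
- split=> //; have := fl (-1) 0 0 D0 D0.
  by rewrite !scaleN1r oppr0 addr0 addNr => ->.
- by move=> a S T [DS PS] [DT PT]; split; [exact: Dl|rewrite fl //; exact: Pl].
- move=> T h; have DT : Dm T by apply: Dc; apply: nclosure_mono h => ? [].
  split=> //; apply: Pc; split; first exact: fb.
  move=> e e0; have c1 : 0 < c + 1 by lra.
  case: h => bT /(_ (e / (c + 1))) [|s [Ds Ps] Ts]; first by rewrite divr_gt0.
  exists (f s) => //.
  have Dd : Dm (T - s) by apply: nsubB.
  have -> : f T - f s = f (T - s).
    have -> : T - s = -1 *: s + T by rewrite scaleN1r addrC.
    by rewrite fl // scaleN1r addrC.
  apply: le_lt_trans (fc _ Dd) _; move: Ts; rewrite ltr_pdivlMr //.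
  have := opnorm_ge0 (Db _ Dd); nra.
Qed.

Lemma nsub0 H K : nsub [set 0 : H -> K].
Proof.
split=> //= [T ->|a S T -> ->|T [bT h]]; first exact: bop_cst0.
  by rewrite scaler0 addr0.
by apply: opnorm_le0 => // e /h [s /= ->]; rewrite subr0 => /ltW.
Qed.

Lemma blin_sub H K H' K' (Dm : set (H -> K)) (f g : (H -> K) -> (H' -> K')) :
  blin Dm f -> blin Dm g -> blin Dm (fun T => f T - g T).
Proof.
move=> [fb fl [c c0 fc]] [gb gl [d d0 gd]]; split.
- by move=> T DT; apply: bop_sub; [exact: fb|exact: gb].
- by move=> a S T DS DT; rewrite fl // gl // scalerBr opprD addrACA.
- exists (c + d) => [|T DT]; first by rewrite addr_ge0.
  have bg := bop_opp (gb _ DT).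
  apply: le_trans (opnormD (fb _ DT) bg) _.
  by rewrite opnormN mulrDl lerD ?fc ?gd.
Qed.

Lemma blin_comp H K H' K' H2 K2 (Dm : set (H -> K)) (Dm' : set (H' -> K'))
    (f : (H -> K) -> (H' -> K')) (g : (H' -> K') -> (H2 -> K2)) :
  blin Dm f -> (forall T, Dm T -> Dm' (f T)) -> blin Dm' g ->
  blin Dm (fun T => g (f T)).
Proof.
move=> [fb fl [c c0 fc]] fD [gb gl [d d0 gd]]; split.
- by move=> T DT; apply/gb/fD.
- by move=> a S T DS DT; rewrite fl // gl //; exact: fD.
- exists (d * c) => [|T DT]; first by rewrite mulr_ge0.
  apply: le_trans (gd _ (fD _ DT)) _; rewrite -mulrA ler_wpM2l //; exact: fc.
Qed.

Lemma blin_postc H K H' (Dm : set (H -> K)) (V : K -> H') :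
  Dm `<=` @bop R H K -> bop V -> blin Dm (fun T => V \o T).
Proof.
move=> Db bV; split.
- by move=> T /Db bT; exact: bop_comp.
- by move=> a S T _ _; apply/funext => x; rewrite !fctE /= bopD ?bopZ.
- by exists (opnorm V) => [|T /Db bT]; [exact: opnorm_ge0|exact: opnormM].
Qed.

Lemma blin_prec H K H' (Dm : set (H -> K)) (V : H' -> H) :
  Dm `<=` @bop R H K -> bop V -> blin Dm (fun T => T \o V).
Proof.
move=> Db bV; split.
- by move=> T /Db bT; exact: bop_comp.
- by move=> a S T _ _; apply/funext.
- by exists (opnorm V) => [|T /Db bT]; [exact: opnorm_ge0|rewrite mulrC; exact: opnormM].
Qed.

Lemma blin_conj H K H' K' (Dm : set (H -> K)) (V : H' -> H) (W : K -> K') :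
  Dm `<=` @bop R H K -> bop V -> bop W -> blin Dm (fun T => W \o T \o V).
Proof.
move=> Db bV bW; have h T : Dm T -> bop (W \o T) by move=> /Db; exact: bop_comp.
exact: blin_comp (blin_postc Db bW) h (blin_prec (fun=> id) bV).
Qed.

(** The operators at which f and g agree are the preimage of 0 under the bounded map f - g, hence a
    closed subspace. Identities on C*-tensor products are checked on elementary tensors in this
    way. *)
Lemma blin_cspan_eq H K H' K' (Dm S : set (H -> K)) (f g : (H -> K) -> (H' -> K')) :
  nsub Dm -> S `<=` Dm -> blin Dm f -> blin Dm g ->
  (forall T, S T -> f T = g T) -> forall T, cspan S T -> f T = g T.
Proof.
move=> nD SD bf bg fg T cT.
suff [_ /= /eqP] : [set T | Dm T /\ [set 0] (f T - g T)] T.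
  by rewrite subr_eq0 => /eqP.
move: cT; apply: cspan_min.
  exact: nsub_pre nD (@nsub0 _ _) (blin_sub bf bg).
by move=> X SX; split; [exact: SD|rewrite /= fg // subrr].
Qed.

Lemma blin_cspan_sub H K H' K' (Dm S : set (H -> K)) (P : set (H' -> K')) f :
  nsub Dm -> S `<=` Dm -> blin Dm f -> nsub P ->
  (forall T, S T -> P (f T)) -> forall T, cspan S T -> P (f T).
Proof.
move=> nD SD bf nP fP T cT.
suff [] : [set T | Dm T /\ P (f T)] T by [].
move: cT; apply: cspan_min; first exact: nsub_pre.
by move=> X SX; split; [exact: SD|exact: fP].
Qed.

(** The limit is built pointwise, and the Cauchy estimate |u_m x - u_n x| <= e |x| passes to it. It
    serves the square root iteration and the closedness of pi(D). *)
Lemma op_complete H K (u : nat -> H -> K) : (forall n, bop (u n)) ->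
  (forall e : R, 0 < e -> exists N, forall m n, (N <= m)%N -> (N <= n)%N ->
     opnorm (u m - u n) < e) ->
  exists2 T, bop T & forall e : R, 0 < e -> exists N, forall n, (N <= n)%N ->
     opnorm (T - u n) < e.
Proof.
move=> bu h.
have bs m n : bop (u m - u n) by exact: bop_sub.
have hx x : exists z, forall e : R, 0 < e -> exists N, forall n,
    (N <= n)%N -> nrm (z - u n x) < e.
  apply: (cauchy_seq_cvg (u := fun n => u n x)) => e e0.
  have x1 : 0 < nrm x + 1 by have := nrm_ge0 x; lra.
  have [|N hN] := h (e / (nrm x + 1)); first by rewrite divr_gt0.
  exists N => m n Nm Nn; have := hN m n Nm Nn; rewrite ltr_pdivlMr //.
  have := ler_opnorm x (bs m n); rewrite !fctE.
  have := opnorm_ge0 (bs m n); have := nrm_ge0 x; nra.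
have [T hT] := choice hx.
have hle (e : R) N : (forall m n, (N <= m)%N -> (N <= n)%N -> opnorm (u m - u n) < e) ->
    forall n x, (N <= n)%N -> nrm (T x - u n x) <= e * nrm x.
  move=> hN n x Nn; apply/ler_addgt0Pr => d d0.
  have [M hM] := hT x d d0; have := hM (maxn N M) (leq_maxr _ _).
  have := ler_nrm_trans (u (maxn N M) x) (T x) (u n x).
  have := ler_opnorm x (bs (maxn N M) n); rewrite !fctE.
  have := hN (maxn N M) n (leq_maxl _ _) Nn.
  have := nrm_ge0 x; nra.
have lT : linear T.
  move=> a x y; apply/eqP; rewrite -subr_eq0; apply/eqP/nrm_le0 => e e0.
  have a1 : 0 < nrm a + 2 by have := nrm_ge0 a; lra.
  have d0 : 0 < e / (nrm a + 2) by rewrite divr_gt0.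
  set d := e / (nrm a + 2) in d0.
  have da : d * (nrm a + 2) = e by rewrite /d divfK // gt_eqF.
  have [N1 h1] := hT x d d0; have [N2 h2] := hT y d d0.
  have [N3 h3] := hT (a *: x + y) d d0.
  pose n := maxn N1 (maxn N2 N3).
  have {}h1 := h1 n (leq_maxl _ _).
  have {}h2 := h2 n (leq_trans (leq_maxl _ _) (leq_maxr _ _)).
  have {}h3 := h3 n (leq_trans (leq_maxr _ _) (leq_maxr _ _)).
  have -> : T (a *: x + y) - (a *: T x + T y) =
     (T (a *: x + y) - u n (a *: x + y)) - (a *: (T x - u n x) + (T y - u n y)).
    by rewrite (bopD _ _ (bu n)) (bopZ _ _ (bu n)); hring.
  apply: le_trans (ler_nrmB _ _) _.
  have := ler_nrmD (a *: (T x - u n x)) (T y - u n y); rewrite nrmZ.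
  have := nrm_ge0 a; have := nrm_ge0 (T x - u n x); nra.
have bT : bop T.
  have [N hN] := h 1 ltr01.
  have -> : T = (T - u N) + u N by rewrite subrK.
  apply: bop_add => //; apply: (bop_bound (c := 1)) => [a x y|x].
    by rewrite !fctE lT (bopD _ _ (bu N)) (bopZ _ _ (bu N)); hring.
  exact: hle hN N x (leqnn _).
exists T => // e e0; have [|N hN] := h (e / 2); first by rewrite divr_gt0.
exists N => n Nn; apply: le_lt_trans (_ : e / 2 < e); last by lra.
apply: opnorm_le => [|x]; first by rewrite divr_ge0 // ltW.
exact: (hle _ _ hN).
Qed.

End ClosedSubspaces.

(** * Square roots and homomorphisms of C*-algebras *)
Section Positive.
Variables (R : realType) (H : hilbert R).
Local Notation C := R[i].
Implicit Types T S X Y : H -> H.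

Definition pos T := [/\ bop T, adj T = T & forall v, 0 <= rin (T v) v].

Lemma rin_sa T x y : bop T -> adj T = T -> rin (T x) y = rin (T y) x.
Proof. by move=> bT sT; rewrite /rin adjE // sT -/(rin x (T y)) rinC. Qed.

Lemma pos_CS Y u v : pos Y -> rin (Y u) v ^+ 2 <= rin (Y u) u * rin (Y v) v.
Proof.
move=> [bY sY pY].
have q (a b : R) : 0 <= a ^+ 2 * rin (Y u) u + 2 * a * b * rin (Y u) v + b ^+ 2 * rin (Y v) v.
  have := pY (a%:C *: u + b%:C *: v).
  rewrite (bopD _ _ bY) !(bopZ _ _ bY) !rinDl !rinDr !rinZl !rinZr (rin_sa v u bY sY).
  congr (_ <= _); ring.
have hu := pY u; have hv := pY v.
set A := rin (Y u) u in q hu *; set B := rin (Y v) v in q hv *.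
set c := rin (Y u) v in q *.
have [B0|B0] := eqVneq B 0.
  rewrite B0 mulr0; have [->|c0] := eqVneq c 0; first by rewrite expr0n.
  (* With B = 0 the quadratic polynomial is affine in b; at this b it equals -A - 2, which is
     negative. *)
  have := q 1 (- (A + 1) / c); rewrite B0 mulr0 addr0 -mulrA divfK //; lra.
have {hv} hv : 0 < B by rewrite lt_neqAle eq_sym B0.
have := q B (- c); nra.
Qed.

(** Cauchy-Schwarz for the form (Yu, v) at v = Yx. It turns smallness of (Yx, x) into smallness of
    Yx without a square root of Y. *)
Lemma pos_sq_le Y c x : pos Y -> opnorm Y <= c ->
  nrm (Y x) ^+ 2 <= c * rin (Y x) x.
Proof.
move=> pY Yc; have [bY sY p] := pY.
have := pos_CS x (Y x) pY; rewrite rin_sq => h.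
have h2 : rin (Y (Y x)) (Y x) <= c * nrm (Y x) ^+ 2.
  apply: le_trans (rin_CS _ _) _; rewrite expr2 mulrA ler_wpM2r ?nrm_ge0 //.
  apply: le_trans (ler_opnorm _ bY) _; rewrite ler_wpM2r ?nrm_ge0 //.
have [y0|y0] := eqVneq (Y x) 0.
  rewrite y0 nrm0 /rin in0l /= mulr0; lra.
have ny : 0 < nrm (Y x) ^+ 2 by rewrite exprn_gt0 ?nrm_gt0.
have := p x; nra.
Qed.

(** [pos_sq_le] and the bound on the form give |Y|^2 <= c |Y|. *)
Lemma opnorm_sa_le Y c : pos Y -> 0 <= c -> (forall x, rin (Y x) x <= c * nrm x ^+ 2) ->
  opnorm Y <= c.
Proof.
move=> pY c0 h; have [bY sY p] := pY.
have le1 x : nrm (Y x) ^+ 2 <= opnorm Y * c * nrm x ^+ 2.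
  apply: le_trans (pos_sq_le x pY (lexx _)) _; rewrite -mulrA.
  by rewrite ler_wpM2l ?opnorm_ge0.
have : opnorm Y <= Num.sqrt (opnorm Y * c).
  apply: opnorm_le => [|x]; first exact: sqrtr_ge0.
  rewrite -(ler_pXn2r (n := 2)) ?nnegrE ?mulr_ge0 ?nrm_ge0 ?sqrtr_ge0 //.
  by rewrite exprMn sqr_sqrtr ?mulr_ge0 ?opnorm_ge0.
have o0 := opnorm_ge0 bY.
rewrite -(ler_pXn2r (n := 2)) ?nnegrE ?sqrtr_ge0 // sqr_sqrtr ?mulr_ge0 // expr2.
have [-> //|o1] := eqVneq (opnorm Y) 0.
by rewrite ler_pM2l // lt_neqAle eq_sym o1.
Qed.

Lemma pos_adjM (K : hilbert R) (T : H -> K) : bop T -> pos (adj T \o T).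
Proof.
move=> bT; have bA := bop_adj bT; split; first exact: bop_comp.
  by rewrite adj_comp // adjK.
by move=> v; rewrite -nrm_adjM // sqr_ge0.
Qed.

Lemma pos_sqr T : bop T -> adj T = T -> pos (T \o T).
Proof. by move=> bT sT; rewrite -{1}sT; exact: pos_adjM. Qed.

Lemma pos_add S T : pos S -> pos T -> pos (S + T).
Proof.
move=> [bS sS pS] [bT sT pT]; split; first exact: bop_add.
  by rewrite adjD // sS sT.
by move=> v; rewrite !fctE rinDl addr_ge0.
Qed.

Lemma pos_scale (a : R) T : 0 <= a -> pos T -> pos (a%:C *: T).
Proof.
move=> a0 [bT sT pT]; split; first exact: bop_scale.
  by rewrite adjZ // sT; congr (_ *: _); rewrite conj_Creal // complex_real.
by move=> v; rewrite !fctE rinZl mulr_ge0.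
Qed.

Lemma pos_id : pos (@id H).
Proof.
split; [exact: bop_id|exact: adj_id|by move=> v; rewrite rin_sq sqr_ge0].
Qed.

(** For w = (S - T)v the hypotheses give (Sw, w) + (Tw, w) = ((S^2 - T^2)v, w) = 0, so Sw = Tw = 0,
    and |w|^2 = ((S - T)w, v) = 0. *)
Lemma pos_sqrt_uniq S T : pos S -> pos T -> S \o T = T \o S ->
  S \o S = T \o T -> S = T.
Proof.
move=> pS pT cST e2; have [bS sS _] := pS; have [bT sT _] := pT.
have bD := bop_sub bS bT.
have sD : adj (S - T) = S - T by rewrite adjB // sS sT.
have D0 v : S ((S - T) v) = 0 /\ T ((S - T) v) = 0.
  set w := (S - T) v.
  have : rin (S w) w + rin (T w) w = 0.
    rewrite -rinDl; have -> : S w + T w = 0.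
      have := congr1 (fun f => f v) cST; have := congr1 (fun f => f v) e2.
      rewrite /w !fctE (bopB _ _ bS) (bopB _ _ bT) /= => -> ->.
      by rewrite addrA subrK subrr.
    by rewrite /rin in0l.
  case: pS pT => [_ _ p1] [_ _ p2] h.
  have h1 := p1 w; have h2 := p2 w.
  have z1 : rin (S w) w = 0 by lra.
  have z2 : rin (T w) w = 0 by lra.
  split; apply: nrm_eq0; apply/eqP; rewrite -sqrf_eq0 eq_le sqr_ge0 andbT.
    by have := pos_sq_le w (And3 bS sS p1) (lexx _); rewrite z1 mulr0.
  by have := pos_sq_le w (And3 bT sT p2) (lexx _); rewrite z2 mulr0.
apply/eqP; rewrite -subr_eq0; apply/eqP/funext => v; apply: nrm_eq0.
apply/eqP; rewrite -sqrf_eq0 nrm_adjM // sD.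
have [h1 h2] := D0 v.
have -> : ((S - T) \o (S - T)) v = S ((S - T) v) - T ((S - T) v) by [].
by rewrite h1 h2 subrr /rin in0l.
Qed.

End Positive.

(** * Square roots by iteration *)

Section SquareRoot.
Variables (R : realType) (H : hilbert R).
Local Notation C := R[i].

(** Closure under adjoints is left out, so that the commutant of a single operator qualifies; the
    root of a positive operator lies in every such algebra containing that operator. *)
Definition nalg (B : set (H -> H)) :=
  [/\ nsub B, B id & forall S T, B S -> B T -> B (S \o T)].

Variable X : H -> H.
Hypotheses (bX : bop X) (sX : adj X = X) (nX : opnorm X <= 1).

(** The fixed point iteration for y = (X + y^2)/2; its limit is y = 1 - s with s^2 = 1 - X. *)
Fixpoint sqrt_iter n : H -> H :=
  if n is m.+1 then (2^-1)%:C *: (X + (sqrt_iter m \o sqrt_iter m)) else 0.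

(** The scalar case X = 1 of the iteration. It dominates the norms of the iterates and of their
    increments, and it is increasing and bounded by 1, hence Cauchy. *)
Fixpoint sqrt_majo n : R := if n is m.+1 then 2^-1 * (1 + sqrt_majo m ^+ 2) else 0.

Let y := sqrt_iter.
Let q := sqrt_majo.

Lemma sqrt_majo_ge0 n : 0 <= q n.
Proof. by case: n => //= n; rewrite mulr_ge0 ?invr_ge0 ?addr_ge0 ?sqr_ge0. Qed.

Lemma sqrt_majo_le1 n : q n <= 1.
Proof. by elim: n => //= n IH; have := sqrt_majo_ge0 n; rewrite /q in IH *; nra. Qed.

Lemma bop_sqrt_iter n : bop (y n).
Proof.
elim: n => /= [|n IH]; first exact: bop_cst0.
by apply: bop_scale; apply: bop_add => //; exact: bop_comp.
Qed.

Lemma sqrt_iter_le n : opnorm (y n) <= q n.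
Proof.
elim: n => /= [|n IH]; first by rewrite opnorm0.
have by_ := bop_sqrt_iter n.
apply: le_trans (opnormZ _ (bop_add bX (bop_comp by_ by_))) _.
rewrite nrmR ger0_norm ?invr_ge0 // ler_wpM2l ?invr_ge0 //.
apply: le_trans (opnormD bX (bop_comp by_ by_)) _; rewrite lerD //.
apply: le_trans (opnormM by_ by_) _; rewrite expr2; apply: ler_pM => //; exact: opnorm_ge0.
Qed.

Lemma sqrt_majo_incr n : q n <= q n.+1.
Proof.
rewrite /q /=; elim: n => /= [|n IH]; first by rewrite expr0n /= addr0 mulr1 invr_ge0.
have := sqrt_majo_ge0 n; rewrite /q => h; nra.
Qed.

Lemma sqrt_iter_step n : opnorm (y n.+1 - y n) <= q n.+1 - q n.
Proof.
elim: n => [|n IH].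
  rewrite /y /= subr0; have := sqrt_iter_le 1; rewrite /q /=; lra.
have b0 := bop_sqrt_iter n; have b1 := bop_sqrt_iter n.+1.
have bd := bop_sub b1 b0.
(* X cancels, and the difference of squares is factored in an order that needs no commutation. *)
have -> : y n.+2 - y n.+1 = (2^-1)%:C *:
    ((y n.+1 \o (y n.+1 - y n)) + ((y n.+1 - y n) \o y n)).
  have -> : y n.+2 - y n.+1 = (2^-1)%:C *: (X + (y n.+1 \o y n.+1)) -
     (2^-1)%:C *: (X + (y n \o y n)) by [].
  move: (y n.+1) (y n) b1 {b0 bd IH} => y1 y0 b1.
  by apply/funext => v; rewrite !fctE /= (bopB _ _ b1); hring.
apply: le_trans (opnormZ _ (bop_add (bop_comp b1 bd) (bop_comp bd b0))) _.
rewrite nrmR ger0_norm ?invr_ge0 //.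
have h := opnormD (bop_comp b1 bd) (bop_comp bd b0).
have h1 := opnormM b1 bd; have h2 := opnormM bd b0.
have := sqrt_iter_le n; have := sqrt_iter_le n.+1.
have := opnorm_ge0 bd; have := opnorm_ge0 b0; have := opnorm_ge0 b1.
have := sqrt_majo_incr n.
move=> qq p1 p0 pd l1 l0.
have P1 : opnorm (y n.+1) * opnorm (y n.+1 - y n) <= q n.+1 * (q n.+1 - q n) by apply: ler_pM.
have P2 : opnorm (y n.+1 - y n) * opnorm (y n) <= (q n.+1 - q n) * q n by apply: ler_pM.
have eq1 : q n.+1 = 2^-1 * (1 + q n ^+ 2) by [].
have -> : q n.+2 = 2^-1 * (1 + q n.+1 ^+ 2) by [].
move: (q n.+1) (q n) (y n.+1) (y n) eq1 h h1 h2 P1 P2 => q1 q0 y1 y0; lra.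
Qed.

Lemma sqrt_iter_dist m n : (n <= m)%N -> opnorm (y m - y n) <= q m - q n.
Proof.
move=> /subnK <-; elim: (m - n)%N => [|k IH]; first by rewrite !subrr opnorm0.
have [b1 b2 b3] := And3 (bop_sqrt_iter (k + n).+1) (bop_sqrt_iter (k + n)) (bop_sqrt_iter n).
apply: le_trans (opnorm_trans b1 b2 b3) _.
have := sqrt_iter_step (k + n); rewrite addSn; lra.
Qed.

Lemma sqrt_majo_cauchy (e : R) : 0 < e -> exists N, forall m, (N <= m)%N -> q m - q N < e.
Proof.
move=> e0; have hs : has_sup (range q).
  by split; [exists (q 0), 0%N|exists 1 => _ [n _ <-]; exact: sqrt_majo_le1].
have [_ [N _ <-] h] := sup_adherent e0 hs; exists N => m Nm.
have : q m <= sup (range q) by apply: sup_upper_bound => //; exists m.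
lra.
Qed.

Lemma sqrt_ex : exists s, [/\ pos s, s \o s = id - X &
  forall B, nalg B -> B X -> B s].
Proof.
have [|T bT hT] := op_complete bop_sqrt_iter.
  move=> e e0; have [|N hN] := sqrt_majo_cauchy (e := e / 2); first by rewrite divr_gt0.
  exists N => m n Nm Nn.
  apply: le_lt_trans (opnorm_trans (bop_sqrt_iter m) (bop_sqrt_iter N) (bop_sqrt_iter n)) _.
  have := sqrt_iter_dist Nm; have := sqrt_iter_dist Nn; rewrite opnormBC.
  have := hN m Nm; have := hN n Nn; rewrite /y; lra.
have lim (P : set (H -> H)) : nsub P -> (forall n, P (y n)) -> P T.
  move=> [_ _ _ Pc] hP; apply: Pc; split=> // e /hT [N hN].
  by exists (y N) => //; exact: hN.
have T1 : opnorm T <= 1.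
  apply/ler_addgt0Pr => e e0; have [N hN] := hT e e0.
  have := opnormD (bop_sub bT (bop_sqrt_iter N)) (bop_sqrt_iter N); rewrite subrK.
  have := hN N (leqnn _); have := sqrt_iter_le N; have := sqrt_majo_le1 N.
  rewrite /y; lra.
have sT : adj T = T.
  apply: adj_uniq => // u v; apply/eqP; rewrite -subr_eq0; apply/eqP/nrm_le0 => e e0.
  have h1 : 0 < nrm u * nrm v + 1.
    by have := mulr_ge0 (nrm_ge0 u) (nrm_ge0 v); lra.
  have [|N /(_ N (leqnn _)) hN] := hT (e / (2 * (nrm u * nrm v + 1))).
    by rewrite divr_gt0 // mulr_gt0.
  have bN := bop_sqrt_iter N.
  have sN : adj (y N) = y N.
    elim: (N) => [|n IH] /=; first exact: adj0.
    have bn := bop_sqrt_iter n.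
    have bnn := bop_comp bn bn.
    rewrite (adjZ _ (bop_add bX bnn)) (adjD bX bnn) (adj_comp bn bn) IH sX.
    by congr (_ *: _); rewrite conj_Creal // complex_real.
  have bd := bop_sub bT bN.
  have -> : inner (T u) v - inner u (T v) =
    inner ((T - y N) u) v - inner u ((T - y N) v).
    rewrite !fctE inBl inBr (adjE _ _ bN) sN; ring.
  apply: le_trans (ler_nrmB _ _) _.
  have := in_CS ((T - y N) u) v; have := in_CS u ((T - y N) v).
  have := ler_opnorm u bd; have := ler_opnorm v bd.
  move: hN; rewrite ltr_pdivlMr ?mulr_gt0 //.
  have := nrm_ge0 u; have := nrm_ge0 v; have := opnorm_ge0 bd.
  move: (nrm (inner _ _)) (nrm (inner _ _)) => a b.
  move: (nrm ((T - y N) u)) (nrm ((T - y N) v)) (nrm u) (nrm v) (opnorm _).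
  move=> c d f g h *.
  have : c * g <= (h * f) * g by apply: ler_wpM2r.
  have : f * d <= f * (h * g) by apply: ler_wpM2l.
  nra.
have bTT := bop_comp bT bT.
have TE : T + T = X + (T \o T).
  apply/eqP; rewrite -subr_eq0; apply/eqP/opnorm_le0.
    by apply: bop_sub; apply: bop_add.
  (* The decomposition below has four terms, each of norm at most e/6, as T and the iterates are
     contractions. *)
  move=> e e0; have [|N hN] := hT (e / 6); first by rewrite divr_gt0.
  have b0 := bop_sqrt_iter N; have b1 := bop_sqrt_iter N.+1.
  have d0 := bop_sub bT b0; have d1 := bop_sub bT b1.
  have -> : T + T - (X + (T \o T)) = ((T - y N.+1) + (T - y N.+1)) -
     ((T \o (T - y N)) + ((T - y N) \o y N)).
    have Xv v : X v = y N.+1 v + y N.+1 v - y N (y N v).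
      have -> : y N.+1 v = (2^-1)%:C *: (X v + y N (y N v)) by [].
      rewrite -scalerDl -rmorphD /= (_ : 2^-1 + 2^-1 = 1 :> R); last by field.
      by rewrite scale1r addrK.
    move: (y N.+1) (y N) Xv => y1 y0 Xv.
    by apply/funext => v; rewrite !fctE /= (bopB _ _ bT) Xv; hring.
  have bA := bop_comp bT d0; have bB := bop_comp d0 b0.
  have := opnormD (bop_add d1 d1) (bop_opp (bop_add bA bB)); rewrite opnormN.
  have := opnormD d1 d1; have := opnormD bA bB.
  have := opnormM bT d0; have := opnormM d0 b0.
  have := hN N (leqnn _); have := hN N.+1 (leqnSn _); have := sqrt_iter_le N.
  have := sqrt_majo_le1 N; rewrite /y /q.
  have := opnorm_ge0 d0; have := opnorm_ge0 b0; have := opnorm_ge0 bT.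
  rewrite /y; nra.
exists (id - T); split.
- split; first by apply: bop_sub => //; exact: bop_id.
    by rewrite adjB ?adj_id ?sT //; exact: bop_id.
  move=> v; rewrite !fctE rinDl rinNl rin_sq.
  have := rin_CS (T v) v; have := ler_opnorm v bT; have := nrm_ge0 v; nra.
- apply/funext => v; rewrite !fctE /= bopB //.
  have := congr1 (fun f => f v) TE; rewrite !fctE /= => h.
  have -> : X v = T v + T v - T (T v) by rewrite h addrK.
  by hring.
- move=> B [nB B1 BM] BX; apply: nsubB => //; apply: lim => // n.
  elim: n => /= [|n IH]; first by case: nB.
  by apply: nsubZ => //; apply: nsubD => //; exact: BM.
Qed.

End SquareRoot.

Section PosSqrt.
Variables (R : realType) (H : hilbert R).
Local Notation C := R[i].

(** With c = |T| + 1 the operator X = 1 - T/c is a positive contraction, and sqrt(c) times the root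
    of 1 - X is a root of T. The last clause is what places the root inside C*-algebras and
    commutants. *)
Lemma pos_sqrt (T : H -> H) : pos T -> exists s, [/\ pos s, s \o s = T &
  forall B, nalg B -> B T -> B s].
Proof.
move=> pT; have [bT sT p] := pT.
pose c := opnorm T + 1.
have c0 : 0 < c by rewrite /c; have := opnorm_ge0 bT; lra.
pose X := id - (c^-1)%:C *: T.
have bid := bop_id H.
have bX : bop X by apply: bop_sub => //; exact: bop_scale.
have pcT := pos_scale (ltW (_ : 0 < c^-1)) pT.
have {}pcT : pos ((c^-1)%:C *: T) by apply: pos_scale pT; rewrite invr_ge0 ltW.
have [bcT scT _] := pcT.
have sX : adj X = X by rewrite /X adjB // adj_id scT.
have pX : pos X.
  split=> // v; rewrite /X !fctE rinDl rinNl rinZl rin_sq.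
  have h := rin_CS (T v) v; have h2 := ler_opnorm v bT; have nv := nrm_ge0 v.
  have h3 : rin (T v) v <= c * nrm v ^+ 2.
    by rewrite /c; have := sqr_ge0 (nrm v); nra.
  by rewrite subr_ge0 ler_pdivrMl.
have nX : opnorm X <= 1.
  apply: opnorm_sa_le => // v; rewrite mul1r /X !fctE rinDl rinNl rinZl rin_sq.
  have : 0 <= c^-1 * rin (T v) v by rewrite mulr_ge0 // invr_ge0 ltW.
  lra.
have [s [ps ss hs]] := sqrt_ex bX sX nX.
have [bs _ _] := ps.
exists ((Num.sqrt c)%:C *: s); split.
- by apply: pos_scale ps; exact: sqrtr_ge0.
- apply/funext => v; have := congr1 (fun f => f v) ss; rewrite /X !fctE /= => h.
  rewrite (bopZ _ _ bs) h scalerA -rmorphM /= -expr2 sqr_sqrtr ?(ltW c0) //.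
  rewrite subKr scalerA -rmorphM /= divff ?gt_eqF // scale1r.
  by [].
- move=> B [nB B1 BM] BT; apply: nsubZ => //; apply: hs => //.
  by rewrite /X; apply: nsubB => //; exact: nsubZ.
Qed.

(** Serves to make the square root of t^2 commute with t. *)
Lemma nalg_comm (t : H -> H) : bop t -> nalg [set b | bop b /\ b \o t = t \o b].
Proof.
move=> bt; have [nb _ _ _] := nsub_bop H H.
split.
- have nB := nsub_bop H H.
  have b1 := blin_prec (H' := H) (@subset_refl _ (@bop R H H)) bt.
  have b2 := blin_postc (@subset_refl _ (@bop R H H)) bt.
  have := nsub_pre nB (nsub0 H H) (blin_sub b1 b2).
  congr nsub; apply/seteqP; split=> b /= [bb h]; split=> //.
    by apply/eqP; rewrite -subr_eq0 h.
  by apply/eqP; rewrite subr_eq0 h.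
- by split=> //; exact: bop_id.
- move=> S T /= [bS cS] [bT cT]; split; first exact: bop_comp.
  by rewrite -compA cT compA cS.
Qed.

Lemma nalgI (A B : set (H -> H)) : nalg A -> nalg B -> nalg (A `&` B).
Proof.
move=> [[Ab A0 Al Ac] A1 AM] [[Bb B0 Bl Bc] B1 BM]; split=> //.
  split.
  - by move=> T [/Ab].
  - by [].
  - by move=> a S T [? ?] [? ?]; split; [exact: Al|exact: Bl].
  - by move=> T h; split; [apply: Ac|apply: Bc]; apply: nclosure_mono h => ? [].
by move=> S T [? ?] [? ?]; split; [exact: AM|exact: BM].
Qed.

Lemma cstar_nalg (A : set (H -> H)) : cstar_algebra A -> A id -> nalg A.
Proof. by move=> [[Ab A0 Al AM As] Ac] A1; split. Qed.

End PosSqrt.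

(** * Contractivity and isometry of homomorphisms of C*-algebras *)

Section StarHom.
Variables (R : realType) (H K : hilbert R).
Local Notation C := R[i].
Variables (A : set (H -> H)) (f : (H -> H) -> (K -> K)).
Hypotheses (cA : cstar_algebra A) (A1 : A id) (hf : star_hom A f).

Let nA : nalg A. Proof. exact: cstar_nalg. Qed.

Lemma star_hom0 : f 0 = 0.
Proof.
have [_ A0 _ _] : nsub A by case: nA.
have [_ fl _ _] := hf; have := fl (-1) 0 0 A0 A0.
by rewrite !scaleN1r oppr0 addr0 addNr.
Qed.

Lemma star_homZ (a : C) x : A x -> f (a *: x) = a *: f x.
Proof.
have [_ A0 _ _] : nsub A by case: nA.
have [_ fl _ _] := hf => Ax.
by have := fl a x 0 Ax A0; rewrite addr0 star_hom0 addr0.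
Qed.

Lemma star_homB x y : A x -> A y -> f (x - y) = f x - f y.
Proof.
have [_ fl _ _] := hf => Ax Ay.
by rewrite addrC -scaleN1r fl // scaleN1r addrC.
Qed.

Lemma star_hom_pos x : A x -> pos x -> pos (f x).
Proof.
move=> Ax px; have [s [ps ss hs]] := pos_sqrt px.
have As : A s by exact: hs.
have [fb _ fM fa] := hf; have [_ sa _] := ps.
rewrite -ss fM // -{1}sa fa //; exact: pos_adjM (fb _ As).
Qed.

(** f is not assumed unital at this point; f(1) is a projection, which suffices for
    contractivity. *)
Lemma star_hom_proj : pos (f id) /\ forall v, rin (f id v) v = nrm (f id v) ^+ 2.
Proof.
have [fb _ fM fa] := hf; split; first by apply: star_hom_pos => //; exact: pos_id.
move=> v; rewrite nrm_adjM; last exact: fb.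
by rewrite -(fa _ A1) adj_id -(fM _ _ A1 A1).
Qed.

Lemma star_hom_id_le v : nrm (f id v) <= nrm v.
Proof.
have [pp h] := star_hom_proj.
have := rin_CS (f id v) v; rewrite h.
have := nrm_ge0 v; have [->|p0] := eqVneq (f id v) 0; first by rewrite nrm0.
have := nrm_gt0 p0; nra.
Qed.

(** |x|^2 - x^* x is positive, hence so is its image, and |f(x)v|^2 <= |x|^2 (f(1)v, v) <= |x|^2
    |v|^2. *)
Lemma star_hom_le x : A x -> opnorm (f x) <= opnorm x.
Proof.
move=> Ax; have [[Ab A0 Al Ac] _ AM] := nA.
have [fb fl fM fa] := hf; have bx := Ab _ Ax; have o0 := opnorm_ge0 bx.
have Aa : A (adj x) by case: cA => [[_ _ _ _ h] _]; exact: h.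
pose T := ((opnorm x ^+ 2)%:C *: id) - (adj x \o x).
have AT : A T by apply: nsubB; [by split| |exact: AM]; apply: nsubZ.
have pT : pos T.
  have [b1 s1 _] := pos_scale (sqr_ge0 (opnorm x)) (pos_id H).
  have [b2 s2 _] := pos_adjM bx.
  split; [exact: bop_sub|by rewrite adjB // s1 s2|].
  move=> v; rewrite /T !fctE rinDl rinNl rinZl rin_sq -[X in _ - rin X _]/((adj x \o x) v).
  rewrite -nrm_adjM // subr_ge0 -exprMn ler_pXn2r ?nnegrE ?mulr_ge0 ?nrm_ge0 //.
  exact: ler_opnorm.
have [_ _ p] := star_hom_pos AT pT.
apply: opnorm_le => // v.
rewrite -(ler_pXn2r (n := 2)) ?nnegrE ?mulr_ge0 ?nrm_ge0 //.
have Ac2 : A ((opnorm x ^+ 2)%:C *: id) by apply: nsubZ.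
have fT : f T = ((opnorm x ^+ 2)%:C *: f id) - (adj (f x) \o f x).
  by rewrite /T (star_homB Ac2 (AM _ _ Aa Ax)) (star_homZ _ A1) (fM _ _ Aa Ax) (fa _ Ax).
have bfx := fb _ Ax; have := p v; rewrite fT.
rewrite !fctE rinDl rinNl rinZl -[X in _ - rin X _]/((adj (f x) \o f x) v).
rewrite -nrm_adjM // => h.
have [_ h2] := star_hom_proj; rewrite h2 in h.
have h3 : nrm (f id v) ^+ 2 <= nrm v ^+ 2.
  by rewrite ler_pXn2r ?nnegrE ?nrm_ge0 //; exact: star_hom_id_le.
rewrite exprMn; have := sqr_ge0 (opnorm x); nra.
Qed.

Lemma star_hom_blin : blin A f.
Proof.
have [fb fl _ _] := hf; split=> //; exists 1 => // T AT.
by rewrite mul1r; exact: star_hom_le.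
Qed.

Hypotheses (finj : set_inj A f) (f1 : f id = id).

(* Injectivity gives isometry: with t = x^*x - r, r = |f(x)|^2, both |f(t)| and
   -f(t) are positive square roots of f(t)^2, so f(|t| + t) = 0 and t <= 0. *)
Lemma star_hom_isometric x : A x -> opnorm (f x) = opnorm x.
Proof.
move=> Ax; apply/eqP; rewrite eq_le star_hom_le //=.
have [[Ab A0 Al Ac] _ AM] := nA.
have [fb fl fM fa] := hf; have bx := Ab _ Ax.
have bfx := fb _ Ax; have o0 := opnorm_ge0 bfx.
have Aa : A (adj x) by case: cA => [[_ _ _ _ h] _]; exact: h.
pose r := opnorm (f x) ^+ 2.
pose h := adj x \o x.
have Ah : A h by exact: AM.
have [bh sh _] := pos_adjM bx.
pose t := h - (r%:C *: id).
have Ar : A (r%:C *: id) by apply: nsubZ.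
have At : A t by apply: nsubB.
have [br sr _] := pos_scale (sqr_ge0 (opnorm (f x))) (pos_id H).
have bt : bop t by exact: bop_sub.
have st : adj t = t by rewrite /t adjB // sh sr.
have ptt := pos_sqr bt st.
have [m [pm mm hm]] := pos_sqrt ptt.
have [Am [bm cm]] : (A `&` [set b | bop b /\ b \o t = t \o b]) m.
  apply: hm; first by apply: nalgI => //; exact: nalg_comm.
  split; first exact: AM.
  by split; [exact: bop_comp|rewrite compA].
have ft : f t = f h - (r%:C *: id) by rewrite /t star_homB // star_homZ // f1.
have fh : f h = adj (f x) \o f x by rewrite fM // fa.
have bft := fb _ At.
have pft : pos (- f t).
  split; [exact: bop_opp|by rewrite adjN // -fa // st|].
  move=> v; rewrite ft fh opprB !fctE rinDl rinNl rinZl rin_sq.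
  rewrite -[X in _ - rin X _]/((adj (f x) \o f x) v) -nrm_adjM // subr_ge0 -exprMn.
  rewrite ler_pXn2r ?nnegrE ?mulr_ge0 ?nrm_ge0 //; exact: ler_opnorm.
have bfm := fb _ Am.
have e : f m = - f t.
  apply: pos_sqrt_uniq => //; first by apply: star_hom_pos.
    apply/funext => v; change (f m (- f t v) = - f t (f m v)).
    rewrite (bopN _ bfm); congr (- _).
    by rewrite -[LHS]/((f m \o f t) v) -fM // cm fM.
  apply/funext => v; change (f m (f m v) = - f t (- f t v)).
  rewrite (bopN _ bft) opprK.
  by rewrite -[LHS]/((f m \o f m) v) -fM // mm fM.
have mt : m + t = 0.
  apply: finj; rewrite ?inE //; first exact: nsubD.
  by rewrite star_hom0 -[m]scale1r fl // scale1r e addNr.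
apply: opnorm_le => // v.
rewrite -(ler_pXn2r (n := 2)) ?nnegrE ?mulr_ge0 ?nrm_ge0 //.
have [_ _ /(_ v)] := pm.
have -> : m = - t by apply/eqP; rewrite -addr_eq0 mt.
rewrite /t opprB !fctE rinDl rinNl rinZl rin_sq -[X in _ - rin X _]/((adj x \o x) v).
by rewrite -nrm_adjM // subr_ge0 exprMn.
Qed.

End StarHom.

(** * Operators prescribed on total families *)

Section Extension.
Variables (R : realType).
Implicit Types H E L : hilbert R.

(** The prescription e_i -> f_i is handled through the span of its graph: one bound on pairs
    expresses well-definedness and boundedness together. The operator obtained is the one whose
    graph is the closure of this span. *)
Lemma bop_extend H E (I : Type) (e : I -> H) (f : I -> E) (c : R) :
  closure (lspan (range e)) = setT -> 0 <= c ->
  (forall p, lspan (range (fun i => (e i, f i))) p -> nrm p.2 <= c * nrm p.1) ->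
  exists V : H -> E, [/\ bop V, forall i, V (e i) = f i &
    forall x, nrm (V x) <= c * nrm x].
Proof.
move=> /closureT_nrmP tot c0 hb.
set G := lspan _ in hb.
have GP u : lspan (range e) u -> exists v, G (u, v).
  move=> [n [a [s [Ss ->]]]].
  have /choice [t ht] : forall i, exists j, e j = s i.
    by move=> i; have [j _ <-] := Ss i; exists j.
  exists (\sum_(i < n) a i *: f (t i)); exists n, a, (fun i => (e (t i), f (t i))); split.
    by move=> i; exists (t i).
  elim/big_rec3: _ => [//|i x y z _ <-].
  by rewrite ht.
pose cl x y := forall d : R, 0 < d -> exists p, [/\ G p, nrm (x - p.1) < d & nrm (y - p.2) < d].
have GB p q : G p -> G q -> nrm (p.2 - q.2) <= c * nrm (p.1 - q.1).
  move=> Gp Gq; apply: (hb (p - q)); rewrite addrC -scaleN1r; exact: lspan_lc.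
have cl_ex x : exists y, cl x y.
  pose B d := [set v | exists2 u, G (u, v) & nrm (x - u) < d].
  have PF : ProperFilter (filter_from [set d : R | 0 < d] B).
    apply: filter_from_proper; last first.
      move=> d /= d0; have [u Su xu] := tot x d d0.
      by have [v Gv] := GP u Su; exists v, u.
    apply: filter_from_filter; first by exists 1; rewrite /= ltr01.
    move=> d1 d2 /= d10 d20; exists (Num.min d1 d2); first by rewrite lt_min d10.
    move=> v [u Gu xu]; split; exists u => //; apply: lt_le_trans xu _;
      by rewrite ge_min lexx ?orbT.
  have [|y Fy] := cauchy_nrm_cvg (F := filter_from [set d : R | 0 < d] B).
    move=> d d0; have c1 : 0 < 2 * (c + 1) by lra.
    exists (B (d / (2 * (c + 1)))).
      by exists (d / (2 * (c + 1))) => //=; rewrite divr_gt0.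
    move=> v w [u Gu xu] [u' Gu' xu'].
    apply: le_lt_trans (GB (u, v) (u', w) Gu Gu') _ => /=.
    have := ler_nrm_trans x u u'; rewrite (nrmB u x).
    move: xu xu'; rewrite !ltr_pdivlMr //.
    have := nrm_ge0 (x - u); have := nrm_ge0 (x - u'); have := nrm_ge0 (u - u').
    nra.
  exists y => d d0; have /cvg_nrmP /(_ d d0) [d' /= d'0 hd] := Fy.
  have d2 : 0 < Num.min d d' by rewrite lt_min d0.
  have [u Su xu] := tot x _ d2; have [v Gv] := GP u Su.
  exists (u, v); split=> //=; first by apply: lt_le_trans xu _; rewrite ge_min lexx.
  by apply: hd; exists u => //; apply: lt_le_trans xu _; rewrite ge_min lexx orbT.
have cl_le x y : cl x y -> nrm y <= c * nrm x.
  move=> h; apply/ler_addgt0Pr => d d0; have c1 : 0 < c + 1 by lra.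
  have [|[u v] [/hb /= uv xu yv]] := h (d / (c + 1)); first by rewrite divr_gt0.
  have := ler_nrm_sub y v; have := ler_nrm_sub u x; rewrite (nrmB u x).
  move: xu yv; rewrite /= !ltr_pdivlMr //.
  have := nrm_ge0 (y - v); have := nrm_ge0 (x - u).
  move: (nrm (x - u)) (nrm (y - v)) (nrm y) (nrm v) (nrm u) (nrm x) uv => a b y' v' u' x' uv.
  move=> a0 b0 h1 h2 h3 h4.
  have : c * u' <= c * (a + x') by apply: ler_wpM2l.
  have : b <= d / (c + 1) by rewrite ler_pdivlMr // ltW.
  have : a <= d / (c + 1) by rewrite ler_pdivlMr // ltW.
  have : d / (c + 1) * (c + 1) = d by rewrite divfK // gt_eqF.
  set q := d / (c + 1) => *.
  have : c * a <= c * q by apply: ler_wpM2l.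
  lra.
have cl_lc a x y x' y' : cl x y -> cl x' y' -> cl (a *: x + x') (a *: y + y').
  move=> h h' d d0; have a1 : 0 < nrm a + 1 by have := nrm_ge0 a; lra.
  have [|[u v] [Guv xu yv]] := h (d / 2 / (nrm a + 1)); first by rewrite !divr_gt0.
  have [|[u' v'] [Guv' xu' yv']] := h' (d / 2); first by rewrite divr_gt0.
  exists (a *: (u, v) + (u', v')); split; first exact: lspan_lc.
  - have -> : a *: x + x' - (a *: (u, v) + (u', v')).1 = a *: (x - u) + (x' - u').
      by rewrite /=; hring.
    apply: le_lt_trans (ler_nrmD _ _) _; rewrite nrmZ.
    move: xu xu'; rewrite /= ltr_pdivlMr //.
    have := nrm_ge0 a; have := nrm_ge0 (x - u); nra.
  - have -> : a *: y + y' - (a *: (u, v) + (u', v')).2 = a *: (y - v) + (y' - v').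
      by rewrite /=; hring.
    apply: le_lt_trans (ler_nrmD _ _) _; rewrite nrmZ.
    move: yv yv'; rewrite /= ltr_pdivlMr //.
    have := nrm_ge0 a; have := nrm_ge0 (y - v); nra.
have cl_uniq x y y' : cl x y -> cl x y' -> y = y'.
  move=> h h'; have := cl_lc (-1) x y' x y h' h.
  rewrite !scaleN1r addNr => /cl_le; rewrite nrm0 mulr0 => h0.
  apply/eqP; rewrite -subr_eq0 addrC; apply/eqP/nrm_eq0/eqP.
  by rewrite eq_le h0 nrm_ge0.
have [V hV] := choice cl_ex; exists V; split.
- apply: (bop_bound (c := c)) => [a x y|x]; last exact: cl_le.
  exact: cl_uniq (hV _) (cl_lc a _ _ _ _ (hV x) (hV y)).
- move=> i; apply: cl_uniq (hV _) _ => d d0; exists (e i, f i); split.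
  + by apply: lspan_self; exists i.
  + by rewrite /= subrr nrm0.
  + by rewrite /= subrr nrm0.
- by move=> x; exact: cl_le.
Qed.

Definition isometry H E (V : H -> E) :=
  bop V /\ forall x y, inner (V x) (V y) = inner x y.

Lemma isometry_nrm H E (V : H -> E) x : isometry V -> nrm (V x) = nrm x.
Proof.
move=> [_ h]; have := h x x; rewrite !in_nrm => /complexI /eqP.
by rewrite eqrXn2 ?nrm_ge0 // => /eqP.
Qed.

Lemma isometry_adjK H E (V : H -> E) : isometry V -> adj V \o V = id.
Proof.
by move=> [bV h]; apply/funext => x; apply: in_inj => y; rewrite /= adjEr.
Qed.

Lemma isometry_opnorm H E (V : H -> E) : isometry V -> opnorm V <= 1.
Proof. by move=> iV; apply: opnorm_le => // x; rewrite mul1r (isometry_nrm _ iV). Qed.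

(** Equality of inner products passes from generators to spans and gives the bound of [bop_extend].
    The isometry V of implemented actions, the group unitary, [embed] and the permutations of tensor
    legs all come from here. *)
Lemma isometry_extend H E (I : Type) (e : I -> H) (f : I -> E) :
  closure (lspan (range e)) = setT ->
  (forall i j, inner (f i) (f j) = inner (e i) (e j)) ->
  exists V : H -> E, isometry V /\ forall i, V (e i) = f i.
Proof.
move=> tot h.
have h1 p q : lspan (range (fun i => (e i, f i))) p ->
    lspan (range (fun i => (e i, f i))) q -> inner p.2 q.2 = inner p.1 q.1.
  move=> Gp; apply: (lspan_min (T := [set q | inner p.2 q.2 = inner p.1 q.1])) q.
  - by rewrite /= !in0r.
  - by move=> a u v /= hu hv; rewrite !inDr !inZr hu hv.
  - move=> _ [j _ <-] /=; move: p Gp.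
    apply: (lspan_min (T := [set p | inner p.2 (f j) = inner p.1 (e j)])).
    + by rewrite /= !in0l.
    + by move=> a u v /= hu hv; rewrite !inDl !inZl hu hv.
    + by move=> _ [i _ <-] /=.
have [|V [bV Ve _]] := bop_extend tot ler01 (f := f).
  move=> p Gp; rewrite mul1r -(ler_pXn2r (n := 2)) ?nnegrE ?nrm_ge0 //.
  by rewrite -!rin_sq /rin (h1 _ _ Gp Gp).
exists V; split=> //; split=> //.
have ran x (d : R) : 0 < d -> exists2 u, lspan (range e) u & nrm (x - u) < d.
  by move/closureT_nrmP : tot; exact.
have Ve2 : forall x y, lspan (range e) x -> lspan (range e) y -> inner (V x) (V y) = inner x y.
  move=> x y lx; apply: (lspan_min (T := [set y | inner (V x) (V y) = inner x y])) y.
  - by rewrite /= bop0 // !in0r.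
  - by move=> a u v /= hu hv; rewrite bopD // bopZ // !inDr !inZr hu hv.
  - move=> _ [j _ <-] /=; move: x lx.
    apply: (lspan_min (T := [set x | inner (V x) (V (e j)) = inner x (e j)])).
    + by rewrite /= bop0 // !in0l.
    + by move=> a u v /= hu hv; rewrite bopD // bopZ // !inDl !inZl hu hv.
    + by move=> _ [i _ <-] /=; rewrite !Ve.
have bA := bop_adj bV.
suff e1 : adj V \o V = id.
  by move=> x y; rewrite -{2}[y]/(id y) -e1 /= -adjE.
apply: (bop_total_eq tot) => //; [exact: bop_comp|exact: bop_id|].
move=> _ [i _ <-] /=; apply/eqP; rewrite -subr_eq0; apply/eqP.
apply: (in_total_eq0 tot) => _ [j _ <-]; rewrite inBl adjEr //.
rewrite Ve2 ?subrr //; apply: lspan_self; [by exists i|by exists j].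
Qed.

Lemma isometry_unitary H E (V : H -> E) : isometry V ->
  closure (lspan (range V)) = setT -> unitary V.
Proof.
move=> iV tot; have [bV h] := iV; have bA := bop_adj bV.
have e1 := isometry_adjK iV; split=> //.
apply: (bop_total_eq tot); [exact: bop_comp|exact: bop_id|].
by move=> _ [x _ <-]; change (V ((adj V \o V) x) = V x); rewrite e1.
Qed.

Lemma unitary_isometry H E (V : H -> E) : unitary V -> isometry V.
Proof.
move=> [bV _ h]; split=> // x y; rewrite adjE //; congr (inner _ _).
by rewrite -[LHS]/((adj V \o V) y) h.
Qed.

Lemma unitary_adj H E (V : H -> E) : unitary V -> unitary (adj V).
Proof.
by move=> [bV h1 h2]; split; rewrite ?adjK //; exact: bop_adj.
Qed.

Lemma total_image H E (S : set H) (X : set E) (V : H -> E) :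
  closure (lspan S) = setT -> bop V ->
  (forall s, S s -> closure (lspan X) (V s)) -> forall x, closure (lspan X) (V x).
Proof.
move=> /closureT_nrmP tot bV h x.
have sX := subspace_closure (subspace_lspan X).
have hs y : lspan S y -> closure (lspan X) (V y).
  move: y; apply: lspan_min => //.
    by rewrite bop0 //; case: sX.
  by move=> a u v hu hv; rewrite bopD // bopZ //; case: sX => _; exact.
apply: closure_closure_nrm => d d0; have c1 : 0 < opnorm V + 1.
  by have := opnorm_ge0 bV; lra.
have [|y Sy xy] := tot x (d / (opnorm V + 1)); first by rewrite divr_gt0.
exists (V y); first exact: hs.
rewrite -bopB //; apply: le_lt_trans (ler_opnorm _ bV) _.
move: xy; rewrite ltr_pdivlMr //; have := opnorm_ge0 bV; have := nrm_ge0 (x - y).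
nra.
Qed.

End Extension.

(** * Tensor products of operators *)
Section HTensor.
Variable R : realType.
Local Notation C := R[i].
Implicit Types H K L : hilbert R.

Lemma tensDl H K (E : htensor H K) h h' k :
  tens E (h + h') k = tens E h k + tens E h' k.
Proof. by have := tens_linear_l E k 1 h h'; rewrite !scale1r. Qed.
Lemma tensDr H K (E : htensor H K) h k k' :
  tens E h (k + k') = tens E h k + tens E h k'.
Proof. by have := tens_linear_r E h 1 k k'; rewrite !scale1r. Qed.
Lemma tens0l H K (E : htensor H K) k : tens E 0 k = 0.
Proof. by have := tens_linear_l E k (-1) 0 0; rewrite !scaleN1r oppr0 addr0 addNr. Qed.
Lemma tens0r H K (E : htensor H K) h : tens E h 0 = 0.
Proof. by have := tens_linear_r E h (-1) 0 0; rewrite !scaleN1r oppr0 addr0 addNr. Qed.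
Lemma tensZl H K (E : htensor H K) c h k : tens E (c *: h) k = c *: tens E h k.
Proof. by have := tens_linear_l E k c h 0; rewrite tens0l !addr0. Qed.
Lemma tensZr H K (E : htensor H K) c h k : tens E h (c *: k) = c *: tens E h k.
Proof. by have := tens_linear_r E h c k 0; rewrite tens0r !addr0. Qed.
Lemma tensBl H K (E : htensor H K) h h' k :
  tens E (h - h') k = tens E h k - tens E h' k.
Proof. by rewrite tensDl -scaleN1r tensZl scaleN1r. Qed.
Lemma nrm_tens H K (E : htensor H K) h k : nrm (tens E h k) = nrm h * nrm k.
Proof.
apply/eqP; rewrite -(eqrXn2 (n := 2)) ?mulr_ge0 ?nrm_ge0 // exprMn; apply/eqP.
by have := tens_inner E h h k k; rewrite !in_nrm -rmorphM => /complexI.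
Qed.

Lemma bop_tensr H K (E : htensor H K) h : bop (tens E h).
Proof.
apply: (bop_bound (c := nrm h)) => [|k]; first exact: tens_linear_r.
by rewrite nrm_tens.
Qed.

Lemma bop_tensl H K (E : htensor H K) k : bop (tens E ^~ k).
Proof.
apply: (bop_bound (c := nrm k)) => [|h]; first exact: tens_linear_l.
by rewrite nrm_tens mulrC.
Qed.

Lemma tens_totalE H K (E : htensor H K) :
  closure (lspan (range (fun p : H * K => tens E p.1 p.2))) = setT.
Proof.
rewrite -[RHS](tens_total E); congr (closure (lspan _)); apply/seteqP; split=> v.
  by move=> [[h k] _ <-]; exists h, k.
by move=> [h [k ->]]; exists (h, k).
Qed.

Lemma tens_total2 H K (E : htensor H K) (S : set H) (T : set K) :
  closure (lspan S) = setT -> closure (lspan T) = setT ->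
  closure (lspan [set v | exists s t, [/\ S s, T t & v = tens E s t]]) = setT.
Proof.
move=> tS tT; set X := [set v | _].
have h1 s k : S s -> closure (lspan X) (tens E s k).
  move=> Ss; apply: (total_image tT (bop_tensr E s)) => t Tt.
  by apply: subset_closure; apply: lspan_self; exists s, t.
have h2 h k : closure (lspan X) (tens E h k).
  by apply: (total_image tS (bop_tensl E k)) => s Ss; exact: h1.
rewrite -subTset => v _; rewrite -[v]/(id v).
apply: (total_image (tens_total E) (bop_id E)) => _ [h [k ->]]; exact: h2.
Qed.

Lemma tens_ext H K L (E : htensor H K) (X Y : E -> L) : bop X -> bop Y ->
  (forall h k, X (tens E h k) = Y (tens E h k)) -> X = Y.
Proof.
move=> bX bY h; apply: (bop_total_eq (tens_total E)) => // _ [a [b ->]]; exact: h.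
Qed.

Lemma tens_ext3 H K L (M : hilbert R) (E : htensor K L) (E' : htensor H E) (X Y : E' -> M) :
  bop X -> bop Y ->
  (forall h k l, X (tens E' h (tens E k l)) = Y (tens E' h (tens E k l))) -> X = Y.
Proof.
move=> bX bY h; apply: tens_ext => // a b.
have bta := bop_tensr E' a.
have := tens_ext (bop_comp bX bta) (bop_comp bY bta) (h a).
by move/(congr1 (fun f => f b)).
Qed.

Lemma tens_ext3l H K L (M : hilbert R) (E : htensor H K) (E' : htensor E L) (X Y : E' -> M) :
  bop X -> bop Y ->
  (forall h k l, X (tens E' (tens E h k) l) = Y (tens E' (tens E h k) l)) -> X = Y.
Proof.
move=> bX bY h; apply: tens_ext => // a b.
have bta := bop_tensl E' b.
have := tens_ext (bop_comp bX bta) (bop_comp bY bta) (fun x y => h x y b).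
by move/(congr1 (fun f => f a)).
Qed.

Lemma adj_tensr H K (E : htensor H K) h' h k :
  adj (tens E h') (tens E h k) = inner h h' *: k.
Proof.
apply: in_inj => z; rewrite adjEr; last exact: bop_tensr.
by rewrite tens_inner inZl.
Qed.

Lemma tens_inj_unit H K (E : htensor H K) h k : inner h h = 1 ->
  adj (tens E h) (tens E h k) = k.
Proof. by move=> h1; rewrite adj_tensr h1 scale1r. Qed.

Lemma isometry_tensr H K (E : htensor H K) h : inner h h = 1 -> isometry (tens E h).
Proof.
by move=> h1; split=> [|x y]; [exact: bop_tensr|rewrite tens_inner h1 mul1r].
Qed.

(* c^2 - T^*T = S^2 gives |sum h(x)Tk|^2 + |sum h(x)Sk|^2 = c^2 |sum h(x)k|^2. *)
Lemma amplify_ex H K K' (E : htensor H K) (E' : htensor H K') (T : K -> K') :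
  bop T -> exists X : E -> E', bop X /\ forall h k, X (tens E h k) = tens E' h (T k).
Proof.
move=> bT; pose c := opnorm T; have c0 : 0 <= c := opnorm_ge0 bT.
have [b1 s1 _] := pos_scale (sqr_ge0 c) (pos_id K).
have [b2 s2 _] := pos_adjM bT.
have pT : pos (((c ^+ 2)%:C *: id) - (adj T \o T)).
  split; [exact: bop_sub|by rewrite adjB // s1 s2|].
  move=> v; rewrite !fctE rinDl rinNl rinZl rin_sq -[X in _ - rin X _]/((adj T \o T) v).
  rewrite -nrm_adjM // subr_ge0 -exprMn ler_pXn2r ?nnegrE ?mulr_ge0 ?nrm_ge0 //.
  exact: ler_opnorm.
have [S [[bS sS _] SS _]] := pos_sqrt pT.
have key k k' : inner (T k) (T k') + inner (S k) (S k') = (c ^+ 2)%:C * inner k k'.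
  rewrite (adjE _ _ bS) sS -[inner k (S _)]/(inner k ((S \o S) k')) SS.
  rewrite (adjE _ _ bT) !fctE inBr inZr conj_Creal ?complex_real //=.
  by rewrite addrC subrK.
pose G := lspan (range (fun p : H * K =>
  (tens E p.1 p.2, (tens E' p.1 (T p.2), tens E p.1 (S p.2))))).
have GE p q : G p -> G q ->
    inner p.2.1 q.2.1 + inner p.2.2 q.2.2 = (c ^+ 2)%:C * inner p.1 q.1.
  move=> Gp; pose P q := inner p.2.1 q.2.1 + inner p.2.2 q.2.2 = (c ^+ 2)%:C * inner p.1 q.1.
  apply: (lspan_min (T := P)) q.
  - by rewrite /P /= !in0r mulr0 addr0.
  - move=> a u v; rewrite /P /= !inDr !inZr => hu hv.
    by rewrite addrACA -mulrDr hu hv; ring.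
  - move=> _ [[h k] _ <-]; rewrite {}/P /=; move: p Gp.
    pose P p := inner p.2.1 (tens E' h (T k)) + inner p.2.2 (tens E h (S k)) =
       (c ^+ 2)%:C * inner p.1 (tens E h k).
    apply: (lspan_min (T := P)).
    + by rewrite /P /= !in0l mulr0 addr0.
    + move=> a u v; rewrite /P /= !inDl !inZl => hu hv.
      by rewrite addrACA -mulrDr hu hv; ring.
    + by move=> _ [[h' k'] _ <-]; rewrite /P /= !tens_inner -mulrDr key; ring.
have [|X [bX Xe _]] := bop_extend (tens_totalE E) c0
    (f := fun p : H * K => tens E' p.1 (T p.2)).
  move=> [u v] Guv /=.
  have [w Gw] : exists w, G (u, (v, w)).
    move: Guv; pose P (p : E * E') := exists w, G (p.1, (p.2, w)).
    apply: (lspan_min (T := P)).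
    - by exists 0; exact: lspan0.
    - move=> a p q [w1 h1] [w2 h2]; exists (a *: w1 + w2).
      exact: (lspan_lc a h1 h2).
    - by move=> _ [[h k] _ <-]; exists (tens E h (S k)); apply: lspan_self; exists (h, k).
  have := GE _ _ Gw Gw; rewrite /= !in_nrm -rmorphD -rmorphM => /complexI h.
  rewrite -(ler_pXn2r (n := 2)) ?nnegrE ?mulr_ge0 ?nrm_ge0 // exprMn -h.
  by rewrite lerDl sqr_ge0.
by exists X; split=> // h k; rewrite (Xe (h, k)).
Qed.

Lemma amplifyl_ex H H' K (E : htensor H K) (E' : htensor H' K) (T : H -> H') :
  bop T -> exists X : E -> E', bop X /\ forall h k, X (tens E h k) = tens E' (T h) k.
Proof.
move=> bT.
(* The same space read as a tensor product of K and H0, so that the left leg becomes the right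
   one. *)
pose F (H0 : hilbert R) (E0 : htensor H0 K) := HTensor
  (htensor_space := E0) (tens := fun k h => tens E0 h k)
  (fun h => tens_linear_r E0 h) (fun k => tens_linear_l E0 k)
  (fun k k' h h' => etrans (tens_inner E0 h h' k k') (mulrC _ _)).
have tot (H0 : hilbert R) (E0 : htensor H0 K) :
   closure (lspan [set v | exists k h, v = tens E0 h k]) = setT.
  rewrite -[RHS](tens_total E0); congr (closure (lspan _)); apply/seteqP.
  by split=> v [a [b ->]]; exists b, a.
have [X [bX hX]] := @amplify_ex K H H' (F _ _ (tot _ E)) (F _ _ (tot _ E')) T bT.
by exists X; split=> // h k; exact: (hX k h).
Qed.

End HTensor.

(** * Tensor products of operators and permutations of legs *)

Section OpTensor.
Variable R : realType.
Variable tp : forall H K : hilbert R, htensor H K.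
Local Notation C := R[i].
Implicit Types H K L : hilbert R.
Local Notation ot := (@optens R tp _ _ _ _).

Lemma optens_ex H H' K K' (S : H -> H') (T : K -> K') : bop S -> bop T ->
  exists X : tp H K -> tp H' K', bop X /\
    forall h k, X (tens (tp H K) h k) = tens (tp H' K') (S h) (T k).
Proof.
move=> bS bT.
have [X [bX hX]] := amplify_ex (tp H K) (tp H K') bT.
have [Y [bY hY]] := amplifyl_ex (tp H K') (tp H' K') bS.
by exists (Y \o X); split=> [|h k /=]; [exact: bop_comp|rewrite hX hY].
Qed.

Lemma optensP H H' K K' (S : H -> H') (T : K -> K') : bop S -> bop T ->
  bop (ot S T) /\ forall h k,
    ot S T (tens (tp H K) h k) = tens (tp H' K') (S h) (T k).
Proof. by move=> bS bT; have /(xgetPex (fun=> 0)) := optens_ex bS bT. Qed.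

Lemma bop_optens H H' K K' (S : H -> H') (T : K -> K') : bop S -> bop T ->
  bop (ot S T).
Proof. by move=> bS /(optensP bS) []. Qed.

Lemma optensE H H' K K' (S : H -> H') (T : K -> K') h k : bop S -> bop T ->
  ot S T (tens (tp H K) h k) = tens (tp H' K') (S h) (T k).
Proof. by move=> bS /(optensP bS) []. Qed.

Lemma optens_uniq H H' K K' (S : H -> H') (T : K -> K') X : bop S -> bop T ->
  bop X -> (forall h k, X (tens (tp H K) h k) = tens (tp H' K') (S h) (T k)) ->
  X = ot S T.
Proof.
move=> bS bT bX h; apply: tens_ext => //; first exact: bop_optens.
by move=> a b; rewrite h optensE.
Qed.

Lemma optens_id H K : ot (@id H) (@id K) = id.
Proof.
symmetry; apply: optens_uniq; [exact: bop_id|exact: bop_id|exact: bop_id|by []].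
Qed.

Lemma optens_comp H H' H2 K K' K2 (S : H -> H') (S' : H' -> H2) (T : K -> K')
    (T' : K' -> K2) : bop S -> bop S' -> bop T -> bop T' ->
  ot S' T' \o ot S T = ot (S' \o S) (T' \o T).
Proof.
move=> bS bS' bT bT'; have [b1 b2] := (bop_optens bS bT, bop_optens bS' bT').
apply: optens_uniq; [exact: bop_comp|exact: bop_comp|exact: bop_comp|].
by move=> h k /=; rewrite !optensE.
Qed.

Lemma optens_lcl H H' K K' (a : C) (S S' : H -> H') (T : K -> K') :
  bop S -> bop S' -> bop T ->
  ot (a *: S + S') T = a *: ot S T + ot S' T.
Proof.
move=> bS bS' bT; symmetry; have [b1 b2] := (bop_optens bS bT, bop_optens bS' bT).
apply: optens_uniq => //; [exact: bop_lc|exact: bop_lc|].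
by move=> h k; rewrite !fctE !optensE // tensDl tensZl.
Qed.

Lemma optens_lcr H H' K K' (a : C) (S : H -> H') (T T' : K -> K') :
  bop S -> bop T -> bop T' ->
  ot S (a *: T + T') = a *: ot S T + ot S T'.
Proof.
move=> bS bT bT'; symmetry; have [b1 b2] := (bop_optens bS bT, bop_optens bS bT').
apply: optens_uniq => //; [exact: bop_lc|exact: bop_lc|].
by move=> h k; rewrite !fctE !optensE // tensDr tensZr.
Qed.

Lemma adj_optens H H' K K' (S : H -> H') (T : K -> K') : bop S -> bop T ->
  adj (ot S T) = ot (adj S) (adj T).
Proof.
move=> bS bT; have [bS' bT'] := (bop_adj bS, bop_adj bT).
have b1 := bop_optens bS bT.
apply: optens_uniq => //; first exact: bop_adj.
move=> h k; apply/eqP; rewrite -subr_eq0; apply/eqP.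
apply: (in_total_eq0 (tens_total (tp H K))) => _ [h' [k' ->]].
by rewrite inBl adjEr // optensE // !tens_inner !adjEr // subrr.
Qed.

Lemma unitary_optens H H' K K' (S : H -> H') (T : K -> K') :
  unitary S -> unitary T -> unitary (ot S T).
Proof.
move=> [bS S1 S2] [bT T1 T2]; have [bS' bT'] := (bop_adj bS, bop_adj bT).
split; first exact: bop_optens.
  by rewrite adj_optens // optens_comp // S1 T1 optens_id.
by rewrite adj_optens // optens_comp // S2 T2 optens_id.
Qed.

(** T -> 1 (x) T is a homomorphism of the C*-algebra of all bounded operators, hence contractive. *)
Lemma opnorm_optensl H K (T : K -> K) : bop T -> opnorm (ot (@id H) T) <= opnorm T.
Proof.
have cB : cstar_algebra (@bop R K K).
  split; last by move=> x [].
  split=> //; [exact: bop_cst0|by move=> a x y; exact: bop_lc| |].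
    by move=> x y; exact: bop_comp.
  by move=> x; exact: bop_adj.
have sh : star_hom (@bop R K K) (fun T => ot (@id H) T).
  have bi := bop_id H; split.
  - by move=> x bx; exact: bop_optens.
  - by move=> a x y bx by_; rewrite optens_lcr.
  - by move=> x y bx by_; rewrite optens_comp.
  - by move=> x bx; rewrite adj_optens // adj_id.
exact: (star_hom_le cB (bop_id K) sh).
Qed.

Lemma opnorm_optensr H K (T : H -> H) : bop T -> opnorm (ot T (@id K)) <= opnorm T.
Proof.
have cB : cstar_algebra (@bop R H H).
  split; last by move=> x [].
  split=> //; [exact: bop_cst0|by move=> a x y; exact: bop_lc| |].
    by move=> x y; exact: bop_comp.
  by move=> x; exact: bop_adj.
have sh : star_hom (@bop R H H) (fun T => ot T (@id K)).
  have bi := bop_id K; split.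
  - by move=> x bx; exact: bop_optens.
  - by move=> a x y bx by_; rewrite optens_lcl.
  - by move=> x y bx by_; rewrite optens_comp.
  - by move=> x bx; rewrite adj_optens // adj_id.
exact: (star_hom_le cB (bop_id H) sh).
Qed.

Lemma optens_split H H' K K' (S : H -> H') (T : K -> K') : bop S -> bop T ->
  ot S T = ot id T \o ot S id.
Proof.
by move=> bS bT; rewrite optens_comp //; exact: bop_id.
Qed.

Lemma tassocP H K L : unitary (@tassoc R tp H K L) /\
  forall h k l, @tassoc R tp _ _ _ (tens (tp (tp H K) L) (tens (tp H K) h k) l) =
    tens (tp H (tp K L)) h (tens (tp K L) k l).
Proof.
pose e (p : H * K * L) := tens (tp (tp H K) L) (tens (tp H K) p.1.1 p.1.2) p.2.
pose f (p : H * K * L) := tens (tp H (tp K L)) p.1.1 (tens (tp K L) p.1.2 p.2).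
have te : closure (lspan (range e)) = setT.
  have h := tens_total2 (tp (tp H K) L) (tens_total (tp H K)) (T := setT).
  rewrite -[RHS]h; last first.
    rewrite -subTset => v _; apply: subset_closure; exact: lspan_self.
  congr (closure (lspan _)); apply/seteqP; split=> v.
    by move=> [[[h0 k] l] _ <-]; exists (tens (tp H K) h0 k), l; split=> //; exists h0, k.
  by move=> [_ [l [[h0 [k ->]] _ ->]]]; exists (h0, k, l).
have [|V [iV Ve]] := isometry_extend te (f := f).
  by move=> p q; rewrite /e /f !tens_inner mulrA.
have /(xgetPex (fun=> 0)) [bX hX] : exists X : tp (tp H K) L -> tp H (tp K L),
    bop X /\ forall h k l, X (tens _ (tens _ h k) l) = tens _ h (tens _ k l).
  by exists V; split=> [|h k l]; [case: iV|exact: (Ve (h, k, l))].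
rewrite -/(@tassoc R tp _ _ _) in bX hX; split=> //.
have -> : @tassoc R tp H K L = V.
  apply: tens_ext3l => //; first by case: iV.
  by move=> h k l; rewrite hX (Ve (h, k, l)).
apply: isometry_unitary => //.
have h := tens_total2 (tp H (tp K L)) (S := setT) _ (tens_total (tp K L)).
rewrite -subTset -h; last first.
  rewrite -subTset => v _; apply: subset_closure; exact: lspan_self.
apply: closureS; apply: lspan_mono => v.
by move=> [h0 [_ [_ [k [l ->]] ->]]]; exists (e (h0, k, l)).
Qed.

Lemma unitary_tassoc H K L : unitary (@tassoc R tp H K L).
Proof. by case: (tassocP H K L). Qed.
Lemma tassocE H K L h k l :
  @tassoc R tp _ _ _ (tens (tp (tp H K) L) (tens (tp H K) h k) l) =
    tens (tp H (tp K L)) h (tens (tp K L) k l).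
Proof. by case: (tassocP H K L) => _; apply. Qed.
Lemma adj_tassocE H K L h k l :
  adj (@tassoc R tp H K L) (tens (tp H (tp K L)) h (tens (tp K L) k l))
  = tens (tp (tp H K) L) (tens (tp H K) h k) l.
Proof.
rewrite -tassocE; have [_ _ h1] := unitary_tassoc H K L.
by rewrite -[LHS]/((adj _ \o _) _) h1.
Qed.

(** Conjugation by this unitary carries an operator on legs two and three to the same operator on
    legs one and three, which exhibits iota (x) Delta_N as an amplification. *)
Lemma exchange_ex H K L : exists2 X : tp H (tp K L) -> tp K (tp H L), unitary X &
  forall h k l, X (tens (tp H (tp K L)) h (tens (tp K L) k l)) =
    tens (tp K (tp H L)) k (tens (tp H L) h l).
Proof.
pose e (H K : hilbert R) (p : H * K * L) := tens (tp H (tp K L)) p.1.1 (tens (tp K L) p.1.2 p.2).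
pose f (p : H * K * L) := tens (tp K (tp H L)) p.1.2 (tens (tp H L) p.1.1 p.2).
have te (H0 K0 : hilbert R) : closure (lspan (range (e H0 K0))) = setT.
  have h := tens_total2 (tp H0 (tp K0 L)) (S := setT) _ (tens_total (tp K0 L)).
  rewrite -[RHS]h; last first.
    rewrite -subTset => v _; apply: subset_closure; exact: lspan_self.
  congr (closure (lspan _)); apply/seteqP; split=> v.
    by move=> [[[h0 k] l] _ <-]; exists h0, (tens (tp K0 L) k l); split=> //; exists k, l.
  by move=> [h0 [_ [_ [k [l ->]] ->]]]; exists (h0, k, l).
have [|V [iV Ve]] := isometry_extend (te H K) (f := f).
  by move=> p q; rewrite /e /f !tens_inner mulrCA.
exists V; last by move=> h k l; exact: (Ve (h, k, l)).
apply: isometry_unitary => //; rewrite -subTset -(te K H).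
apply: closureS; apply: lspan_mono => v [[[k h] l] _ <-].
by exists (e H K (h, k, l)) => //; rewrite Ve.
Qed.

End OpTensor.

(** * Finite direct sums of copies of a Hilbert space *)

Section DirectSum.
Variables (R : realType) (H : hilbert R) (n : nat).
Local Notation C := R[i].

(** Approximating an operator at n vectors amounts to approximating its diagonal amplification at
    one vector of H^n. Functions on ['I_n] bring the module structure with them. *)
Definition dsum : Type := 'I_n -> H.

HB.instance Definition _ := GRing.Lmodule.copy dsum ('I_n -> H).

Definition dsum_inner (x y : dsum) : C := \sum_i inner (x i) (y i).
Definition dsum_sq (x : dsum) : R := \sum_i nrm (x i) ^+ 2.
Definition dsum_norm (x : dsum) : C := (Num.sqrt (dsum_sq x))%:C.

Lemma dsum_sq_ge0 x : 0 <= dsum_sq x.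
Proof. by apply: sumr_ge0 => i _; rewrite sqr_ge0. Qed.

Lemma dsum_innerE x : dsum_inner x x = (dsum_sq x)%:C.
Proof. by rewrite rmorph_sum; apply: eq_bigr => i _; rewrite in_nrm. Qed.

Lemma dsum_sq_comb (a b : R) x y :
  dsum_sq (a%:C *: x + b%:C *: y) =
  a ^+ 2 * dsum_sq x + 2 * a * b * (\sum_i rin (x i) (y i)) + b ^+ 2 * dsum_sq y.
Proof.
rewrite /dsum_sq !big_distrr /= -!big_split /=; apply: eq_bigr => i _.
rewrite -!rin_sq -[(_ + _) i]/(a%:C *: x i + b%:C *: y i).
by rewrite !rinDl !rinDr !rinZl !rinZr (rinC (x i)); ring.
Qed.

Lemma dsum_norm_triangle (x y : dsum) : dsum_norm (x + y) <= dsum_norm x + dsum_norm y.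
Proof.
rewrite /dsum_norm -rmorphD lecR.
have a0 := sqrtr_ge0 (dsum_sq x); have b0 := sqrtr_ge0 (dsum_sq y).
rewrite -(ler_pXn2r (n := 2)) ?nnegrE ?sqrtr_ge0 ?addr_ge0 //.
have ea := sqr_sqrtr (dsum_sq_ge0 x); have eb := sqr_sqrtr (dsum_sq_ge0 y).
rewrite sqr_sqrtr ?dsum_sq_ge0 // sqrrD ea eb.
have := dsum_sq_comb 1 1 x y; rewrite !scale1r => ->.
rewrite !expr1n !mul1r lerD2r lerD2l mulr1 mulr2n.
set r := \sum_i _.
set a := Num.sqrt (dsum_sq x) in a0 ea *; set b := Num.sqrt (dsum_sq y) in b0 eb *.
suff : r <= a * b by lra.
(* A vanishing norm makes the quadratic polynomial affine in one coefficient, and the value chosen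
   for it would make the polynomial negative unless r = 0. *)
have [a00|a00] := eqVneq a 0.
  have [->|r0] := eqVneq r 0; first by rewrite a00 mul0r.
  have := dsum_sq_comb (- (dsum_sq y + 1) / r) 1 x y.
  have := dsum_sq_ge0 ((- (dsum_sq y + 1) / r)%:C *: x + 1%:C *: y).
  move=> {}h1 {}h2; rewrite h2 -ea a00 expr0n /= -/r in h1.
  have : (- (dsum_sq y + 1) / r) * r = - (dsum_sq y + 1) by rewrite divfK.
  set q := _ / r in h1 *; move=> hq; have y0 := dsum_sq_ge0 y.
  have : 2 * q * 1 * r = 2 * (q * r) by ring.
  rewrite hq => e; rewrite e in h1; lra.
have [b00|b00] := eqVneq b 0.
  have [->|r0] := eqVneq r 0; first by rewrite b00 mulr0.
  have := dsum_sq_comb 1 (- (dsum_sq x + 1) / r) x y.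
  have := dsum_sq_ge0 (1%:C *: x + (- (dsum_sq x + 1) / r)%:C *: y).
  move=> {}h1 {}h2; rewrite h2 -eb b00 [0 ^+ 2]expr0n /= -/r in h1.
  have : (- (dsum_sq x + 1) / r) * r = - (dsum_sq x + 1) by rewrite divfK.
  set q := _ / r in h1 *; move=> hq; have x0 := dsum_sq_ge0 x.
  have : 2 * 1 * q * r = 2 * (q * r) by ring.
  rewrite hq => e; rewrite e in h1; lra.
have := dsum_sq_ge0 (b%:C *: x + (- a)%:C *: y).
rewrite dsum_sq_comb -/r -ea -eb => h.
have : 0 < a * b by rewrite mulr_gt0 // lt_neqAle eq_sym ?a00 ?b00.
nra.
Qed.

Lemma dsum_normZ (c : C) (x : dsum) : dsum_norm (c *: x) = `|c| * dsum_norm x.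
Proof.
rewrite /dsum_norm -nrmE -rmorphM; congr (_%:C).
have -> : dsum_sq (c *: x) = nrm c ^+ 2 * dsum_sq x.
  rewrite /dsum_sq big_distrr /=; apply: eq_bigr => i _.
  by rewrite -exprMn -nrmZ.
by rewrite sqrtrM ?sqr_ge0 // sqrtr_sqr ger0_norm ?nrm_ge0.
Qed.

Lemma dsum_norm_eq0 (x : dsum) : dsum_norm x = 0 -> x = 0.
Proof.
move=> /complexI /eqP; rewrite sqrtr_eq0 => x0.
have {x0} : dsum_sq x == 0 by rewrite eq_le x0 dsum_sq_ge0.
rewrite psumr_eq0 => [/allP h|i _]; last by rewrite sqr_ge0.
apply/funext => i; apply: nrm_eq0; apply/eqP; rewrite -sqrf_eq0.
exact: h (mem_index_enum i).
Qed.

HB.instance Definition _ := Lmodule_isNormed.Build C dsum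
  dsum_norm_triangle dsum_normZ dsum_norm_eq0.

Lemma dsum_nrm (x : dsum) : nrm x = Num.sqrt (dsum_sq x).
Proof. by []. Qed.

Lemma dsum_nrm_sq (x : dsum) : nrm x ^+ 2 = \sum_i nrm (x i) ^+ 2.
Proof. by rewrite dsum_nrm sqr_sqrtr // dsum_sq_ge0. Qed.

Lemma dsum_coord_le (x : dsum) i : nrm (x i) <= nrm x.
Proof.
rewrite -(ler_pXn2r (n := 2)) ?nnegrE ?nrm_ge0 // dsum_nrm_sq (bigD1 i) //=.
by rewrite lerDl sumr_ge0 // => j _; rewrite sqr_ge0.
Qed.

Lemma dsum_le_coord (x : dsum) (e : R) : 0 <= e -> (forall i, nrm (x i) <= e) ->
  nrm x <= n%:R * e.
Proof.
move=> e0 h.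
rewrite -(ler_pXn2r (n := 2)) ?nnegrE ?nrm_ge0 ?mulr_ge0 // dsum_nrm_sq.
apply: (@le_trans _ _ (\sum_(i < n) e ^+ 2)).
  by apply: ler_sum => i _; rewrite ler_pXn2r ?nnegrE ?nrm_ge0.
(* The crude bound n <= n^2 is enough. *)
rewrite sumr_const card_ord -[_ *+ n]mulr_natl exprMn ler_wpM2r ?sqr_ge0 //.
by rewrite -natrX ler_nat; case: (n) => // m; rewrite -{1}(expn1 m.+1) leq_pexp2l.
Qed.

Lemma dsum_complete (F : set_system dsum) : ProperFilter F -> cauchy F -> cvg F.
Proof.
move=> FF /cauchyP cF; apply/cvg_ex.
have hc (e : R) : 0 < e -> exists2 x, F [set y | nrm (x - y) < e] & True.
  move=> e0; have e0' : 0 < e%:C by rewrite ltcR.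
  have [x Fx] := cF _ e0'; exists x => //.
  apply: filterS Fx => y; rewrite -ball_normE /ball_ /= -nrmE ltcR.
  by [].
have hi i : exists z : H, (fun x : dsum => x i) @ F --> z.
  apply: cauchy_nrm_cvg => e e0.
  have [|x Fx _] := hc (e / 2); first by rewrite divr_gt0.
  exists [set y i | y in [set y | nrm (x - y) < e / 2]].
    by move: Fx; apply: (@filterS _ F) => y xy; exists y.
  move=> _ _ [y /= xy <-] [z /= xz <-].
  have h1 : nrm (x i - y i) < e / 2 := le_lt_trans (dsum_coord_le (x - y) i) xy.
  have h2 : nrm (x i - z i) < e / 2 := le_lt_trans (dsum_coord_le (x - z) i) xz.
  apply: le_lt_trans (ler_nrm_trans (x i) _ _) _; rewrite nrmB; lra.
have [z hz] := choice hi; exists z.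
apply/cvg_nrmP => e e0.
have n1 : 0 < n%:R + 1 :> R by rewrite ltr_wpDl.
have e1 : 0 < e / (n%:R + 1) by rewrite divr_gt0.
have : F [set y : dsum | forall i, nrm (z i - y i) < e / (n%:R + 1)].
  apply: filter_forall => i; have /cvg_nrmP h := hz i; exact: (h _ e1).
apply: filterS => y hy /=.
have : nrm ((z : dsum) - y) <= n%:R * (e / (n%:R + 1)).
  apply: dsum_le_coord; first exact: ltW.
  by move=> i; apply/ltW; exact: (hy i).
move/le_lt_trans; apply; rewrite mulrA ltr_pdivrMr // mulrC.
by rewrite ltr_pM2l // ltrDl.
Qed.

HB.instance Definition _ := Uniform_isComplete.Build dsum dsum_complete.

Lemma dsum_innerDl (y : dsum) : zmod_morphism (dsum_inner ^~ y).
Proof.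
move=> x x'; rewrite /dsum_inner -sumrB; apply: eq_bigr => i _; exact: inBl.
Qed.
Lemma dsum_innerDr (x : dsum) : zmod_morphism (dsum_inner x).
Proof.
move=> y y'; rewrite /dsum_inner -sumrB; apply: eq_bigr => i _; exact: inBr.
Qed.
Lemma dsum_innerZl (y : dsum) : scalable_for *%R (dsum_inner ^~ y).
Proof.
move=> a x; rewrite /dsum_inner mulr_sumr; apply: eq_bigr => i _; exact: inZl.
Qed.
Lemma dsum_innerZr (x : dsum) : scalable_for (@Num.conj C \; *%R) (dsum_inner x).
Proof.
move=> a y; rewrite /dsum_inner /= mulr_sumr; apply: eq_bigr => i _; exact: inZr.
Qed.

HB.instance Definition _ := isBilinear.Build C dsum dsum C *%R (@Num.conj C \; *%R)
  dsum_inner dsum_innerDl dsum_innerDr dsum_innerZl dsum_innerZr.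

Lemma dsum_innerC x y : dsum_inner x y = (-1) ^+ false * Num.conj (dsum_inner y x).
Proof.
rewrite expr0 mul1r /dsum_inner rmorph_sum; apply: eq_bigr => i _; exact: inC.
Qed.

HB.instance Definition _ := isHermitianSesquilinear.Build C dsum false (@Num.conj C)
  dsum_inner dsum_innerC.

Lemma dsum_inner_gt0 x : x != 0 -> 0 < dsum_inner x x.
Proof.
move=> x0; rewrite dsum_innerE ltcR lt_neqAle dsum_sq_ge0 andbT eq_sym.
apply: contra_neq x0 => h; apply: dsum_norm_eq0.
by rewrite /dsum_norm h sqrtr0.
Qed.

HB.instance Definition _ := isDotProduct.Build C dsum dsum_inner dsum_inner_gt0.

Lemma dsum_inner_norm (x : dsum) : dsum_inner x x = `|x| ^+ 2.
Proof.
rewrite dsum_innerE -nrmE -rmorphXn /=; congr (_%:C).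
by rewrite dsum_nrm sqr_sqrtr // dsum_sq_ge0.
Qed.

Definition dsumH : hilbert R :=
  @Hilbert R dsum (dsum_inner : {dot dsum for @Num.conj C}) dsum_inner_norm.

Definition dsum_in (i : 'I_n) (x : H) : dsumH := fun j => if j == i then x else 0.

Lemma dsum_in_inner i j x y : inner (dsum_in i x) (dsum_in j y) =
  if i == j then inner x y else 0.
Proof.
change (\sum_k inner (dsum_in i x k) (dsum_in j y k) = if i == j then inner x y else 0).
rewrite (bigD1 i) //= big1 ?addr0 => [|k ki].
  by rewrite /dsum_in eqxx; case: eqP => // _; rewrite in0r.
by rewrite /dsum_in (negPf ki) in0l.
Qed.

Lemma dsum_decomp (x : dsumH) : x = \sum_i dsum_in i (x i).
Proof.
apply/funext => j; rewrite fct_sumE (bigD1 j) //= big1 ?addr0 => [|k kj].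
  by rewrite /dsum_in eqxx.
by rewrite /dsum_in eq_sym (negPf kj).
Qed.

Lemma bop_dsum_in i : bop (dsum_in i).
Proof.
apply: (bop_bound (c := 1)) => [a x y|x].
  by apply/funext => j; rewrite /dsum_in !fctE; case: eqP => // _; rewrite scaler0 addr0.
rewrite mul1r -(ler_pXn2r (n := 2)) ?nnegrE ?nrm_ge0 //.
by rewrite -!rin_sq /rin dsum_in_inner eqxx.
Qed.

End DirectSum.

(** * Amplifications, bicommutants and normality *)
Section StrongClosure.
Variable R : realType.
Implicit Types H K E : hilbert R.

(** Membership is reduced to finitely many vectors and one radius. Conversely the sets of
    approximants, indexed by finite lists of vectors and radii, generate a proper filter [G] that
    converges to T pointwise. *)
Lemma sclosureP H K (S : set (H -> K)) (T : H -> K) :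
  sclosure S T <-> bop T /\ forall n (v : 'I_n -> H) (e : R), 0 < e ->
    exists2 s, S s & forall i, nrm (T (v i) - s (v i)) < e.
Proof.
split=> [[bT cl]|[bT h]]; split=> //.
  move=> n v e e0.
  have ev t : (fun g : H -> K => g t) @ nbhs (T : {ptws H -> K}) --> T t.
    by move: t; apply/pointwise_cvgP.
  have /cl [s [Ss hs]] : nbhs (T : {ptws H -> K})
      [set g : H -> K | forall i, nrm (T (v i) - g (v i)) < e].
    have FN := nbhs_filter (T : {ptws H -> K}).
    apply: (@filter_forall {ptws H -> K} _
      (fun i (g : {ptws H -> K}) => nrm (T (v i) - g (v i)) < e) _ FN) => i.
    have /cvg_nrmP hv := ev (v i); exact: hv.
  by exists s.
pose G := [set Q : set (H -> K) | exists (l : seq H) (e : R), 0 < e /\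
   forall s, S s -> (forall v, v \in l -> nrm (T v - s v) < e) -> Q s].
have PG : ProperFilter G.
  split.
    move=> [l [e [e0 hl]]].
    have [s Ss hs] := h (size l) (fun i => nth 0 l i) e e0.
    apply: (hl s Ss) => v /(nthP 0) [i il <-]; exact: (hs (Ordinal il)).
  split.
  - by exists [::], 1.
  - move=> P Q [l [e [e0 hl]]] [l' [e' [e'0 hl']]].
    exists (l ++ l'), (Num.min e e'); split; first by rewrite lt_min e0.
    move=> s Ss hs; split; [apply: hl|apply: hl'] => // v vl;
      have := hs v; rewrite mem_cat vl ?orbT lt_min => /(_ isT) /andP[] //.
  - by move=> P Q PQ [l [e [e0 hl]]]; exists l, e; split=> // s Ss hs; apply/PQ/hl.
move=> B /= nB.
have GT : {ptws, G --> T}.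
  apply/pointwise_cvgP => t; apply/cvg_nrmP => e e0.
  by exists [:: t], e; split=> // s Ss; apply; rewrite inE.
have [l [e [e0 hl]]] : G B by exact: GT.
have [s Ss hs] := h (size l) (fun i => nth 0 l i) e e0.
exists s; split=> //; apply: (hl s Ss) => v /(nthP 0) [i il <-]; exact: (hs (Ordinal il)).
Qed.

Lemma sclosure_self H K (S : set (H -> K)) : S `<=` @bop R H K -> S `<=` sclosure S.
Proof.
move=> Sb s Ss; split; first exact: Sb.
by apply: subset_closure.
Qed.

Lemma sclosure_mono H K (S T : set (H -> K)) : S `<=` T -> sclosure S `<=` sclosure T.
Proof.
move=> ST X /sclosureP [bX h]; apply/sclosureP; split=> // n v e e0.
by have [s /ST Ts hs] := h n v e e0; exists s.
Qed.

Lemma sclosure_idem H K (S : set (H -> K)) : sclosure (sclosure S) `<=` sclosure S.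
Proof.
move=> X /sclosureP [bX h]; apply/sclosureP; split=> // n v e e0.
have [|s /sclosureP [_ hs] sX] := h n v (e / 2); first by rewrite divr_gt0.
have [|t St ts] := hs n v (e / 2); first by rewrite divr_gt0.
exists t => // i; have := ler_nrm_trans (s (v i)) (X (v i)) (t (v i)).
have := sX i; have := ts i; lra.
Qed.

Lemma nclosure_sclosure H K (S : set (H -> K)) : S `<=` @bop R H K ->
  nclosure S `<=` sclosure S.
Proof.
move=> Sb X [bX h]; apply/sclosureP; split=> // n v e e0.
pose c := \sum_i nrm (v i) + 1.
have c0 : 0 < c by rewrite ltr_wpDl // sumr_ge0 // => i _; rewrite nrm_ge0.
have [|s Ss Xs] := h (e / c); first by rewrite divr_gt0.
exists s => // i; have bd := bop_sub bX (Sb _ Ss).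
apply: le_lt_trans (ler_opnorm (v i) bd) _.
have vc : nrm (v i) < c.
  rewrite /c (bigD1 i) //= -addrA ltrDl ltr_wpDl // sumr_ge0 // => j _.
  by rewrite nrm_ge0.
move: Xs; rewrite ltr_pdivlMr //; have := opnorm_ge0 bd; have := nrm_ge0 (v i); nra.
Qed.

End StrongClosure.

(** * Multiples of the identity representation *)

Section Amplification.
Variable R : realType.
Local Notation C := R[i].
Implicit Types K E : hilbert R.

(* Normal representations that are multiples of the identity representation:
   f(x) = x (x) 1 up to unitary equivalence, through intertwiners V_i. *)
Definition ampl K E (f : (K -> K) -> (E -> E)) : Prop :=
  (forall x, bop x -> bop (f x)) /\
  exists (I : Type) (V : I -> K -> E),
  [/\ forall i, bop (V i),
      forall i x, bop x -> forall k, f x (V i k) = V i (x k),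
      forall i j, exists c : C, forall k k', inner (V i k) (V j k') = c * inner k k' &
      closure (lspan [set v | exists i k, v = V i k]) = setT].

Lemma ampl_bop K E (f : (K -> K) -> (E -> E)) x : ampl f -> bop x -> bop (f x).
Proof. by move=> [h _]; exact: h. Qed.

Lemma ampl_lc K E (f : (K -> K) -> (E -> E)) (a : C) x y : ampl f ->
  bop x -> bop y -> f (a *: x + y) = a *: f x + f y.
Proof.
move=> [fb [I [V [bV fV _ tot]]]] bx by_; have bxy := bop_lc a bx by_.
have [bfx bfy] := (fb _ bx, fb _ by_).
apply: (bop_total_eq tot (fb _ bxy) (bop_lc a bfx bfy)) => _ [i [k ->]].
change (f (a *: x + y) (V i k) = a *: f x (V i k) + f y (V i k)).
rewrite (fV _ _ bxy) (fV _ _ bx) (fV _ _ by_).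
change (V i (a *: x k + y k) = a *: V i (x k) + V i (y k)).
by rewrite (bopD _ _ (bV i)) (bopZ _ _ (bV i)).
Qed.

Lemma ampl_mul K E (f : (K -> K) -> (E -> E)) x y : ampl f ->
  bop x -> bop y -> f (x \o y) = f x \o f y.
Proof.
move=> [fb [I [V [bV fV _ tot]]]] bx by_; have bxy := bop_comp bx by_.
have [bfx bfy] := (fb _ bx, fb _ by_).
apply: (bop_total_eq tot (fb _ bxy) (bop_comp bfx bfy)) => _ [i [k ->]].
by rewrite /= !fV.
Qed.

(** The scalars c with (V_i k, V_j k') = c (k, k') are what moves x across the inner product. *)
Lemma ampl_adj K E (f : (K -> K) -> (E -> E)) x : ampl f ->
  bop x -> f (adj x) = adj (f x).
Proof.
move=> [fb [I [V [bV fV Vc tot]]]] bx; have bA := bop_adj bx.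
have [bfx bfA] := (fb _ bx, fb _ bA).
apply: (bop_total_eq tot bfA (bop_adj bfx)) => _ [i [k ->]].
rewrite fV //; apply/eqP; rewrite -subr_eq0; apply/eqP.
apply: (in_total_eq0 tot) => _ [j [k' ->]].
rewrite inBl adjEr // fV //; have [c hc] := Vc i j.
by rewrite !hc adjEr // subrr.
Qed.

Lemma ampl1 K E (f : (K -> K) -> (E -> E)) : ampl f -> f id = id.
Proof.
move=> [fb [I [V [bV fV _ tot]]]]; have b1 := bop_id K.
apply: (bop_total_eq tot (fb _ b1) (bop_id E)) => _ [i [k ->]].
by rewrite fV.
Qed.

Lemma ampl_star_hom K E (f : (K -> K) -> (E -> E)) (A : set (K -> K)) :
  A `<=` @bop R K K -> ampl f -> star_hom A f.
Proof.
move=> Ab af; split.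
- by move=> x /Ab; exact: ampl_bop.
- by move=> a x y /Ab bx /Ab by_; exact: ampl_lc.
- by move=> x y /Ab bx /Ab by_; exact: ampl_mul.
- by move=> x /Ab bx; exact: ampl_adj.
Qed.

Lemma amplB K E (f : (K -> K) -> (E -> E)) x y : ampl f ->
  bop x -> bop y -> f (x - y) = f x - f y.
Proof.
move=> af bx by_; rewrite addrC -scaleN1r (ampl_lc _ af by_ bx).
by rewrite scaleN1r addrC.
Qed.

Lemma cstar_bop K : cstar_algebra (@bop R K K).
Proof.
split; last by move=> x [].
split=> //; [exact: bop_cst0|by move=> a x y; exact: bop_lc| |].
  by move=> x y; exact: bop_comp.
by move=> x; exact: bop_adj.
Qed.

Lemma ampl_opnorm K E (f : (K -> K) -> (E -> E)) x : ampl f -> bop x ->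
  opnorm (f x) <= opnorm x.
Proof.
move=> af bx; have sf := ampl_star_hom (fun=> id) af.
exact: (star_hom_le (cstar_bop K) (bop_id K) sf).
Qed.

Lemma ampl_pos K E (f : (K -> K) -> (E -> E)) x : ampl f -> pos x -> pos (f x).
Proof.
move=> af px; have sf := ampl_star_hom (fun=> id) af; have [bx _ _] := px.
exact: (star_hom_pos (cstar_bop K) (bop_id K) sf).
Qed.

Lemma ampl_blin K E (f : (K -> K) -> (E -> E)) : ampl f -> blin (@bop R K K) f.
Proof.
move=> af; split; [by move=> x; exact: ampl_bop|by move=> a x y; exact: ampl_lc|].
by exists 1 => // x bx; rewrite mul1r; exact: ampl_opnorm.
Qed.

Lemma ampl_comp K E (L : hilbert R) (f : (K -> K) -> (E -> E)) (g : (E -> E) -> (L -> L)) :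
  ampl f -> ampl g -> ampl (fun x => g (f x)).
Proof.
move=> [fb [I [V [bV fV Vc tV]]]] [gb [J [W [bW gW Wc tW]]]].
split; first by move=> x /fb /gb.
exists (I * J)%type, (fun p k => W p.2 (V p.1 k)); split.
- by move=> [i j]; exact: (bop_comp (bW j) (bV i)).
- by move=> [i j] x bx k /=; rewrite gW ?fV //; exact: fb.
- move=> [i j] [i' j']; have [c hc] := Vc i i'; have [d hd] := Wc j j'.
  by exists (d * c) => k k'; rewrite /= hd hc mulrA.
- rewrite -subTset => v _; rewrite -[v]/(id v).
  apply: (total_image tW (bop_id L)) => _ [j [e ->]].
  apply: (total_image tV (bW j)) => _ [i [k ->]].
  by apply: subset_closure; apply: lspan_self; exists (i, j), k.
Qed.

Lemma ampl_conj K E (U : K -> E) : unitary U -> ampl (fun x => U \o x \o adj U).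
Proof.
move=> uU; have [bU U1 U2] := uU; have bA := bop_adj bU.
split; first by move=> x bx; apply: bop_comp => //; exact: bop_comp.
exists unit, (fun=> U); split=> //.
- move=> _ x bx k /=; congr (U (x _)).
  by rewrite -[LHS]/((adj U \o U) k) U2.
- move=> _ _; exists 1 => k k'; rewrite mul1r.
  by have [_ ->] := unitary_isometry uU.
- rewrite -subTset => v _; apply: subset_closure; apply: lspan_self.
  by exists tt, (adj U v); rewrite -[RHS]/((U \o adj U) v) U1.
Qed.

Lemma ampl_optens (tp : forall H K : hilbert R, htensor H K) (H K : hilbert R) :
  ampl (fun x : K -> K => @optens R tp H H K K id x).
Proof.
have bi := bop_id H; split; first by move=> x bx; exact: bop_optens.
exists H, (fun h => tens (tp H K) h); split.
- by move=> h; exact: bop_tensr.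
- by move=> h x bx k; rewrite optensE.
- by move=> h h'; exists (inner h h') => k k'; rewrite tens_inner.
- rewrite -[RHS](tens_total (tp H K)).
  by congr (closure (lspan _)); apply/seteqP; split=> v [h [k ->]]; exists h, k.
Qed.

Lemma ampl_dsum K E n (f : (K -> K) -> (E -> E)) : ampl f ->
  ampl (fun x (y : dsumH E n) => (fun i => f x (y i)) : dsumH E n).
Proof.
move=> af; have [fb [I [V [bV fV Vc tV]]]] := af; split.
  move=> x bx; have bfx := fb _ bx.
  apply: (bop_bound (c := opnorm (f x))) => [a y z|y].
    by apply/funext => i; rewrite !fctE (bopD _ _ bfx) (bopZ _ _ bfx).
  rewrite -(ler_pXn2r (n := 2)) ?nnegrE ?mulr_ge0 ?nrm_ge0 ?opnorm_ge0 //.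
  rewrite exprMn !dsum_nrm_sq big_distrr /=; apply: ler_sum => i _.
  rewrite -exprMn ler_pXn2r ?nnegrE ?mulr_ge0 ?nrm_ge0 ?opnorm_ge0 //.
  exact: ler_opnorm.
exists ('I_n * I)%type, (fun p k => dsum_in p.1 (V p.2 k)); split.
- by move=> [i j]; exact: (bop_comp (bop_dsum_in E i) (bV j)).
- move=> [i j] x bx k; apply/funext => i' /=; rewrite /dsum_in.
  by case: eqP => _; rewrite ?fV // (bop0 (fb _ bx)).
- move=> [i j] [i' j']; have [c hc] := Vc j j'.
  exists (if i == i' then c else 0) => k k' /=.
  by rewrite dsum_in_inner; case: eqP => _; rewrite ?hc ?mul0r.
- set X := [set v | _]; rewrite -subTset => v _; rewrite [v]dsum_decomp.
  have [c0 cl] := subspace_closure (subspace_lspan X).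
  elim/big_rec: _ => [//|i y _ cy]; rewrite -[dsum_in i _]scale1r.
  apply: cl => //.
  apply: (total_image tV (bop_dsum_in E i)) => _ [j [k ->]].
  by apply: subset_closure; apply: lspan_self; exists (i, j), k.
Qed.

Definition commutant K (M : set (K -> K)) : set (K -> K) :=
  [set S | bop S /\ forall m, M m -> S \o m = m \o S].

(** * The bicommutant theorem inside an amplification *)

Section Bicommutant.
Variables (K : hilbert R) (M : set (K -> K)).
Hypotheses (sM : star_algebra M) (M1 : M id).

Let bM : M `<=` @bop R K K. Proof. by case: sM. Qed.

Lemma commutant_adj S : commutant M S -> commutant M (adj S).
Proof.
move=> [bS h]; split=> [|m Mm]; first exact: bop_adj.
have bm := bM Mm; have [_ _ _ _ Ma] := sM.
have := h _ (Ma _ Mm) => /(congr1 (fun x => adj x)).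
by rewrite (adj_comp bS (bop_adj bm)) (adj_comp (bop_adj bm) bS) (adjK bm) => ->.
Qed.

(** The projection P onto the closure of f(M)x commutes with f(M). Its compressions V_j^* P V_i
    therefore lie in M', and T commutes with them; hence P commutes with f(T), and f(T)x = f(T)Px =
    P f(T)x lies in the closure. *)
Lemma bicommutant_vector E (f : (K -> K) -> (E -> E)) T (x : E) (e : R) :
  ampl f -> bop T -> (forall S, commutant M S -> S \o T = T \o S) -> 0 < e ->
  exists2 s, M s & nrm (f T x - f s x) < e.
Proof.
move=> af bT hT e0; have [fb [I [V [bV fV Vc tot]]]] := af.
have [_ M0 Ml MM Ma] := sM.
pose L := [set f s x | s in M].
have sL : subspace L.
  split; first by exists 0 => //; have := amplB af bT bT; rewrite !subrr => ->.
  move=> a _ _ [s Ms <-] [t Mt <-]; exists (a *: s + t); first exact: Ml.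
  by rewrite (ampl_lc _ af (bM Ms) (bM Mt)).
have fL m y : M m -> L y -> L (f m y).
  move=> Mm [s Ms <-]; exists (m \o s); first exact: MM.
  by rewrite (ampl_mul af (bM Mm) (bM Ms)).
have fcL m y : M m -> closure L y -> closure L (f m y).
  move=> Mm /closure_nrmP cy; apply/closure_nrmP => d d0.
  have bm := fb _ (bM Mm).
  have c1 : 0 < opnorm (f m) + 1 by have := opnorm_ge0 bm; lra.
  have [|z Lz yz] := cy (d / (opnorm (f m) + 1)); first by rewrite divr_gt0.
  exists (f m z); first exact: fL.
  rewrite -(bopB _ _ bm); apply: le_lt_trans (ler_opnorm _ bm) _.
  move: yz; rewrite ltr_pdivlMr //; have := opnorm_ge0 bm; have := nrm_ge0 (y - z).
  nra.
pose P := proj L; have bP := bop_proj sL.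
have Pf m y : M m -> P (f m y) = f m (P y).
  move=> Mm; have bm := fb _ (bM Mm).
  apply: (proj_uniq sL); first by apply: fcL => //; exact: proj_cl.
  move=> s Ls; rewrite -(bopB _ _ bm) (adjE _ _ bm) -(ampl_adj af (bM Mm)).
  by apply: (proj_orth sL); apply: fL => //; exact: Ma.
have PT : P \o f T = f T \o P.
  have bfT := fb _ bT.
  apply: (bop_total_eq tot); [exact: bop_comp|exact: bop_comp|].
  move=> _ [i [k ->]]; apply/eqP; rewrite -subr_eq0; apply/eqP.
  apply: (in_total_eq0 tot) => _ [j [k' ->]]; rewrite inBl.
  pose S := adj (V j) \o P \o V i.
  have bVj := bop_adj (bV j).
  have bS : bop S by apply: bop_comp => //; exact: bop_comp.
  have cS : commutant M S.
    split=> // m Mm; have bm := bM Mm; apply/funext => u; rewrite /S /=.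
    rewrite -(fV _ _ bm) Pf //; apply: in_inj => w.
    rewrite (adjEr _ _ (bV j)) (adjE _ _ (fb _ bm)) -(ampl_adj af bm).
    rewrite (fV _ _ (bop_adj bm)) -(adjEr _ _ (bV j)) -(adjE _ _ bm).
    by [].
  have := hT _ cS => /(congr1 (fun g => inner (g k) k')); rewrite /S /= => h.
  rewrite (fV _ _ bT) -(adjEr _ _ (bV j)) h (adjE _ _ bT) (adjEr _ _ (bV j)).
  rewrite (adjE _ _ bfT) -(ampl_adj af bT) (fV _ _ (bop_adj bT)).
  by rewrite subrr.
have Lx : L x by exists id => //; rewrite (ampl1 af).
have : closure L (f T x).
  have -> : f T x = P (f T x).
    have := congr1 (fun g => g x) PT; rewrite /= => ->.
    by congr (f T _); rewrite /P (proj_id sL) //; exact: subset_closure.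
  exact: proj_cl.
by move=> /closure_nrmP /(_ e e0) [_ [s Ms <-] h]; exists s.
Qed.

(** Finitely many vectors become a single one in the direct sum, whose representation is again an
    amplification. *)
Lemma bicommutant_ampl E (f : (K -> K) -> (E -> E)) T :
  ampl f -> bop T -> (forall S, commutant M S -> S \o T = T \o S) ->
  sclosure (f @` M) (f T).
Proof.
move=> af bT hT; apply/sclosureP; split; first exact: ampl_bop.
move=> n v e e0.
have [s Ms h] := bicommutant_vector (v : dsumH E n) (ampl_dsum n af) bT hT e0.
exists (f s); first by exists s.
by move=> i; apply: le_lt_trans h; exact: (dsum_coord_le (_ - _) i).
Qed.

Lemma ampl_id : ampl (@id (K -> K)).
Proof.
split=> //; exists unit, (fun=> id); split=> //.
- by move=> _; exact: bop_id.
- by move=> _ _; exists 1 => k k'; rewrite mul1r.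
- rewrite -subTset => v _; apply: subset_closure; apply: lspan_self.
  by exists tt, v.
Qed.

Lemma sclosure_commute T S : sclosure M T -> commutant M S -> S \o T = T \o S.
Proof.
move=> /sclosureP [bT h] [bS cS]; apply/funext => v; rewrite /=.
apply/eqP; rewrite -subr_eq0; apply/eqP/nrm_le0 => e e0.
have c0 : 0 < opnorm S + 1 by have := opnorm_ge0 bS; lra.
(* One s approximates T at both v and S v, and S s v = s S v bridges the two. *)
have [|s Ms hs] := h 2%N (fun i => if i == ord0 then v else S v) (e / (opnorm S + 1)).
  by rewrite divr_gt0.
have := hs ord0; have := hs ord_max; rewrite /= => h1 h2.
have e1 := congr1 (fun g => g v) (cS _ Ms); rewrite /= in e1.
have -> : S (T v) - T (S v) = S (T v - s v) - (T (S v) - s (S v)).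
  by rewrite (bopB _ _ bS) e1; hring.
apply: le_trans (ler_nrmB _ _) _; have := ler_opnorm (T v - s v) bS.
move: h1 h2; rewrite !ltr_pdivlMr //.
have := nrm_ge0 (T v - s v); have := nrm_ge0 (T (S v) - s (S v)).
have := opnorm_ge0 bS.
move: (nrm (S (T v - s v))) (nrm (T v - s v)) (nrm (T (S v) - s (S v))) (opnorm S) c0.
move=> a b c d d0 *; nra.
Qed.

Lemma bicommutantE T :
  sclosure M T <-> bop T /\ forall S, commutant M S -> S \o T = T \o S.
Proof.
split=> [h|[bT h]]; first by split; [case: h|move=> S; exact: sclosure_commute].
have := bicommutant_ampl ampl_id bT h.
by rewrite image_id.
Qed.

(** An infinite amplification is not strongly continuous on unbounded sets, so T is carried over
    through its commutation with M' and not as a limit. *)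
Lemma ampl_sclosure E (f : (K -> K) -> (E -> E)) T : ampl f -> sclosure M T ->
  sclosure (f @` M) (f T).
Proof. by move=> af /bicommutantE [bT h]; exact: bicommutant_ampl. Qed.

(** Joint multiplication and the adjoint are not strongly continuous, so the algebra operations are
    checked in the bicommutant. *)
Lemma sclosure_vn : von_neumann_algebra (sclosure M).
Proof.
have M0 : sclosure M 0 by apply: sclosure_self => //; case: sM.
split; last exact: sclosure_idem; last by exact: sclosure_self.
split=> //.
- by move=> T [].
- move=> a S T /bicommutantE [bS hS] /bicommutantE [bT hT]; apply/bicommutantE.
  split=> [|X cX]; first exact: bop_lc.
  have [bX _] := cX; apply/funext => v; rewrite /= !fctE (bopD _ _ bX) (bopZ _ _ bX).
  have := congr1 (fun g => g v) (hS _ cX); have := congr1 (fun g => g v) (hT _ cX).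
  by rewrite /= => -> ->.
- move=> S T /bicommutantE [bS hS] /bicommutantE [bT hT]; apply/bicommutantE.
  split=> [|X cX]; first exact: bop_comp.
  by rewrite compA (hS _ cX) -compA (hT _ cX) compA.
- move=> T /bicommutantE [bT hT]; apply/bicommutantE; split=> [|X cX].
    exact: bop_adj.
  have [bX _] := cX; have [bX' _] := commutant_adj cX.
  have := hT _ (commutant_adj cX) => /(congr1 (fun x => adj x)).
  by rewrite (adj_comp bX' bT) (adj_comp bT bX') (adjK bX) => ->.
Qed.

End Bicommutant.
End Amplification.

(** * Increasing nets of selfadjoint operators *)

Section Vigier.
Variables (R : realType) (H : hilbert R).
Local Notation C := R[i].
Implicit Types (S T x y z : H -> H) (X : set (H -> H)).

Lemma sa_in T v : selfadjoint T -> inner (T v) v = (rin (T v) v)%:C.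
Proof.
move=> [bT sT]; rewrite /rin.
have : Num.conj (inner (T v) v) = inner (T v) v by rewrite -inC (adjE v v bT) sT.
by case: (inner (T v) v) => a b [] hb; congr (_ +i* _); lra.
Qed.

Lemma sa_sub S T : selfadjoint S -> selfadjoint T -> selfadjoint (S - T).
Proof.
by move=> [bS sS] [bT sT]; split; [exact: bop_sub|rewrite adjB // sS sT].
Qed.

Lemma ople_pos S T : selfadjoint S -> selfadjoint T -> ople S T <-> pos (T - S).
Proof.
move=> sS sT; have sD := sa_sub sT sS; have [bD aD] := sD; split=> [h|[_ _ p] v].
  split=> // v; have := h v; rewrite -[T v - S v]/((T - S) v) sa_in // lecR.
  by [].
by rewrite -[T v - S v]/((T - S) v) sa_in // lecR; exact: p.
Qed.

Variables (X : set (H -> H)) (T : H -> H).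
Hypotheses (X0 : X !=set0) (Xs : X `<=` @selfadjoint R H).
Hypothesis Xd : forall x y, X x -> X y -> exists z, [/\ X z, ople x z & ople y z].
Hypothesis lubT : oplub X T.

Let sT : selfadjoint T. Proof. by case: lubT. Qed.

Lemma vigier_pos x : X x -> pos (T - x).
Proof.
by move=> Xx; apply/(ople_pos (Xs Xx) sT); case: lubT => _ h _; exact: h.
Qed.

Lemma vigier_pos2 x z : X x -> X z -> ople x z -> pos (z - x).
Proof. by move=> Xx Xz xz; apply/(ople_pos (Xs Xx) (Xs Xz)). Qed.

Lemma ople_trans_in x y z : X x -> X y -> X z -> ople x y -> ople y z -> ople x z.
Proof.
move=> Xx Xy Xz xy yz; apply/(ople_pos (Xs Xx) (Xs Xz)).
have -> : z - x = (z - y) + (y - x) by rewrite addrA subrK.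
by apply: pos_add; exact: vigier_pos2.
Qed.

Lemma pos_le_opnorm S Y : pos S -> pos (Y - S) -> bop Y -> opnorm S <= opnorm Y.
Proof.
move=> pS [_ _ pD] bY; apply: opnorm_sa_le => //; first exact: opnorm_ge0.
move=> v; have := pD v; rewrite !fctE rinDl rinNl subr_ge0 => /le_trans; apply.
apply: le_trans (rin_CS _ _) _; rewrite expr2 mulrA ler_wpM2r ?nrm_ge0 //.
exact: ler_opnorm.
Qed.

(** The numbers ((T - x)v, v) decrease along X, and [pos_sq_le] with the uniform bound c turns this
    into the Cauchy property of the vectors x v. The strong limit S is a selfadjoint upper bound, so
    T <= S, and ((T - z)k, k) is squeezed between 0 and ((S - z)k, k). *)
Lemma vigier k (e : R) : 0 < e ->
  exists2 x, X x & forall z, X z -> ople x z -> nrm ((T - z) k) < e.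
Proof.
have [x0 Xx0] := X0.
have [b0 a0] := Xs Xx0; have [bT aT] := sT.
have bD0 := bop_sub bT b0.
pose c := opnorm (T - x0); have c0 : 0 <= c := opnorm_ge0 bD0.
have cle x z : X x -> X z -> ople x0 x -> ople x z -> opnorm (z - x) <= c.
  move=> Xx Xz x0x xz; apply: pos_le_opnorm => //; first exact: vigier_pos2.
  have -> : (T - x0) - (z - x) = (T - z) + (x - x0).
    by apply/funext => v; rewrite !fctE; hring.
  by apply: pos_add; [exact: vigier_pos|exact: vigier_pos2].
have cauchy v (d : R) : 0 < d -> exists x, [/\ X x, ople x0 x &
    forall z, X z -> ople x z -> nrm ((z - x) v) < d].
  move=> d0; pose E := [set rin ((T - x) v) v | x in X].
  have Ei : has_inf E.
    split; first by exists (rin ((T - x0) v) v), x0.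
    by exists 0 => _ [x Xx <-]; case: (vigier_pos Xx) => _ _; exact.
  have c1 : 0 < c + 1 by lra.
  (* Chosen so that c times it stays below d^2. *)
  have d1 : 0 < d ^+ 2 / (c + 1) by rewrite divr_gt0 // exprn_gt0.
  have [_ [x1 Xx1 <-] hx1] := inf_adherent d1 Ei.
  have [x [Xx x1x x0x]] := Xd Xx1 Xx0.
  exists x; split=> // z Xz xz.
  have h1 : inf E <= rin ((T - z) v) v by apply: inf_lbound; [case: Ei|exists z].
  have h2 : rin ((z - x) v) v <= d ^+ 2 / (c + 1).
    have [_ _ /(_ v)] := vigier_pos2 Xx1 Xx x1x.
    move: h1 hx1; rewrite !fctE !rinDl !rinNl; lra.
  have pzx := vigier_pos2 Xx Xz xz.
  have h3 := pos_sq_le v pzx (cle _ _ Xx Xz x0x xz).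
  rewrite -(ltr_pXn2r (n := 2)) ?nnegrE ?nrm_ge0 ?ltW //.
  apply: le_lt_trans h3 _.
  have : c * rin ((z - x) v) v <= c * (d ^+ 2 / (c + 1)) by apply: ler_wpM2l.
  move/le_lt_trans; apply; rewrite mulrA ltr_pdivrMr // mulrC.
  by rewrite ltr_pM2l ?exprn_gt0 // ltrDl.
have lim_ex v : exists w : H, forall d : R, 0 < d -> exists x, [/\ X x, ople x0 x &
    forall z, X z -> ople x z -> nrm (w - z v) < d].
  pose B x := [set z v | z in [set z | X z /\ ople x z]].
  have refl x : X x -> ople x x.
    by move=> Xx w; rewrite subrr in0l.
  have PF : ProperFilter (filter_from X B).
    apply: filter_from_proper; last first.
      by move=> x Xx; exists (x v), x => //; split=> //; exact: refl.
    apply: filter_from_filter; first by exists x0.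
    move=> x y Xx Xy; have [z [Xz xz yz]] := Xd Xx Xy; exists z => //.
    by move=> _ [w [Xw zw] <-]; split; exists w => //; split=> //;
      apply: ople_trans_in zw.
  have [|y hy] := cauchy_nrm_cvg (F := filter_from X B).
    move=> d d0; have [|x [Xx x0x hx]] := cauchy v (d / 2); first by rewrite divr_gt0.
    exists (B x); first by exists x.
    move=> _ _ [z [Xz xz] <-] [w [Xw xw] <-].
    have := hx z Xz xz; have := hx w Xw xw; rewrite !fctE.
    have := ler_nrm_trans (x v) (z v) (w v); rewrite (nrmB (x v)); lra.
  exists y => d d0; have /cvg_nrmP /(_ d d0) [x Xx hx] := hy.
  have [z [Xz xz x0z]] := Xd Xx Xx0.
  exists z; split=> // w Xw zw; apply: hx; exists w => //; split=> //.
  exact: ople_trans_in zw.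
have [S hS] := choice lim_ex.
have refl x : X x -> ople x x by move=> Xx w; rewrite subrr in0l.
have two u v (d : R) : 0 < d -> exists x, [/\ X x, ople x0 x &
    forall z, X z -> ople x z -> nrm (S u - z u) < d /\ nrm (S v - z v) < d].
  move=> d0; have [x [Xx x0x hx]] := hS u d d0; have [y [Xy x0y hy]] := hS v d d0.
  have [z [Xz xz yz]] := Xd Xx Xy; exists z; split=> //.
    exact: ople_trans_in xz.
  move=> w Xw zw; split; [apply: hx|apply: hy] => //; exact: ople_trans_in zw.
have lS : linear S.
  move=> a u v; apply/eqP; rewrite -subr_eq0; apply/eqP/nrm_le0 => d d0.
  have a1 : 0 < nrm a + 2 by have := nrm_ge0 a; lra.
  have [|x [Xx _ hx]] := two u v (d / (nrm a + 2)); first by rewrite divr_gt0.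
  have [|y [Xy _ hy]] := hS (a *: u + v) (d / (nrm a + 2)); first by rewrite divr_gt0.
  have [z [Xz xz yz]] := Xd Xx Xy.
  have [h1 h2] := hx z Xz xz; have h3 := hy z Xz yz.
  have [bz _] := Xs Xz.
  have -> : S (a *: u + v) - (a *: S u + S v) = (S (a *: u + v) - z (a *: u + v))
     - (a *: (S u - z u) + (S v - z v)).
    by rewrite (bopD _ _ bz) (bopZ _ _ bz); hring.
  apply: le_trans (ler_nrmB _ _) _.
  have := ler_nrmD (a *: (S u - z u)) (S v - z v); rewrite nrmZ.
  have dt : d / (nrm a + 2) * (nrm a + 2) = d by rewrite divfK // gt_eqF.
  move: (d / (nrm a + 2)) dt h1 h2 h3 => t dt h1 h2 h3.
  have : nrm a * nrm (S u - z u) <= nrm a * t by apply: ler_wpM2l; [exact: nrm_ge0|exact: ltW].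
  lra.
have bS : bop S.
  apply: (bop_bound (c := opnorm x0 + c)) => // v.
  apply/ler_addgt0Pr => d d0; have [x [Xx x0x hx]] := hS v d d0.
  have := hx x Xx (refl _ Xx).
  have := ler_nrm_sub (S v) (x v); have := ler_nrm_sub (x v) (x0 v).
  have := ler_opnorm v b0; have [bx _] := Xs Xx.
  have := ler_opnorm v (bop_sub bx b0); have := cle x0 x Xx0 Xx (refl _ Xx0) x0x.
  rewrite !fctE; have := nrm_ge0 v; nra.
have sS : selfadjoint S.
  split=> //; apply: adj_uniq => // u v.
  apply/eqP; rewrite -subr_eq0; apply/eqP/nrm_le0 => d d0.
  have n1 : 0 < nrm u + nrm v + 1 by have := nrm_ge0 u; have := nrm_ge0 v; lra.
  have [|x [Xx _ hx]] := two u v (d / (nrm u + nrm v + 1)); first by rewrite divr_gt0.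
  have [h1 h2] := hx x Xx (refl _ Xx); have [bx sx] := Xs Xx.
  have -> : inner (S u) v - inner u (S v) = inner (S u - x u) v - inner u (S v - x v).
    by rewrite inBl inBr (adjE _ _ bx) sx; ring.
  apply: le_trans (ler_nrmB _ _) _.
  have := in_CS (S u - x u) v; have := in_CS u (S v - x v).
  have dt : d / (nrm u + nrm v + 1) * (nrm u + nrm v + 1) = d by rewrite divfK // gt_eqF.
  move: (d / (nrm u + nrm v + 1)) dt h1 h2 => t dt h1 h2.
  have : nrm (S u - x u) * nrm v <= t * nrm v by apply: ler_wpM2r; [exact: nrm_ge0|exact: ltW].
  have : nrm u * nrm (S v - x v) <= nrm u * t by apply: ler_wpM2l; [exact: nrm_ge0|exact: ltW].
  have := nrm_ge0 (S u - x u); lra.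
have TS : ople T S.
  case: lubT => _ _; apply=> // x Xx; apply/(ople_pos (Xs Xx) sS).
  have [bD aD] := sa_sub sS (Xs Xx); split=> // v.
  rewrite -oppr_le0; apply/ler_addgt0Pr => d d0; rewrite add0r.
  have n1 : 0 < nrm v + 1 by have := nrm_ge0 v; lra.
  have [|y [Xy _ hy]] := hS v (d / (nrm v + 1)); first by rewrite divr_gt0.
  have [z [Xz yz xz]] := Xd Xy Xx.
  have := hy z Xz yz; rewrite ltr_pdivlMr // => h.
  have [_ _ /(_ v)] := vigier_pos2 Xx Xz xz.
  have := rin_CS (z v - S v) v; rewrite (nrmB (z v)).
  rewrite !fctE !rinDl !rinNl; have := nrm_ge0 (S v - z v); have := nrm_ge0 v; nra.
move=> e0.
have c1 : 0 < c + 1 by lra.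
have n1 : 0 < nrm k + 1 by have := nrm_ge0 k; lra.
have d0 : 0 < e ^+ 2 / (c + 1) / (nrm k + 1) by rewrite !divr_gt0 // exprn_gt0.
have [x [Xx x0x hx]] := hS k _ d0.
exists x => // z Xz xz.
have := hx z Xz xz; rewrite ltr_pdivlMr // => h.
have pz := vigier_pos Xz.
have x0z : ople x0 z by exact: ople_trans_in xz.
have nz : opnorm (T - z) <= c.
  apply: pos_le_opnorm => //.
  have -> : (T - x0) - (T - z) = z - x0.
    by apply/funext => v; rewrite !fctE; hring.
  exact: vigier_pos2.
have h3 := pos_sq_le k pz nz.
have h4 : rin ((T - z) k) k < e ^+ 2 / (c + 1).
  have /(ople_pos sT sS) [_ _ /(_ k)] := TS.
  have := rin_CS (S k - z k) k; rewrite !fctE !rinDl !rinNl.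
  have := nrm_ge0 (S k - z k); lra.
rewrite -(ltr_pXn2r (n := 2)) ?nnegrE ?nrm_ge0 ?ltW //.
apply: le_lt_trans h3 _.
have : c * rin ((T - z) k) k <= c * (e ^+ 2 / (c + 1)) by apply: ler_wpM2l => //; exact: ltW.
move/le_lt_trans; apply; rewrite mulrA ltr_pdivrMr // mulrC.
by rewrite ltr_pM2l ?exprn_gt0 // ltrDl.
Qed.

End Vigier.

(** * Normality of amplifications *)

Section Normality.
Variable R : realType.

(** f(z)w tends to f(T)w along X: on vectors V_i k this is strong convergence to the least upper
    bound, and |f(T - z)| <= |T - x0| extends it to all w. Every upper bound of f(X) therefore
    dominates f(T). *)
Lemma ampl_normal (K E : hilbert R) (f : (K -> K) -> (E -> E)) (N : set (K -> K)) :
  ampl f -> normal_map N f.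
Proof.
move=> af X T X0 XN Xd NT lubT.
have Xs : X `<=` @selfadjoint R K by move=> x /XN [].
have [sT Tub _] := lubT; have [bT aT] := sT.
have sf x : selfadjoint x -> selfadjoint (f x).
  by move=> [bx ax]; split; [exact: ampl_bop|rewrite -ampl_adj // ax].
have mono x y : selfadjoint x -> selfadjoint y -> ople x y -> ople (f x) (f y).
  move=> sx sy /(ople_pos sx sy) p; apply/(ople_pos (sf _ sx) (sf _ sy)).
  rewrite -amplB //; [exact: ampl_pos|by case: sy|by case: sx].
split.
- exact: sf.
- by move=> _ [x Xx <-]; apply: mono => //; [exact: Xs|exact: Tub].
- move=> T' sT' ub; apply/(ople_pos (sf _ sT) sT').
  have [bD aD] := sa_sub sT' (sf _ sT); split=> // w.
  have [fb [I [V [bV fV Vc tot]]]] := af.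
  have [x0 Xx0] := X0.
  have bz z : X z -> bop (T - z) by move=> /Xs [bz _]; exact: bop_sub.
  pose P := [set w | forall e : R, 0 < e -> exists2 x, X x &
      forall z, X z -> ople x z -> nrm (f (T - z) w) < e].
  have tr x y z : X x -> X y -> X z -> ople x y -> ople y z -> ople x z.
    exact: ople_trans_in.
  have PV i k : P (V i k).
    move=> e e0; have c1 : 0 < opnorm (V i) + 1 by have := opnorm_ge0 (bV i); lra.
    have d0 : 0 < e / (opnorm (V i) + 1) by rewrite divr_gt0.
    have [x Xx hx] := vigier X0 Xs Xd lubT k d0; exists x => // z Xz xz.
    rewrite (fV _ _ (bz _ Xz)).
    have := hx z Xz xz; rewrite ltr_pdivlMr //.
    have := ler_opnorm ((T - z) k) (bV i); have := opnorm_ge0 (bV i).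
    have := nrm_ge0 ((T - z) k); nra.
  have Pl v : lspan [set v | exists i k, v = V i k] v -> P v.
    move: v; apply: lspan_min.
    - move=> e e0; exists x0 => // z Xz _.
      by rewrite (bop0 (fb _ (bz _ Xz))) nrm0.
    - move=> a u v hu hv e e0; have a1 : 0 < nrm a + 1 by have := nrm_ge0 a; lra.
      have [|x Xx hx] := hu (e / 2 / (nrm a + 1)); first by rewrite !divr_gt0.
      have [|y Xy hy] := hv (e / 2); first by rewrite divr_gt0.
      have [z [Xz xz yz]] := Xd _ _ Xx Xy; exists z => // t Xt zt.
      have bt := fb _ (bz _ Xt); rewrite (bopD _ _ bt) (bopZ _ _ bt).
      apply: le_lt_trans (ler_nrmD _ _) _; rewrite nrmZ.
      have := hx t Xt (tr _ _ _ Xx Xz Xt xz zt); rewrite ltr_pdivlMr //.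
      have := hy t Xt (tr _ _ _ Xy Xz Xt yz zt).
      have := nrm_ge0 a; have := nrm_ge0 (f (T - t) u); nra.
    - by move=> _ [i [k ->]]; exact: PV.
  have Pw : P w.
    move=> e e0; have b0 := bz _ Xx0.
    have c1 : 0 < opnorm (T - x0) + 1 by have := opnorm_ge0 b0; lra.
    have /closureT_nrmP /(_ w (e / 2 / (opnorm (T - x0) + 1))) [|w' lw' ww'] := tot.
      by rewrite !divr_gt0.
    have [|x Xx hx] := Pl _ lw' (e / 2); first by rewrite divr_gt0.
    have [y [Xy xy x0y]] := Xd _ _ Xx Xx0; exists y => // z Xz yz.
    have := hx z Xz (tr _ _ _ Xx Xy Xz xy yz).
    have bfz := fb _ (bz _ Xz).
    have nz : opnorm (f (T - z)) <= opnorm (T - x0).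
      apply: le_trans (ampl_opnorm af (bz _ Xz)) _.
      apply: pos_le_opnorm => //; first exact: vigier_pos Xz.
      have -> : (T - x0) - (T - z) = z - x0.
        by apply/funext => v; rewrite !fctE; hring.
      exact: (vigier_pos2 Xs Xx0 Xz (tr _ _ _ Xx0 Xy Xz x0y yz)).
    have := ler_opnorm (w - w') bfz; rewrite (bopB _ _ bfz).
    have := ler_nrm_sub (f (T - z) w) (f (T - z) w').
    move: ww'; rewrite ltr_pdivlMr //.
    have := nrm_ge0 (w - w'); have := opnorm_ge0 bfz.
    move: (nrm (w - w')) (opnorm (f (T - z))) (opnorm (T - x0)) nz c1 => a b c *.
    have : b * a <= c * a by apply: ler_wpM2r.
    nra.
  rewrite -oppr_le0; apply/ler_addgt0Pr => d d0; rewrite add0r.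
  have n1 : 0 < nrm w + 1 by have := nrm_ge0 w; lra.
  have [|x Xx hx] := Pw (d / (nrm w + 1)); first by rewrite divr_gt0.
  have refl : ople x x by move=> v; rewrite subrr in0l.
  have := hx x Xx refl; rewrite ltr_pdivlMr // => h.
  have sx := Xs _ Xx; have [bx _] := sx.
  have /(ople_pos (sf _ sx) sT') [_ _ /(_ w)] := ub _ (ex_intro2 _ _ x Xx erefl).
  have := rin_CS (f (T - x) w) w; rewrite (amplB af bT bx) in h *.
  rewrite !fctE in h *; rewrite !rinDl !rinNl; have := nrm_ge0 w.
  have := nrm_ge0 (f T w - f x w); nra.
Qed.

End Normality.

(** * Compact operators and Hilbert modules *)
Section CompactOperators.
Variables (R : realType).
Local Notation C := R[i].
Implicit Types H K L : hilbert R.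

Definition rank1 H K (h : K) (h' : H) : H -> K := fun x => inner x h' *: h.

Definition rank1s H K : set (H -> K) := [set T | exists h h', T = rank1 h h'].

Lemma bop_rank1 H K (h : K) (h' : H) : bop (rank1 h h').
Proof.
apply: (bop_bound (c := nrm h' * nrm h)) => [a x y|x].
  by rewrite /rank1 inDl inZl scalerDl scalerA.
by rewrite /rank1 nrmZ mulrAC ler_wpM2r ?nrm_ge0 // mulrC in_CS.
Qed.

Lemma rank1s_bop H K : @rank1s H K `<=` @bop R H K.
Proof. by move=> _ [h [h' ->]]; exact: bop_rank1. Qed.

Lemma adj_rank1 H K (h : K) (h' : H) : adj (rank1 h h') = rank1 h' h.
Proof.
apply: adj_uniq => [|x y]; first exact: bop_rank1.
by rewrite /rank1 inZl inZr -inC mulrC.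
Qed.

Lemma rank1_compr H K L (T : L -> H) (h : K) (h' : H) : bop T ->
  rank1 h h' \o T = rank1 h (adj T h').
Proof. by move=> bT; apply/funext => x; rewrite /rank1 /= adjE. Qed.

Lemma opnorm_le_ball H K (T : H -> K) (c : R) :
  (forall x, nrm x <= 1 -> nrm (T x) <= c) -> opnorm T <= c.
Proof.
move=> Tc; apply: ge_sup; first by exists (nrm (T 0)), 0 => //=; rewrite normr0.
by move=> _ [x /= x1 <-]; apply: Tc; rewrite -lecR nrmE.
Qed.

Lemma scale_continuous H (h : H) : continuous (fun a : R => a%:C *: h : H).
Proof.
move=> x B /nbhs_nrmP [e e0 eB]; have h1 : 0 < nrm h + 1 by have := nrm_ge0 h; lra.
apply/nbhs_ballP; exists (e / (nrm h + 1)); first by rewrite /= divr_gt0.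
move=> y; rewrite /ball /= => xy; apply: eB.
rewrite -scalerBl -rmorphB /= nrmZ nrmR.
move: xy; rewrite ltr_pdivlMr //; have := nrm_ge0 h; have := normr_ge0 (x - y).
nra.
Qed.

(** The unit ball goes into a disc of the complex line spanned by h, covered by the continuous image
    of a square in R^2 through real and imaginary parts of the coefficient. *)
Lemma compact_rank1 H K (h : K) (h' : H) : compact_op (rank1 h h').
Proof.
split; first exact: bop_rank1.
pose M := nrm h'.
pose f (p : R * R) : K := p.1%:C *: h + p.2%:C *: ('i *: h).
have fc : continuous f.
  have c1 (g : K) : continuous (fun p : R * R => p.1%:C *: g : K).
    move=> q; apply: (continuous_comp (f := fst) (g := fun a : R => a%:C *: g)).
      exact: cvg_fst.
    exact: scale_continuous.
  have c2 (g : K) : continuous (fun p : R * R => p.2%:C *: g : K).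
    move=> q; apply: (continuous_comp (f := snd) (g := fun a : R => a%:C *: g)).
      exact: cvg_snd.
    exact: scale_continuous.
  by move=> p; apply: cvgD; [exact: c1|exact: c2].
have cS : compact (f @` (`[- M, M]%classic `*` `[- M, M]%classic)).
  apply: continuous_compact; first exact: continuous_subspaceT.
  by apply: compact_setX; exact: segment_compact.
apply: (@precompact_subset _ _ (f @` (`[- M, M]%classic `*` `[- M, M]%classic))).
  move=> _ [x /= x1 <-]; rewrite /rank1.
  have : nrm (inner x h') <= M.
    apply: le_trans (in_CS _ _) _; rewrite -/M.
    have : nrm x <= 1 by rewrite -lecR nrmE.
    have := nrm_ge0 x; have M0 : 0 <= M := nrm_ge0 h'; nra.
  case: (inner x h') => a b ab.
  have [ha hb] : `|a| <= M /\ `|b| <= M.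
    split; apply: le_trans ab; rewrite /nrm /= -sqrtr_sqr ler_wsqrtr //.
      by rewrite lerDl sqr_ge0.
    by rewrite lerDr sqr_ge0.
  exists (a, b); first by rewrite /= !in_itv /= -!ler_norml ha hb.
  rewrite /f /= scalerA -scalerDl; congr (_ *: _).
  by rewrite /real_complex_def; simpc.
apply: compact_precompact => //; exact: norm_hausdorff.
Qed.

(** Gram-Schmidt: each new vector y contributes the normalised rank one projection onto its
    component z = y - Py. *)
Lemma finite_projection H (l : seq H) : exists P : H -> H,
  [/\ bop P, lspan (@rank1s H H) P, adj P = P, P \o P = P &
     forall y, y \in l -> P y = y].
Proof.
elim: l => [|y l [P [bP lP sP PP Pl]]].
  exists 0; split=> //; [exact: bop_cst0|exact: lspan0|exact: adj0].
pose z := y - P y; have [z0|z0] := eqVneq z 0.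
  exists P; split=> // w; rewrite inE => /orP[/eqP ->|]; last exact: Pl.
  by apply/eqP; rewrite eq_sym -subr_eq0 -/z z0.
have Pz : P z = 0.
  rewrite /z (bopB _ _ bP) -[P (P y)]/((P \o P) y) PP subrr //.
have br := bop_rank1 z z.
pose c := ((nrm z ^+ 2)^-1)%:C.
have nz : nrm z ^+ 2 != 0 by rewrite sqrf_eq0 gt_eqF // nrm_gt0.
have cz : c * inner z z = 1 by rewrite in_nrm /c -rmorphM /= mulVf.
have Pzx x : inner (P x) z = 0 by rewrite (adjE _ _ bP) sP Pz in0r.
exists (c *: rank1 z z + P); split.
- by apply: bop_lc.
- by apply: lspan_lc => //; apply: lspan_self; exists z, z.
- by rewrite adj_lc // adj_rank1 sP conj_Creal // complex_real.
- apply/funext => x; rewrite /= !fctE /rank1 inDl inZl (bopD _ _ bP) !(bopZ _ _ bP).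
  rewrite inZl Pz !scaler0 add0r Pzx addr0 -[P (P x)]/((P \o P) x) PP.
  by rewrite (mulrC (inner x z)) mulrA cz mul1r.
- move=> w; rewrite inE !fctE /rank1 => /orP[/eqP ->|wl].
    have -> : inner y z = inner z z by rewrite {2}/z inBl Pzx subr0.
    by rewrite scalerA cz scale1r /z subrK.
  by rewrite -{1}(Pl _ wl) Pzx scale0r scaler0 add0r Pl.
Qed.

(** The image of the unit ball has a finite e/4-net. The finite rank projection P fixing the net is
    a contraction, so it moves no point of the image by more than e/2. *)
Lemma compact_op_rank1 H K : @compact_op R H K `<=` cspan (@rank1s H K).
Proof.
move=> k [bk pk]; split=> // e e0.
rewrite precompactE compact_cover in pk.
pose A := k @` [set x : H | `|x| <= 1].
have e4 : 0 < e / 4 by rewrite divr_gt0.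
have opb (y : K) : A y -> open [set z | nrm (y - z) < e / 4].
  move=> _; rewrite openE => z /= yz; apply/nbhs_nrmP.
  exists (e / 4 - nrm (y - z)); first by rewrite subr_gt0.
  move=> w zw /=; have := ler_nrm_trans z y w; lra.
have cov : closure A `<=` cover A (fun y => [set z | nrm (y - z) < e / 4]).
  by move=> v /closure_nrmP /(_ _ e4) [y Ay vy]; exists y => //=; rewrite nrmB.
have [l _ hl] := pk _ _ _ opb cov.
have [P [bP lP sP PP Pl]] := finite_projection (finmap.enum_fset l).
exists (P \o k).
  have : lspan (@rank1s K K) `<=` [set Q | bop Q /\ lspan (@rank1s H K) (Q \o k)].
    apply: lspan_min.
    - by split; [exact: bop_cst0|exact: lspan0].
    - move=> a S T [bS lS] [bT lT]; split; first exact: bop_lc.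
      have -> : (a *: S + T) \o k = a *: (S \o k) + (T \o k) by [].
      exact: lspan_lc.
    - move=> _ [h [h' ->]]; split; first exact: bop_rank1.
      by rewrite rank1_compr //; apply: lspan_self; exists h, (adj k h').
  by move=> /(_ _ lP) [].
apply: le_lt_trans (_ : e / 2 < e); last by lra.
apply: opnorm_le_ball => x x1.
have Akx : A (k x) by exists x => //=; rewrite -nrmE (lecR _ 1).
have [y yl ky] := hl _ (subset_closure Akx).
have Py : P y = y by exact: Pl.
have -> : (k - (P \o k)) x = (k x - y) - P (k x - y).
  by rewrite !fctE (bopB _ _ bP) Py /=; hring.
apply: le_trans (ler_nrmB _ _) _.
have Ple v : nrm (P v) <= nrm v.
  have : nrm (P v) ^+ 2 = rin (P v) v.
    by rewrite nrm_adjM // sP PP.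
  have [->|p0] := eqVneq (P v) 0; first by rewrite nrm0 nrm_ge0.
  have := rin_CS (P v) v; have := nrm_gt0 p0; nra.
have := Ple (k x - y); move: ky => /=; rewrite (nrmB y); lra.
Qed.

End CompactOperators.

(** * The Hilbert module and the multipliers of K(H) (x) B *)

Section CompactTensor.
Variable R : realType.
Variable tp : forall H K : hilbert R, htensor H K.
Local Notation ot := (@optens R tp _ _ _ _).
Variables (H K : hilbert R) (B : set (K -> K)).
Hypotheses (nB : nalg B) (sB : forall b, B b -> B (adj b)).

Let bB : B `<=` @bop R K K. Proof. by case: nB => [[]]. Qed.

Let E : set (tp H K -> tp H K) :=
  [set X | exists h h' b, B b /\ X = ot (rank1 h h') b].

Let Eb : E `<=` @bop R (tp H K) (tp H K).
Proof.
by move=> _ [h [h' [b [Bb ->]]]]; apply: bop_optens; [exact: bop_rank1|exact: bB].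
Qed.

Let nE : nsub (cspan E). Proof. exact: nsub_cspan. Qed.

Lemma blin_optensl (b : K -> K) : bop b ->
  blin (@bop R H H) (fun a => ot a b : tp H K -> tp H K).
Proof.
move=> bb; have bi := bop_id H; split.
- by move=> a ba; exact: bop_optens.
- by move=> c a a' ba ba'; exact: optens_lcl.
- exists (opnorm b) => [|a ba]; first exact: opnorm_ge0.
  rewrite optens_split //.
  have b1 := bop_optens tp (bop_id H) bb; have b2 := bop_optens tp ba (bop_id K).
  apply: le_trans (opnormM b1 b2) _; apply: ler_pM; try exact: opnorm_ge0.
    exact: opnorm_optensl.
  exact: opnorm_optensr.
Qed.

Lemma ctens_compactE : ctens (tp := tp) (@compact_op R H H) B = cspan E.
Proof.
apply/seteqP; split; last first.
  apply: cspan_mono => _ [h [h' [b [Bb ->]]]].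
  by exists (rank1 h h'), b; split=> //; exact: compact_rank1.
apply: cspan_min => // _ [k [b [ck Bb ->]]]; have bb := bB Bb.
apply: (blin_cspan_sub (nsub_bop H H) (@rank1s_bop R H H) (blin_optensl bb) nE).
  move=> _ [h [h' ->]]; apply: cspan_self => //; by exists h, h', b.
exact: compact_op_rank1.
Qed.

(** With t_h denoting k -> h (x) k, a generator of K(H) (x) B is t_h b t_h'^* while the Hilbert
    module is spanned by the t_h b; this is the link between the two. *)
Lemma optens_rank1 h h' (b : K -> K) : bop b ->
  ot (rank1 h h') b = (tens (tp H K) h \o b) \o adj (tens (tp H K) h').
Proof.
move=> bb; have bt := bop_tensr (tp H K) h; have bt' := bop_adj (bop_tensr (tp H K) h').
symmetry; apply: optens_uniq => //; first exact: bop_rank1.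
  by apply: bop_comp => //; exact: bop_comp.
move=> u v; rewrite /= adj_tensr (bopZ _ _ bb) tensZr /rank1 tensZl.
by [].
Qed.

Lemma hmodule_gen : [set v | exists (h : H) b, B b /\ v = (fun k => tens (tp H K) h (b k))]
  `<=` @bop R K (tp H K).
Proof.
by move=> _ [h [b [Bb ->]]]; apply: (bop_comp (bop_tensr _ h)); exact: bB.
Qed.

Lemma nsub_hmodule : nsub (hmodule (tp := tp) (H := H) B).
Proof. exact: nsub_cspan hmodule_gen. Qed.

(** With t_h denoting k -> h (x) k, the product of X with t_h b t_h'^* only asks X t_h to be in the
    module. Multiplication by X on the right is the adjoint of multiplication by X^* on the left. *)
Lemma mult_compact (X : tp H K -> tp H K) : bop X ->
  (forall h, hmodule (tp := tp) B (X \o tens (tp H K) h)) ->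
  (forall h, hmodule (tp := tp) B (adj X \o tens (tp H K) h)) ->
  mult (ctens (tp := tp) (@compact_op R H H) B) X.
Proof.
move=> bX hX hX'; rewrite ctens_compactE; have [_ _ BM] := nB.
have EcB : cspan E `<=` @bop R (tp H K) (tp H K) by case: nE.
have left Y : bop Y -> (forall h, hmodule (tp := tp) B (Y \o tens (tp H K) h)) ->
    forall a, cspan E a -> cspan E (Y \o a).
  move=> bY hY; apply: (blin_cspan_sub (nsub_bop _ _) Eb (blin_postc (fun=> id) bY) nE).
  move=> _ [h [h' [b [Bb ->]]]]; have bb := bB Bb.
  rewrite optens_rank1 // compA compA.
  have bt' := bop_adj (bop_tensr (tp H K) h').
  pose f (v : K -> tp H K) := (v \o b) \o adj (tens (tp H K) h').
  apply: (blin_cspan_sub (f := f) (nsub_bop _ _) hmodule_gen _ nE) (hY h).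
    apply: (blin_comp (blin_prec (fun=> id) bb) _ (blin_prec (fun=> id) bt')).
    by move=> v bv; exact: bop_comp.
  move=> _ [g [c [Bc ->]]]; apply: cspan_self => //.
  exists g, h', (c \o b); split; first exact: BM.
  by rewrite optens_rank1 //; apply: bop_comp => //; exact: bB.
have adjE' a : cspan E a -> cspan E (adj a).
  move=> ca; have : cspan E `<=` [set T | bop T /\ cspan E (adj T)]; last first.
    by move=> /(_ _ ca) [].
  apply: cspan_min; last first.
    move=> T ET; split; first exact: Eb.
    move: ET => [h [h' [b [Bb ->]]]]; apply: cspan_self => //.
    exists h', h, (adj b); split; first exact: sB.
    by rewrite adj_optens ?adj_rank1 //; [exact: bop_rank1|exact: bB].
  have [Nb N0 Nl Nc] := nE; split.
  - by move=> T [].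
  - by split; [exact: bop_cst0|rewrite adj0].
  - move=> c S T [bS cS] [bT cT]; split; first exact: bop_lc.
    by rewrite adj_lc //; exact: Nl.
  - move=> T [bT hT]; split=> //; apply: Nc; split; first exact: bop_adj.
    move=> e e0; have [s [bs cs] Ts] := hT e e0; exists (adj s) => //.
    by rewrite -adjB // opnorm_adj //; exact: bop_sub.
split=> // a ca; have ba := EcB _ ca; split; first exact: left.
have := adjE' _ (left _ (bop_adj bX) hX' _ (adjE' _ ca)).
by rewrite (adj_comp (bop_adj bX) (bop_adj ba)) !adjK.
Qed.

End CompactTensor.

Section SpanAlgebra.
Variable R : realType.
Implicit Types H K : hilbert R.

Lemma cspan_mul H (S : set (H -> H)) : S `<=` @bop R H H ->
  (forall s t, S s -> S t -> S (s \o t)) ->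
  forall x y, cspan S x -> cspan S y -> cspan S (x \o y).
Proof.
move=> Sb SM x y cx cy; have nS := nsub_cspan Sb.
have [bS _ _ _] := nS.
apply: (blin_cspan_sub (nsub_bop H H) Sb (blin_postc (fun=> id) (bS _ cx)) nS) cy.
move=> t St; move: x cx; apply: (blin_cspan_sub (f := fun x => x \o t)
  (nsub_bop H H) Sb (blin_prec (fun=> id) (Sb _ St)) nS).
by move=> s Ss; apply: cspan_self => //; exact: SM.
Qed.

Lemma nsub_adj H K (P : set (H -> K)) : nsub P ->
  nsub [set T : K -> H | bop T /\ P (adj T)].
Proof.
move=> [Nb N0 Nl Nc]; split.
- by move=> T [].
- by split; [exact: bop_cst0|rewrite adj0].
- move=> c S T [bS cS] [bT cT]; split; first exact: bop_lc.
  by rewrite adj_lc //; exact: Nl.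
- move=> T [bT hT]; split=> //; apply: Nc; split; first exact: bop_adj.
  move=> e e0; have [s [bs cs] Ts] := hT e e0; exists (adj s) => //.
  by rewrite -adjB // opnorm_adj //; exact: bop_sub.
Qed.

Lemma cspan_adj H (S : set (H -> H)) : S `<=` @bop R H H ->
  (forall s, S s -> S (adj s)) -> forall x, cspan S x -> cspan S (adj x).
Proof.
move=> Sb Sa x cx; have : cspan S `<=` [set T | bop T /\ cspan S (adj T)].
  apply: cspan_min; first exact/nsub_adj/nsub_cspan.
  move=> s Ss; split; first exact: Sb.
  by apply: cspan_self => //; exact: Sa.
by move=> /(_ _ cx) [].
Qed.

Lemma mult_unital H (A : set (H -> H)) : nalg A -> mult A = A.
Proof.
move=> [nA A1 AM]; have [Ab _ _ _] := nA; apply/seteqP; split=> x.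
  by move=> [_ /(_ _ A1) []].
move=> Ax; split; first exact: Ab.
by move=> a Aa; split; exact: AM.
Qed.

Lemma proj_comm H (L : set H) (S : H -> H) : subspace L -> bop S ->
  (forall x, L x -> L (S x)) -> (forall x, L x -> L (adj S x)) ->
  forall x, proj L (S x) = S (proj L x).
Proof.
move=> sL bS h h' x; apply: (proj_uniq sL).
  have /closure_nrmP cy := proj_cl sL x; apply/closure_nrmP => d d0.
  have c1 : 0 < opnorm S + 1 by have := opnorm_ge0 bS; lra.
  have [|z Lz yz] := cy (d / (opnorm S + 1)); first by rewrite divr_gt0.
  exists (S z); first exact: h.
  rewrite -(bopB _ _ bS); apply: le_lt_trans (ler_opnorm _ bS) _.
  move: yz; rewrite ltr_pdivlMr //; have := opnorm_ge0 bS.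
  have := nrm_ge0 (proj L x - z); nra.
move=> s Ls; rewrite -(bopB _ _ bS) (adjE _ _ bS).
by apply: (proj_orth sL); exact: h'.
Qed.

End SpanAlgebra.

(** * C*-tensor products acting on the Hilbert module *)

Section TensorAlgebra.
Variable R : realType.
Variable tp : forall H K : hilbert R, htensor H K.
Local Notation ot := (@optens R tp _ _ _ _).
Local Notation ct := (@ctens R tp _ _).
Variables (H K : hilbert R) (A : set (H -> H)) (B : set (K -> K)).
Local Notation hmod := (@hmodule R tp H K).
Hypotheses (cA : cstar_algebra A) (A1 : A id) (cB : cstar_algebra B) (B1 : B id).

Let bA : A `<=` @bop R H H. Proof. by case: cA => [[]]. Qed.
Let bB : B `<=` @bop R K K. Proof. by case: cB => [[]]. Qed.

Lemma elem_tens_bop : @elem_tens R tp _ _ A B `<=` @bop R (tp H K) (tp H K).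
Proof. by move=> _ [a [b [Aa Bb ->]]]; apply: bop_optens; [exact: bA|exact: bB]. Qed.

Lemma nsub_ctens : nsub (ct A B).
Proof. exact: nsub_cspan elem_tens_bop. Qed.

Lemma ctens_gen a b : A a -> B b -> ct A B (ot a b).
Proof. by move=> Aa Bb; apply: (cspan_self elem_tens_bop); exists a, b. Qed.

Lemma ctens1 : ct A B id.
Proof. by rewrite -(optens_id tp); exact: ctens_gen. Qed.

Lemma ctens_mul x y : ct A B x -> ct A B y -> ct A B (x \o y).
Proof.
apply: (cspan_mul elem_tens_bop) => _ _ [a [b [Aa Bb ->]]] [a' [b' [Aa' Bb' ->]]].
have [[_ _ _ AM _] _] := cA; have [[_ _ _ BM _] _] := cB.
exists (a \o a'), (b \o b'); split; [exact: AM|exact: BM|].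
by rewrite optens_comp //; [exact: bA|exact: bA|exact: bB|exact: bB].
Qed.

Lemma ctens_adj x : ct A B x -> ct A B (adj x).
Proof.
apply: (cspan_adj elem_tens_bop) => _ [a [b [Aa Bb ->]]].
have [[_ _ _ _ As] _] := cA; have [[_ _ _ _ Bs] _] := cB.
exists (adj a), (adj b); split; [exact: As|exact: Bs|].
by rewrite adj_optens //; [exact: bA|exact: bB].
Qed.

Lemma ctens_cstar : cstar_algebra (ct A B).
Proof.
have [b0 z0 l0 c0] := nsub_ctens; split=> //; split=> //; [exact: ctens_mul|exact: ctens_adj].
Qed.

Lemma ctens_nalg : nalg (ct A B).
Proof. by split; [exact: nsub_ctens|exact: ctens1|exact: ctens_mul]. Qed.

Lemma mult_ctens : mult (ct A B) = ct A B.
Proof. exact: mult_unital ctens_nalg. Qed.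

Lemma ctens_tensr h x : ct A B x -> hmod B (x \o tens (tp H K) h).
Proof.
have bt := bop_tensr (tp H K) h.
have nB : nalg B by exact: cstar_nalg.
apply: (blin_cspan_sub (f := fun x => x \o tens (tp H K) h) (nsub_bop _ _) elem_tens_bop
  (blin_prec (fun=> id) bt) (nsub_hmodule tp H nB)).
move=> _ [a [b [Aa Bb ->]]]; apply: cspan_self; first exact: hmodule_gen nB.
exists (a h), b; split=> //; apply/funext => k /=.
by rewrite optensE //; [exact: bA|exact: bB].
Qed.

Lemma hmodule_sub (H' K' : hilbert R) (P : set (H' -> K')) (f : (K -> tp H K) -> (H' -> K')) :
  nsub P -> blin (@bop R K (tp H K)) f ->
  (forall h b, B b -> P (f (fun k => tens (tp H K) h (b k)))) ->
  forall v, hmod B v -> P (f v).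
Proof.
move=> nP bf hP v hv; have nB : nalg B by exact: cstar_nalg.
have gb := @hmodule_gen R tp H K B nB.
apply: (blin_cspan_sub (nsub_bop _ _) gb bf nP _ hv).
by move=> _ [h [b [Bb ->]]]; exact: hP.
Qed.

Lemma hmodule_mulr v b : hmod B v -> B b ->
  hmod B (v \o b).
Proof.
move=> hv Bb; have nB : nalg B by exact: cstar_nalg.
have [_ _ BM] := nB.
move: v hv; apply: (hmodule_sub (f := fun v => v \o b) (nsub_hmodule tp H nB)
  (blin_prec (fun=> id) (bB Bb))).
move=> h c Bc; apply: cspan_self; first exact: hmodule_gen nB.
by exists h, (c \o b); split=> //; exact: BM.
Qed.

Lemma hmodule_mull v a : hmod B v -> bop a ->
  hmod B (ot a id \o v).
Proof.
move=> hv ba; have nB : nalg B by exact: cstar_nalg.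
have bi := bop_id K.
move: v hv; apply: (hmodule_sub (nsub_hmodule tp H nB)
  (blin_postc (fun=> id) (bop_optens tp ba bi))).
move=> h c Bc; apply: cspan_self; first exact: hmodule_gen nB.
by exists (a h), c; split=> //; apply/funext => k /=; rewrite optensE.
Qed.

(** This is the B-valued inner product of the module with h (x) 1. *)
Lemma hmodule_slice v h : hmod B v ->
  B (adj (tens (tp H K) h) \o v).
Proof.
have nB : nalg B by exact: cstar_nalg.
have bt := bop_adj (bop_tensr (tp H K) h).
have [nsB _ _] := nB.
move: v; apply: (hmodule_sub nsB (blin_postc (fun=> id) bt)) => g c Bc.
have -> : adj (tens (tp H K) h) \o (fun k => tens (tp H K) g (c k)) = inner g h *: c.
  by apply/funext => k /=; rewrite adj_tensr.
exact: nsubZ.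
Qed.

End TensorAlgebra.

(** * Implemented actions *)
Section Implemented.
Variable R : realType.
Variable tp : forall H K : hilbert R, htensor H K.
Local Notation ot := (@optens R tp _ _ _ _).
Local Notation ct := (@ctens R tp _ _).
Variables (H K : hilbert R) (A : set (H -> H)) (L1 : H).
Local Notation hmod := (@hmodule R tp H K).
Hypotheses (cA : cstar_algebra A) (A1 : A id).
Hypothesis L1_unit : inner L1 L1 = 1.
Local Notation th h := (tens (tp H K) h).

(* B0 acts on K with vector xi, and f = Delta restricts to an action on B0 whose
   L1-slice is the vector state of xi; Vz is an intertwiner between the identity
   representation and f. *)
Variables (B0 : set (K -> K)) (xi : K) (f : (K -> K) -> (tp H K -> tp H K)).
Variable Vz : K -> tp H K.
Hypotheses (cB0 : cstar_algebra B0) (B01 : B0 id).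
Hypotheses (af : ampl f) (fB0 : forall b, B0 b -> ct A B0 (f b)).
Hypothesis f_slice : forall b, B0 b ->
  adj (th L1) \o f b \o th L1 = inner (b xi) xi *: id.
Hypothesis xi_cyclic : closure [set b xi | b in B0] = setT.
Hypotheses (iVz : isometry Vz) (fVz : forall x, bop x -> f x \o Vz = Vz \o x).
Local Notation N := (sclosure B0).

Let sB0 : star_algebra B0. Proof. by case: cB0. Qed.
Let bB0 : B0 `<=` @bop R K K. Proof. by case: sB0. Qed.
Let bA : A `<=` @bop R H H. Proof. by case: cA => [[]]. Qed.
Let bN : N `<=` @bop R K K. Proof. by move=> x []. Qed.
Let bth (h : H) : bop (th h). Proof. exact: bop_tensr. Qed.

(** The slice formula at b^* c, with b and c in [B0], says that the vectors f(b)(L1 (x) eta) have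
    the inner products of the vectors b xi (x) eta. *)
Lemma impl_isometry : exists V : tp K K -> tp H K, isometry V /\
  forall b eta, B0 b -> V (tens (tp K K) (b xi) eta) = f b (th L1 eta).
Proof.
pose I := ({b | B0 b} * K)%type.
pose e (p : I) := tens (tp K K) (sval p.1 xi) p.2.
pose g (p : I) := f (sval p.1) (th L1 p.2).
have te : closure (lspan (range e)) = setT.
  have h := tens_total2 (tp K K) (S := [set b xi | b in B0]) (T := setT).
  rewrite -[RHS]h.
  - congr (closure (lspan _)); apply/seteqP; split=> v.
      move=> [[[b Bb] k] _ <-]; exists (b xi), k; split=> //; by exists b.
    by move=> [_ [k [[b Bb <-] _ ->]]]; exists (exist _ b Bb, k).
  - rewrite -subTset -xi_cyclic; apply: closureS; exact: lspan_self.
  - rewrite -subTset => v _; apply: subset_closure; exact: lspan_self.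
have [|V [iV Ve]] := isometry_extend te (f := g).
  move=> [[b Bb] k] [[c Bc] l]; rewrite /e /g /= tens_inner.
  have [_ _ _ BM Bs] := sB0; have bc := bB0 Bc; have bb := bB0 Bb.
  have bc' := bop_adj bc.
  rewrite (adjE _ _ (ampl_bop af bb)) -(ampl_adj af bb).
  rewrite -[f (adj b) _]/((f (adj b) \o f c) (th L1 l)) -(ampl_mul af (bop_adj bb) bc).
  have Bbc := BM _ _ (Bs _ Bb) Bc.
  rewrite (inC (f (adj b \o c) _)) -(adjEr _ _ (bth L1)).
  have := congr1 (fun X => X l) (f_slice Bbc); rewrite /= => ->.
  have -> : (inner (adj b (c xi)) xi *: id) l = inner (adj b (c xi)) xi *: l by [].
  by rewrite inZl rmorphM /= -!inC -(adjE _ _ bb).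
by exists V; split=> // b eta Bb; exact: (Ve (exist _ b Bb, eta)).
Qed.

Definition implV : tp K K -> tp H K := projT1 (cid impl_isometry).

Lemma implV_iso : isometry implV.
Proof. by rewrite /implV; case: cid => V []. Qed.

Lemma implVE b eta : B0 b -> implV (tens (tp K K) (b xi) eta) = f b (th L1 eta).
Proof. by move=> Bb; rewrite /implV; case: cid => V /= [_ h]; exact: h. Qed.

(** Since f(x) Vz = Vz x with Vz isometric, approximating f(x) at the two vectors w and Vz xi also
    approximates x at xi, with the same b. *)
Lemma impl_approx x (w : tp H K) (e : R) : N x -> 0 < e ->
  exists2 b, B0 b & nrm (x xi - b xi) < e /\ nrm (f x w - f b w) < e.
Proof.
move=> Nx e0; have bx := bN Nx.
have /sclosureP [_ /(_ 2%N (fun i => if i == ord0 then w else Vz xi) e e0)]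
  := ampl_sclosure sB0 B01 af Nx.
move=> [_ [b Bb <-] h]; exists b => //; have bb := bB0 Bb.
have := h ord0; have := h ord_max => /=.
have -> : f x (Vz xi) = Vz (x xi) by rewrite -[LHS]/((f x \o Vz) xi) fVz.
have -> : f b (Vz xi) = Vz (b xi) by rewrite -[LHS]/((f b \o Vz) xi) fVz.
have [bVz _] := iVz.
by rewrite -(bopB _ _ bVz) (isometry_nrm _ iVz).
Qed.

Lemma implV_N x eta : N x -> f x (th L1 eta) = implV (tens (tp K K) (x xi) eta).
Proof.
move=> Nx; have [bV _] := implV_iso.
apply/eqP; rewrite -subr_eq0; apply/eqP/nrm_le0 => e e0.
have n1 : 0 < nrm eta + 1 by have := nrm_ge0 eta; lra.
have [|b Bb [h1 h2]] := @impl_approx x (th L1 eta) (e / (nrm eta + 1)) Nx.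
  by rewrite divr_gt0.
have -> : f x (th L1 eta) - implV (tens (tp K K) (x xi) eta) =
    (f x (th L1 eta) - f b (th L1 eta)) - implV (tens (tp K K) (x xi - b xi) eta).
  by rewrite tensBl (bopB _ _ bV) (implVE eta Bb); hring.
apply: le_trans (ler_nrmB _ _) _.
rewrite (isometry_nrm _ implV_iso) nrm_tens.
have dt : e / (nrm eta + 1) * (nrm eta + 1) = e by rewrite divfK // gt_eqF.
move: (e / (nrm eta + 1)) dt h1 h2 => t dt h1 h2.
have := nrm_ge0 eta; have := nrm_ge0 (x xi - b xi); nra.
Qed.

Lemma impl_slice_N x : N x -> adj (th L1) \o f x \o th L1 = inner (x xi) xi *: id.
Proof.
move=> Nx; apply/funext => eta; apply/eqP; rewrite -subr_eq0; apply/eqP/nrm_le0 => e e0.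
have n1 : 0 < nrm xi * nrm eta + 1 by have := mulr_ge0 (nrm_ge0 xi) (nrm_ge0 eta); lra.
have [|b Bb [h1 h2]] := @impl_approx x (th L1 eta) (e / (nrm xi * nrm eta + 1)) Nx.
  by rewrite divr_gt0.
have bt := bop_adj (bth L1).
have eb := congr1 (fun X => X eta) (f_slice Bb); rewrite /= !fctE in eb.
have -> : (adj (th L1) \o f x \o th L1) eta - (inner (x xi) xi *: id) eta =
   adj (th L1) (f x (th L1 eta) - f b (th L1 eta)) - inner (x xi - b xi) xi *: eta.
  by rewrite (bopB _ _ bt) eb inBl scalerBl !fctE /=; hring.
apply: le_trans (ler_nrmB _ _) _; rewrite nrmZ.
have o1 : opnorm (adj (th L1)) <= 1.
  rewrite opnorm_adj //; apply: isometry_opnorm; exact: isometry_tensr.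
have := ler_opnorm (f x (th L1 eta) - f b (th L1 eta)) bt.
have := in_CS (x xi - b xi) xi.
have dt : e / (nrm xi * nrm eta + 1) * (nrm xi * nrm eta + 1) = e.
  by rewrite divfK // gt_eqF.
move: (e / (nrm xi * nrm eta + 1)) dt h1 h2 => t dt h1 h2 h3 h4.
have h5 : nrm (inner (x xi - b xi) xi) * nrm eta <= t * nrm xi * nrm eta.
  apply: ler_wpM2r; first exact: nrm_ge0.
  apply: le_trans h3 _; apply: ler_wpM2r; [exact: nrm_ge0|exact: ltW].
have := nrm_ge0 (f x (th L1 eta) - f b (th L1 eta)).
have : opnorm (adj (th L1)) * nrm (f x (th L1 eta) - f b (th L1 eta)) <=
   1 * nrm (f x (th L1 eta) - f b (th L1 eta)).
  by apply: ler_wpM2r => //; exact: nrm_ge0.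
nra.
Qed.

(** f(x) is in the strong closure of f(B0), and f(B0) lies in A (x) B0, which commutes with a' (x)
    1. *)
Lemma impl_comm x a' : N x -> commutant A a' -> f x \o ot a' id = ot a' id \o f x.
Proof.
move=> Nx [ba' ca']; have bi := bop_id K; have bo := bop_optens tp ba' bi.
have := ampl_sclosure sB0 B01 af Nx.
move=> h; symmetry; apply: (sclosure_commute h); split=> // _ [b Bb <-].
have bE := elem_tens_bop (tp := tp) cA cB0.
have := fB0 Bb; apply: (blin_cspan_eq (nsub_bop _ _) bE
  (blin_postc (fun=> id) bo) (blin_prec (fun=> id) bo)).
move=> _ [a [c [Aa Bc ->]]]; have ba := bA Aa; have bc := bB0 Bc.
by rewrite !optens_comp // ca'.
Qed.

Section Subalgebra.
(** The coefficient algebra is kept distinct from [B0]: in the uniqueness proof it is an arbitrary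
    C*-version of the action on N. *)
Variable B : set (K -> K).
Hypotheses (cB : cstar_algebra B) (B1 : B id) (BN : B `<=` N).
Hypotheses (fB : forall b, B b -> ct A B (f b)).
Hypothesis B_cyclic : closure [set b xi | b in B] = setT.

Let nB : nalg B. Proof. exact: cstar_nalg. Qed.
Let nH : nsub (hmod B). Proof. exact: (nsub_hmodule tp H nB). Qed.

(** For z = b xi with b in B this is f(b)(L1 (x) .), with f(b) in A (x) B. Such z are dense, and
    since V is isometric the error in operator norm is at most |z - b xi|. *)
Lemma implV_hmodule z : hmod B (implV \o tens (tp K K) z).
Proof.
have [bV _] := implV_iso; have [_ _ _ Hc] := nH.
apply: Hc; split; first by apply: bop_comp => //; exact: bop_tensr.
move=> e e0; have /closureT_nrmP /(_ z e e0) [_ [b Bb <-] zb] := B_cyclic.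
exists (f b \o th L1); first exact: (ctens_tensr cA cB B1 L1 (fB Bb)).
have -> : f b \o th L1 = implV \o tens (tp K K) (b xi).
  by apply/funext => eta /=; rewrite implV_N //; exact: BN.
have bd : bop (tens (tp K K) (z - b xi)) by exact: bop_tensr.
have -> : implV \o tens (tp K K) z - (implV \o tens (tp K K) (b xi)) =
    implV \o tens (tp K K) (z - b xi).
  by apply/funext => eta; rewrite !fctE /= tensBl (bopB _ _ bV).
apply: le_lt_trans zb; apply: opnorm_le => [|eta]; first exact: nrm_ge0.
by rewrite /= (isometry_nrm _ implV_iso) nrm_tens.
Qed.

Lemma impl_hmodule1 x : N x -> hmod B (f x \o th L1).
Proof.
move=> Nx; have -> : f x \o th L1 = implV \o tens (tp K K) (x xi).
  by apply/funext => eta /=; rewrite implV_N.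
exact: implV_hmodule.
Qed.

Lemma impl_tens_dense (P : set H) x : closure P = setT -> bop x ->
  (forall h, P h -> hmod B (f x \o th h)) -> forall h, hmod B (f x \o th h).
Proof.
move=> /closureT_nrmP dP bx hP h; have bfx := ampl_bop af bx.
have [_ _ _ Hc] := nH; apply: Hc; split; first exact: bop_comp.
move=> e e0; have c1 : 0 < opnorm (f x) + 1 by have := opnorm_ge0 bfx; lra.
have [|h' Ph' hh'] := dP h (e / (opnorm (f x) + 1)); first by rewrite divr_gt0.
exists (f x \o th h'); first exact: hP.
have -> : (f x \o th h) - (f x \o th h') = f x \o th (h - h').
  by apply/funext => eta; rewrite !fctE /= tensBl (bopB _ _ bfx).
apply: le_lt_trans (opnormM bfx (bth _)) _.
have : opnorm (th (h - h')) <= nrm (h - h').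
  by apply: opnorm_le => [|k]; [exact: nrm_ge0|rewrite nrm_tens].
move: hh'; rewrite ltr_pdivlMr //; have := opnorm_ge0 bfx; have := nrm_ge0 (h - h').
nra.
Qed.

Hypothesis L1_cyclic : closure [set a' L1 | a' in commutant A] = setT.

Lemma impl_hmodule x h : N x -> hmod B (f x \o th h).
Proof.
move=> Nx; move: h; apply: (impl_tens_dense L1_cyclic (bN Nx)).
move=> _ [a' ca' <-]; have [ba' _] := ca'.
have -> : f x \o th (a' L1) = ot a' id \o (f x \o th L1).
  have bi := bop_id K; rewrite compA -(impl_comm Nx ca'); apply/funext => eta /=.
  by rewrite optensE.
exact: (hmodule_mull cB B1 (impl_hmodule1 Nx) ba').
Qed.

(** f(x)(a' L1 (x) b k) = (a' (x) 1) V(x xi (x) b k), so x enters only through one vector; this is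
    the source of strictness. *)
Lemma impl_strict_bound x a' b : N x -> commutant A a' -> B b ->
  opnorm (f x \o (fun k => th (a' L1) (b k))) <= opnorm a' * opnorm b * nrm (x xi).
Proof.
move=> Nx ca' Bb; have [ba' _] := ca'; have bi := bop_id K.
have [Bbb _ _ _] : nsub B by case: nB.
have bb := Bbb _ Bb.
apply: opnorm_le => [|k]; first by rewrite !mulr_ge0 ?opnorm_ge0 ?nrm_ge0.
have -> : (f x \o (fun k => th (a' L1) (b k))) k = ot a' id (f x (th L1 (b k))).
  rewrite -[RHS]/((ot a' id \o f x) (th L1 (b k))) -(impl_comm Nx ca') /=.
  by rewrite optensE.
apply: le_trans (ler_opnorm _ (bop_optens tp ba' bi)) _.
rewrite implV_N // (isometry_nrm _ implV_iso) nrm_tens.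
have h1 := opnorm_optensr tp K ba'; have h2 := ler_opnorm k bb.
rewrite -!mulrA; apply: ler_pM => //; first exact: opnorm_ge0 (bop_optens tp ba' bi).
  by rewrite mulr_ge0 ?nrm_ge0.
have := nrm_ge0 (x xi); nra.
Qed.

End Subalgebra.
End Implemented.

(** * Slice maps along vector states *)

Section Slices.
Variable R : realType.
Variable tp : forall H K : hilbert R, htensor H K.
Local Notation C := R[i].
Local Notation ot := (@optens R tp _ _ _ _).
Local Notation ct := (@ctens R tp _ _).

Lemma nsub_eval (H K : hilbert R) (W : set K) (v : H) : subspace W ->
  nsub [set x : H -> K | bop x /\ closure W (x v)].
Proof.
move=> sW; have [c0 cl] := subspace_closure sW; split.
- by move=> x [].
- by split; [exact: bop_cst0|].
- move=> a S T [bS hS] [bT hT]; split; first exact: bop_lc.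
  exact: cl.
- move=> T [bT h]; split=> //; apply: closure_closure_nrm => e e0.
  have v1 : 0 < nrm v + 1 by have := nrm_ge0 v; lra.
  have [|s [bs cs] Ts] := h (e / (nrm v + 1)); first by rewrite divr_gt0.
  exists (s v) => //; have bd := bop_sub bT bs.
  have := ler_opnorm v bd; rewrite !fctE => /le_lt_trans; apply.
  move: Ts; rewrite ltr_pdivlMr //; have := nrm_ge0 v; have := opnorm_ge0 bd; nra.
Qed.

(* A vector h x is encoded as the rank one operator from a fixed unit vector u. *)
Lemma vec_cspan_eq (H K E : hilbert R) (S : set (H -> K)) (f g : (H -> K) -> E) :
  S `<=` @bop R H K ->
  (forall (c : C) x y, cspan S x -> cspan S y -> f (c *: x + y) = c *: f x + f y) ->
  (forall (c : C) x y, cspan S x -> cspan S y -> g (c *: x + y) = c *: g x + g y) ->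
  (exists c : R, forall x, cspan S x -> nrm (f x) <= c * opnorm x) ->
  (exists c : R, forall x, cspan S x -> nrm (g x) <= c * opnorm x) ->
  (forall s, S s -> f s = g s) -> (exists u : E, inner u u = 1) ->
  forall x, cspan S x -> f x = g x.
Proof.
move=> Sb fl gl [c fc] [d gd] fg [u u1] x cx.
have nS := nsub_cspan Sb; have [bS _ _ _] := nS.
have bl (h : (H -> K) -> E) (m : R) : (forall (c : C) x y, cspan S x -> cspan S y ->
    h (c *: x + y) = c *: h x + h y) -> (forall x, cspan S x -> nrm (h x) <= m * opnorm x) ->
    blin (cspan S) (fun x => rank1 (h x) u).
  move=> hl hm; split.
  - by move=> y _; exact: bop_rank1.
  - move=> a y z cy cz; apply/funext => v; rewrite hl // !fctE /rank1.
    by rewrite scalerDr !scalerA (mulrC a).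
  - exists `|m| => [|y cy]; first exact: normr_ge0.
    have oy := opnorm_ge0 (bS _ cy).
    apply: opnorm_le => [|v]; first by rewrite mulr_ge0.
    rewrite /rank1 nrmZ; have := in_CS v u.
    have -> : nrm u = 1.
      have := u1; rewrite in_nrm => /complexI /eqP.
      by rewrite sqrf_eq1 => /orP[/eqP //|/eqP h1]; have := nrm_ge0 u; rewrite h1; lra.
    have := hm y cy; have := ler_wpM2r oy (ler_norm m).
    have := nrm_ge0 v; have := nrm_ge0 (h y); have := nrm_ge0 (inner v u).
    move: (nrm (inner v u)) (nrm (h y)) (nrm v) => p q r p0 q0 r0 h1 h2 h3.
    have : p * q <= r * q by apply: ler_wpM2r => //; lra.
    have : q * r <= `|m| * opnorm y * r by apply: ler_wpM2r => //; lra.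
    lra.
have e1 : rank1 (f x) u = rank1 (g x) u.
  apply: (blin_cspan_eq (f := fun x => rank1 (f x) u) (g := fun x => rank1 (g x) u)
    nS (cspan_self Sb) (bl f c fl fc) (bl g d gl gd) _ cx) => s Ss.
  by rewrite (fg _ Ss).
by have := congr1 (fun X => X u) e1; rewrite /rank1 u1 !scale1r.
Qed.

Lemma blin_slice (H K : hilbert R) (h h' : H) (Dm : set (tp H K -> tp H K)) :
  Dm `<=` @bop R (tp H K) (tp H K) ->
  blin Dm (fun x => adj (tens (tp H K) h') \o x \o tens (tp H K) h).
Proof.
by move=> Db; apply: blin_conj => //; [exact: bop_tensr|exact/bop_adj/bop_tensr].
Qed.

Lemma blin_rslice (H K : hilbert R) (k k' : K) (Dm : set (tp H K -> tp H K)) :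
  Dm `<=` @bop R (tp H K) (tp H K) ->
  blin Dm (fun x => adj (tens (tp H K) ^~ k') \o x \o tens (tp H K) ^~ k).
Proof.
by move=> Db; apply: blin_conj => //; [exact: bop_tensl|exact/bop_adj/bop_tensl].
Qed.

Lemma adj_tensl (H K : hilbert R) k' h k :
  adj (tens (tp H K) ^~ k') (tens (tp H K) h k) = inner k k' *: h.
Proof.
apply: in_inj => z; rewrite adjEr; last exact: bop_tensl.
by rewrite tens_inner inZl mulrC.
Qed.

Lemma blin_bound (H K H' K' : hilbert R) (Dm : set (H -> K)) (f : (H -> K) -> (H' -> K')) :
  blin Dm f -> exists c : R, forall x, Dm x -> opnorm (f x) <= c * opnorm x.
Proof. by move=> [_ _ [c _ h]]; exists c. Qed.

Section State.
Variables (H K : hilbert R) (A : set (H -> H)) (D : set (K -> K)).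
Hypotheses (cA : cstar_algebra A) (A1 : A id) (cD : cstar_algebra D) (D1 : D id).
Variables (om : (H -> H) -> C) (v : H).
Hypothesis omE : forall a, A a -> om a = inner (a v) v.

(** Linearity, boundedness and the values on elementary tensors determine [lslice] on A (x) D, so
    the chosen map must be compression by the vector v that implements the functional. *)
Lemma lsliceE x : ct A D x ->
  lslice A D om x = adj (tens (tp H K) v) \o x \o tens (tp H K) v.
Proof.
have eb := elem_tens_bop (tp := tp) cA cD.
have [cb _ _ _] := nsub_ctens tp cA cD.
have [Ab _ _ _] : nsub A by case: (cstar_nalg cA A1).
have [Db _ _ _] : nsub D by case: (cstar_nalg cD D1).
have bE := blin_slice v v cb.
set E0 := fun x : tp H K -> tp H K => adj (tens (tp H K) v) \o x \o tens (tp H K) v in bE.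
have [bE1 lE1 _] := bE.
have gE a b : A a -> D b -> E0 (ot a b) = om a *: b.
  move=> Aa Db'; have ba := Ab _ Aa; have bb := Db _ Db'.
  apply/funext => k; rewrite /E0 /= optensE // adj_tensr omE //.
have /(xgetPex (fun=> fun=> 0)) : exists E, [/\ forall (c : C) x y, ct A D x -> ct A D y ->
                   E (c *: x + y) = c *: E x + E y,
                 forall x, ct A D x -> bop (E x),
                 exists c : R, forall x, ct A D x ->
                   opnorm (E x) <= c * opnorm x &
                 forall a b, A a -> D b -> E (ot a b) = om a *: b].
  by exists E0; split=> //; exact: blin_bound bE.
rewrite -/(lslice A D om) => -[hl hb [c hc] hg] cx.
have bL : blin (ct A D) (lslice A D om).
  split=> //; exists `|c| => [|y cy]; first exact: normr_ge0.
  apply: le_trans (hc y cy) _; apply: ler_wpM2r; last exact: ler_norm.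
  exact/opnorm_ge0/cb.
apply: (blin_cspan_eq (nsub_ctens tp cA cD) _ bL bE _ cx).
  exact: cspan_self.
by move=> _ [a [b [Aa Db' ->]]]; rewrite hg // gE.
Qed.

End State.

Section RState.
Variables (H K : hilbert R) (A : set (H -> H)) (D : set (K -> K)).
Hypotheses (cA : cstar_algebra A) (A1 : A id) (cD : cstar_algebra D) (D1 : D id).
Variables (om : (K -> K) -> C) (v : K).
Hypothesis omE : forall a, D a -> om a = inner (a v) v.

Lemma rsliceE x : ct A D x ->
  rslice A D om x = adj (tens (tp H K) ^~ v) \o x \o tens (tp H K) ^~ v.
Proof.
have eb := elem_tens_bop (tp := tp) cA cD.
have [cb _ _ _] := nsub_ctens tp cA cD.
have [Ab _ _ _] : nsub A by case: (cstar_nalg cA A1).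
have [Db _ _ _] : nsub D by case: (cstar_nalg cD D1).
have bE := blin_rslice v v cb.
set E0 := fun x : tp H K -> tp H K => adj (tens (tp H K) ^~ v) \o x \o tens (tp H K) ^~ v in bE.
have [bE1 lE1 _] := bE.
have gE a b : A a -> D b -> E0 (ot a b) = om b *: a.
  move=> Aa Db'; have ba := Ab _ Aa; have bb := Db _ Db'.
  apply/funext => k; rewrite /E0 /= optensE // adj_tensl omE //.
have /(xgetPex (fun=> fun=> 0)) : exists E, [/\ forall (c : C) x y, ct A D x -> ct A D y ->
                   E (c *: x + y) = c *: E x + E y,
                 forall x, ct A D x -> bop (E x),
                 exists c : R, forall x, ct A D x ->
                   opnorm (E x) <= c * opnorm x &
                 forall a b, A a -> D b -> E (ot a b) = om b *: a].
  by exists E0; split=> //; exact: blin_bound bE.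
rewrite -/(rslice A D om) => -[hl hb [c hc] hg] cx.
have bL : blin (ct A D) (rslice A D om).
  split=> //; exists `|c| => [|y cy]; first exact: normr_ge0.
  apply: le_trans (hc y cy) _; apply: ler_wpM2r; last exact: ler_norm.
  exact/opnorm_ge0/cb.
apply: (blin_cspan_eq (nsub_ctens tp cA cD) _ bL bE _ cx).
  exact: cspan_self.
by move=> _ [a [b [Aa Db' ->]]]; rewrite hg // gE.
Qed.

End RState.
End Slices.

(** * The compact quantum group *)
Section Group.
Variable R : realType.
Variable tp : forall H K : hilbert R, htensor H K.
Local Notation ot := (@optens R tp _ _ _ _).
Local Notation ct := (@ctens R tp _ _).
Variables (H : hilbert R) (A : set (H -> H)) (DeltaG : (H -> H) -> (tp H H -> tp H H)).
Variables (L1 : H).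
Local Notation th h := (tens (tp H H) h).
Local Notation thr h := (tens (tp H H) ^~ h).
Hypotheses (cA : cstar_algebra A) (A1 : A id).
Hypotheses (sG : star_hom A DeltaG) (G1 : DeltaG id = id).
Hypothesis (GA : forall a, A a -> ct A A (DeltaG a)).
Hypothesis dense_l : cspan (opmul (DeltaG @` A) [set ot a id | a in A]) = ct A A.
Hypothesis dense_r : cspan (opmul (DeltaG @` A) [set ot id a | a in A]) = ct A A.
Hypothesis L1_unit : inner L1 L1 = 1.
Hypothesis L1_cyclic : closure [set a L1 | a in A] = setT.
Hypothesis L1_sep : forall a, A a -> a L1 = 0 -> a = 0.
Hypothesis G_lslice : forall a, A a ->
  adj (th L1) \o DeltaG a \o th L1 = inner (a L1) L1 *: id.
Hypothesis G_rslice : forall a, A a ->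
  adj (thr L1) \o DeltaG a \o thr L1 = inner (a L1) L1 *: id.

Let sA : star_algebra A. Proof. by case: cA. Qed.
Let bA : A `<=` @bop R H H. Proof. by case: sA. Qed.

Lemma A_total : closure (lspan [set a L1 | a in A]) = setT.
Proof. by rewrite -subTset -L1_cyclic; apply: closureS; exact: lspan_self. Qed.

Lemma AA_total : closure (lspan [set v | exists a b, [/\ A a, A b &
  v = tens (tp H H) (a L1) (b L1)]]) = setT.
Proof.
rewrite -[RHS](tens_total2 (tp H H) A_total A_total).
congr (closure (lspan _)); apply/seteqP; split=> v.
  by move=> [a [b [Aa Ab ->]]]; exists (a L1), (b L1); split=> //; [exists a|exists b].
by move=> [_ [_ [[a Aa <-] [b Ab <-] ->]]]; exists a, b.
Qed.

(** This is W^* for the multiplicative unitary W, in the convention Delta(a) = W^*(1 (x) a)W.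
    Invariance of the Haar state under slicing the second leg makes it isometric; density of
    Delta(A)(A (x) 1) makes its range total. *)
Lemma group_unitary : exists2 U : tp H H -> tp H H, unitary U &
  forall a b, A a -> A b ->
    U (tens (tp H H) (a L1) (b L1)) = DeltaG b (tens (tp H H) (a L1) L1).
Proof.
have [_ _ _ AM As] := sA; have [Gb Gl GM Ga] := sG.
pose I := ({a | A a} * {b | A b})%type.
pose e (p : I) := tens (tp H H) (sval p.1 L1) (sval p.2 L1).
pose g (p : I) := DeltaG (sval p.2) (tens (tp H H) (sval p.1 L1) L1).
have te : closure (lspan (range e)) = setT.
  rewrite -[RHS]AA_total; congr (closure (lspan _)); apply/seteqP; split=> v.
    by move=> [[[a Aa] [b Ab]] _ <-]; exists a, b.
  by move=> [a [b [Aa Ab ->]]]; exists (exist _ a Aa, exist _ b Ab).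
have [|V [iV Ve]] := isometry_extend te (f := g).
  move=> [[a Aa] [b Ab]] [[c Ac] [d Ad]]; rewrite /e /g /= tens_inner.
  have bd := Gb _ Ad; have btl := bop_tensl (tp H H) L1.
  rewrite (inC (DeltaG d _)) (adjE _ _ bd) -(Ga _ Ad).
  rewrite -[DeltaG (adj d) _]/((DeltaG (adj d) \o DeltaG b) (thr L1 (a L1))).
  have Adb := AM _ _ (As _ Ad) Ab.
  rewrite -(GM _ _ (As _ Ad) Ab) -inC.
  rewrite -[tens (tp H H) (c L1) L1]/(thr L1 (c L1)) -(adjEr _ _ btl).
  have := congr1 (fun X => X (a L1)) (G_rslice Adb); rewrite /= => ->.
  rewrite !fctE inZl /= (adjEr _ _ (bA Ad)) mulrC //.
have VE a b : A a -> A b -> V (tens (tp H H) (a L1) (b L1)) = DeltaG b (tens (tp H H) (a L1) L1).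
  by move=> Aa Ab; exact: (Ve (exist _ a Aa, exist _ b Ab)).
exists V => //; apply: isometry_unitary => //.
set W := lspan (range V); have sW : subspace W by exact: subspace_lspan.
have : ct A A `<=` [set x | bop x /\ closure W (x (tens (tp H H) L1 L1))].
  rewrite -dense_l; apply: cspan_min; first exact: nsub_eval.
  move=> _ [_ [_ [[b Ab <-] [a Aa <-] ->]]]; split.
    by apply: bop_comp; [exact: Gb|apply: bop_optens; [exact: bA|exact: bop_id]].
  rewrite /= optensE; [|exact: bA|exact: bop_id].
  by rewrite -VE //; apply: subset_closure; apply: lspan_self; exists (tens (tp H H) (a L1) (b L1)).
move=> hc; rewrite -subTset => v _; rewrite -[v]/(id v).
apply: (total_image AA_total (bop_id _)) => _ [a [b [Aa Ab ->]]] /=.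
have [_] := hc _ (ctens_gen tp cA cA Aa Ab).
by rewrite optensE //; exact: bA.
Qed.

Definition groupU : tp H H -> tp H H := sval (cid2 group_unitary).

Lemma unitary_groupU : unitary groupU.
Proof. by rewrite /groupU; case: cid2. Qed.

Lemma groupUE a b : A a -> A b ->
  groupU (tens (tp H H) (a L1) (b L1)) = DeltaG b (tens (tp H H) (a L1) L1).
Proof. by rewrite /groupU; case: cid2 => U /= _ h; exact: h. Qed.

(* Extends DeltaG, hence also its normal extension to A'', to all of B(H). *)
Definition DG (x : H -> H) : tp H H -> tp H H := groupU \o ot id x \o adj groupU.

Lemma ampl_DG : ampl DG.
Proof. exact: ampl_comp (ampl_optens tp H H) (ampl_conj unitary_groupU). Qed.

Lemma DG_groupU x : bop x -> DG x \o groupU = groupU \o ot id x.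
Proof.
move=> bx; have [_ _ U2] := unitary_groupU; rewrite /DG -compA U2 //.
Qed.

Lemma DGE a : A a -> DG a = DeltaG a.
Proof.
move=> Aa; have [Gb Gl GM Ga] := sG; have [bU U1 U2] := unitary_groupU.
have ba := bA Aa; have bi := bop_id H; have bo := bop_optens tp bi ba.
suff e : groupU \o ot id a = DeltaG a \o groupU by rewrite /DG e -compA U1.
apply: (bop_total_eq AA_total); [exact: bop_comp|apply: bop_comp => //; exact: Gb|].
move=> _ [c [b [Ac Ab ->]]] /=; rewrite optensE // groupUE //.
have [_ _ _ AM _] := sA.
have -> : a (b L1) = (a \o b) L1 by [].
by rewrite (groupUE Ac (AM _ _ Aa Ab)) (GM _ _ Aa Ab).
Qed.

Lemma groupU_L1 h : groupU (tens (tp H H) h L1) = tens (tp H H) h L1.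
Proof.
have [bU _ _] := unitary_groupU; have bt := bop_tensl (tp H H) L1.
have : groupU \o thr L1 = thr L1.
  apply: (bop_total_eq A_total) => //; first exact: bop_comp.
  move=> _ [a Aa <-]; have := groupUE Aa A1; rewrite G1 => h1; exact: h1.
by move/(congr1 (fun X => X h)).
Qed.

(** The intertwining isometry that an implemented action requires, here for A acting on itself. *)
Definition groupV : H -> tp H H := groupU \o th L1.

Lemma isometry_groupV : isometry groupV.
Proof.
have [bU hU] := unitary_isometry unitary_groupU.
split; first by apply: bop_comp => //; exact: bop_tensr.
by move=> x y; rewrite /groupV /= hU tens_inner L1_unit mul1r.
Qed.

Lemma DG_groupV x : bop x -> DG x \o groupV = groupV \o x.
Proof.
move=> bx; rewrite /groupV compA DG_groupU //; apply/funext => k /=.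
by rewrite optensE //; exact: bop_id.
Qed.

Let DGA b : A b -> ct A A (DG b). Proof. by move=> Ab; rewrite DGE //; exact: GA. Qed.
Let DG_slice b : A b -> adj (th L1) \o DG b \o th L1 = inner (b L1) L1 *: id.
Proof. by move=> Ab; rewrite DGE //; exact: G_lslice. Qed.

Lemma DG_hmodule z h : sclosure A z -> @hmodule R tp H H A (DG z \o th h).
Proof.
move=> Nz; have bz : bop z by case: Nz.
have nH := nsub_hmodule tp H (cstar_nalg cA A1).
move: h; apply: (impl_tens_dense ampl_DG cA A1 L1_cyclic bz) => _ [a Aa <-].
have bDz := ampl_bop ampl_DG bz.
have : forall Y, ct A A Y -> @hmodule R tp H H A (DG z \o Y \o th L1).
  rewrite -dense_r => Y.
  have Sb : opmul (DeltaG @` A) [set ot id a | a in A] `<=` @bop R (tp H H) (tp H H).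
    move=> _ [_ [_ [[b Ab <-] [c Ac <-] ->]]]; apply: bop_comp.
      by case: sG => Gb _ _ _; exact: Gb.
    by apply: bop_optens; [exact: bop_id|exact: bA].
  apply: (blin_cspan_sub (f := fun Y => DG z \o Y \o th L1) (nsub_bop _ _) Sb
     (blin_conj (fun=> id) (bop_tensr _ L1) bDz) nH).
  move=> _ [_ [_ [[b Ab <-] [c Ac <-] ->]]].
  have bb := bA Ab; have bc := bA Ac; have bi := bop_id H.
  have -> : DG z \o (DeltaG b \o ot id c) \o th L1 = (DG (z \o b) \o th L1) \o c.
    rewrite (ampl_mul ampl_DG bz bb) (DGE Ab); apply/funext => k /=.
    by rewrite optensE.
  apply: (hmodule_mulr cA A1) => //.
  apply: (impl_hmodule1 cA cA A1 ampl_DG DG_slice L1_cyclic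
    isometry_groupV DG_groupV cA A1 (sclosure_self bA) DGA L1_cyclic).
  have [[_ _ _ NM _] _ _] := sclosure_vn sA A1.
  by apply: NM => //; exact: sclosure_self.
move=> /(_ _ (ctens_gen tp cA cA Aa A1)).
have -> : DG z \o ot a id \o th L1 = DG z \o th (a L1) => //.
apply/funext => k /=; rewrite optensE //; [exact: bA|exact: bop_id].
Qed.

(* L1 is separating for A'': the slices of DG p, where p is the projection onto
   the orthogonal of A' L1, lie in A and annihilate L1. *)
Lemma commutant_cyclic : closure [set a' L1 | a' in commutant A] = setT.
Proof.
pose L := [set a' L1 | a' in commutant A].
have sL : subspace L.
  split; first by exists 0 => //; split; [exact: bop_cst0|move=> m Am; apply/funext => k;
    rewrite /= (bop0 (bA Am))].
  move=> a _ _ [s [bs cs] <-] [t [bt ct'] <-]; exists (a *: s + t) => //.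
  split; first exact: bop_lc.
  move=> m Am; have bm := bA Am; apply/funext => k.
  have := congr1 (fun X => X k) (cs _ Am); have := congr1 (fun X => X k) (ct' _ Am).
  by rewrite /= !fctE (bopD _ _ bm) (bopZ _ _ bm) /= => -> ->.
have bP := bop_proj sL; have bi := bop_id H.
pose p := id - proj L; have bp : bop p by exact: bop_sub.
have LS S x : commutant A S -> L x -> L (S x).
  move=> [bS cS] [t [bt ct'] <-]; exists (S \o t) => //; split; first exact: bop_comp.
  by move=> m Am; rewrite -compA ct' // compA cS.
have Np : sclosure A p.
  apply/(bicommutantE sA A1); split=> // S cS; have [bS _] := cS.
  have := proj_comm sL bS (LS S ^~ cS) (LS _ ^~ (commutant_adj sA cS)).
  by move=> h; apply/funext => x; rewrite /p !fctE /= (bopB _ _ bS) h.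
have Cid : commutant A id by split=> [|m _]; [exact: bop_id|].
have pL1 : p L1 = 0.
  rewrite /p !fctE (proj_id sL) ?subrr //; apply: subset_closure; exists id => //.
have [bU U1 U2] := unitary_groupU.
have Gp0 h : DG p (tens (tp H H) h L1) = 0.
  rewrite -groupU_L1 -[LHS]/((DG p \o groupU) (tens (tp H H) h L1)) DG_groupU //=.
  by rewrite optensE // pL1 tens0r (bop0 bU).
have bDp := ampl_bop ampl_DG bp.
have slice0 h h' : adj (th h') \o (DG p \o th h) = 0.
  apply: L1_sep; first by apply: (hmodule_slice cA A1); exact: DG_hmodule.
  by rewrite /= Gp0 (bop0 (bop_adj (bop_tensr _ h'))).
have Dp0 : DG p = 0.
  apply: tens_ext => //; first exact: bop_cst0.
  move=> h k; apply/eqP; rewrite -subr_eq0; apply/eqP.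
  apply: (in_total_eq0 (tens_total (tp H H))) => _ [h' [k' ->]].
  rewrite inBl [(0 : tp H H -> tp H H) _]/(0 : tp H H) in0l subr0.
  rewrite -(adjEr _ _ (bop_tensr (tp H H) h')).
  by have := congr1 (fun X => X k) (slice0 h h'); rewrite /= => ->; rewrite in0l.
have p0 : p = 0.
  apply/funext => k; have := congr1 (fun X => X k) (DG_groupV bp).
  rewrite /= Dp0 => e; apply: nrm_eq0.
  by rewrite -(isometry_nrm _ isometry_groupV) -e nrm0.
rewrite -subTset => x _.
have -> : x = proj L x.
  by have := congr1 (fun X => X x) p0; rewrite /p !fctE /= => /eqP; rewrite subr_eq0 => /eqP.
exact: proj_cl.
Qed.

End Group.

Section AmplEq.
Variable R : realType.

(* W_j^* V_i lies in M', hence commutes with the strong closure of M. *)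
Lemma ampl_eq_sclosure (K E : hilbert R) (M : set (K -> K))
    (f g : (K -> K) -> (E -> E)) : M `<=` @bop R K K -> ampl f -> ampl g ->
  (forall m, M m -> f m = g m) -> forall x, sclosure M x -> f x = g x.
Proof.
move=> bM af ag fg x Mx; have bx : bop x by case: Mx.
have [fb [I [V [bV fV _ tV]]]] := af; have [gb [J [W [bW gW _ tW]]]] := ag.
apply: (bop_total_eq tV (fb _ bx) (gb _ bx)) => _ [i [k ->]].
apply/eqP; rewrite -subr_eq0; apply/eqP.
apply: (in_total_eq0 tW) => _ [j [k' ->]]; rewrite inBl.
have gadj y k1 w : bop y -> inner (g y w) (W j k1) = inner w (W j (adj y k1)).
  by move=> by_; rewrite (adjE _ _ (gb _ by_)) -(ampl_adj ag by_) gW //; exact: bop_adj.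
have cS : commutant M (adj (W j) \o V i).
  split; first by apply: bop_comp => //; exact: bop_adj.
  move=> m Mm; have bm := bM _ Mm; apply/funext => u; apply: in_inj => w /=.
  rewrite (adjEr _ _ (bW j)) -fV // fg // gadj // -(adjEr _ _ (bW j)).
  by rewrite -(adjE _ _ bm).
have := sclosure_commute Mx cS => /(congr1 (fun X => inner (X k) k')) /=.
rewrite (adjEr _ _ (bW j)) (adjE _ _ bx) (adjEr _ _ (bW j)) => h.
by rewrite fV // h gadj // subrr.
Qed.

End AmplEq.

(** * Coactions on one leg and double slices *)

Section Legs.
Variable R : realType.
Variable tp : forall H K : hilbert R, htensor H K.
Local Notation ot := (@optens R tp _ _ _ _).
Local Notation ta H L := (@tassoc R tp H H L).

(** For W the group unitary this F is Delta_G (x) iota: 1 (x) x is rebracketed and conjugated by W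
    (x) 1, which makes F an amplification and hence normal. *)
Lemma leg1_ex (H L : hilbert R) (W : tp H H -> tp H H) : unitary W ->
  exists2 F : (tp H L -> tp H L) -> (tp (tp H H) L -> tp (tp H H) L), ampl F &
    forall m n, bop m -> bop n -> F (ot m n) = ot (W \o ot id m \o adj W) n.
Proof.
move=> uW; have [bW _ _] := uW; have bW' := bop_adj bW; have uT := unitary_tassoc tp H H L.
have [bT T1 T2] := uT; have bT' := bop_adj bT; have bH := bop_id H; have bL := bop_id L.
have uid : unitary (@id L) by split; rewrite ?adj_id.
have uWi := unitary_optens tp uW uid.
exists (fun x => ot W id \o (adj (ta H L) \o ot id x \o ta H L) \o adj (ot W id)).
  have := ampl_comp (ampl_comp (ampl_optens tp H (tp H L)) (ampl_conj (unitary_adj uT))) (ampl_conj uWi).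
  by rewrite adjK.
move=> m n bm bn; have bmn := bop_optens tp bm bn; have b1m := bop_optens tp bH bm.
have -> : adj (ta H L) \o ot id (ot m n) \o ta H L = ot (ot id m) n.
  apply: tens_ext3l; [|exact: bop_optens|].
    by apply: bop_comp => //; apply: bop_comp => //; exact: bop_optens.
  move=> h k l; rewrite /= tassocE (optensE _ _ _ bH bmn) (optensE _ _ _ bm bn) adj_tassocE.
  by rewrite (optensE _ _ _ b1m bn) (optensE _ _ _ bH bm).
have bWm := bop_comp bW b1m.
by rewrite adj_optens // adj_id !optens_comp.
Qed.

Lemma leg2_ex (H L : hilbert R) (U : tp H L -> tp H L) : unitary U ->
  exists2 F : (tp H L -> tp H L) -> (tp H (tp H L) -> tp H (tp H L)), ampl F &
    forall m n, bop m -> bop n -> F (ot m n) = ot m (U \o ot id n \o adj U).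
Proof.
move=> uU; have [bU _ _] := uU; have bU' := bop_adj bU.
have [X uX hX] := exchange_ex tp H H L; have [bX X1 X2] := uX; have bX' := bop_adj bX.
have bH := bop_id H.
have uid : unitary (@id H) by split; rewrite ?adj_id.
have uUi := unitary_optens tp uid uU.
exists (fun x => ot id U \o (X \o ot id x \o adj X) \o adj (ot id U)).
  exact: ampl_comp (ampl_comp (ampl_optens tp H (tp H L)) (ampl_conj uX)) (ampl_conj uUi).
move=> m n bm bn; have bmn := bop_optens tp bm bn; have b1n := bop_optens tp bH bn.
have -> : X \o ot id (ot m n) \o adj X = ot m (ot id n).
  have e : X \o ot id (ot m n) = ot m (ot id n) \o X.
    apply: tens_ext3; [by apply: bop_comp => //; exact: bop_optens|
      by apply: bop_comp => //; exact: bop_optens|].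
    move=> h k l; rewrite /= hX (optensE _ _ _ bH bmn) (optensE _ _ _ bm bn) hX.
    by rewrite (optensE _ _ _ bm b1n) (optensE _ _ _ bH bn).
  by rewrite e -compA X1.
have bUn := bop_comp bU b1n.
by rewrite adj_optens // adj_id !optens_comp.
Qed.

(** Both H legs are sliced away, which leaves an operator on E; for E = K it is one to which pi can
    be applied. *)
Definition slice2 (H E : hilbert R) (h1' h2' h1 h2 : H) (z : tp H (tp H E) -> tp H (tp H E)) :=
  adj (tens (tp H E) h2') \o (adj (tens (tp H (tp H E)) h1') \o z \o tens (tp H (tp H E)) h1)
    \o tens (tp H E) h2.

Lemma slice_ext (H E : hilbert R) (z z' : tp H E -> tp H E) : bop z -> bop z' ->
  (forall h h', adj (tens (tp H E) h') \o z \o tens (tp H E) h =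
                adj (tens (tp H E) h') \o z' \o tens (tp H E) h) -> z = z'.
Proof.
move=> bz bz' hz; apply: tens_ext => // h k.
apply/eqP; rewrite -subr_eq0; apply/eqP.
apply: (in_total_eq0 (tens_total (tp H E))) => _ [h' [k' ->]].
rewrite inBl -!(adjEr _ _ (bop_tensr (tp H E) h')).
by have := congr1 (fun X => X k) (hz h h') => /= ->; rewrite subrr.
Qed.

Lemma slice2_ext (H E : hilbert R) (z z' : tp H (tp H E) -> tp H (tp H E)) :
  bop z -> bop z' ->
  (forall h1' h2' h1 h2, slice2 h1' h2' h1 h2 z = slice2 h1' h2' h1 h2 z') -> z = z'.
Proof.
move=> bz bz' hz; apply: slice_ext => // h1 h1'.
have bs y : bop y -> bop (adj (tens (tp H (tp H E)) h1') \o y \o tens (tp H (tp H E)) h1).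
  move=> by_; apply: bop_comp; last exact: bop_tensr.
  by apply: bop_comp => //; apply: bop_adj; exact: bop_tensr.
by apply: slice_ext => [||h2 h2']; [exact: bs|exact: bs|exact: hz].
Qed.

Lemma blin_slice2 (H E : hilbert R) (h1' h2' h1 h2 : H) :
  blin (@bop R (tp H (tp H E)) (tp H (tp H E))) (slice2 (E := E) h1' h2' h1 h2).
Proof.
have bl := blin_slice h1 h1' (Dm := @bop R (tp H (tp H E)) (tp H (tp H E))) (fun=> id).
have [bb _ _] := bl.
exact: (blin_comp bl bb (blin_slice h2 h2' (fun=> id))).
Qed.

Lemma slice2_optens (H E : hilbert R) (h1' h2' h1 h2 : H) m n : bop m -> bop n ->
  slice2 (E := E) h1' h2' h1 h2 (ot m n) =
  inner (m h1) h1' *: (adj (tens (tp H E) h2') \o n \o tens (tp H E) h2).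
Proof.
move=> bm bn; apply/funext => l; rewrite /slice2 /= optensE // adj_tensr.
by rewrite (bopZ _ _ (bop_adj (bop_tensr _ h2'))).
Qed.

Lemma slice2_tassoc (H E : hilbert R) (h1' h2' h1 h2 : H) X n : bop X -> bop n ->
  slice2 (E := E) h1' h2' h1 h2 (ta H E \o ot X n \o adj (ta H E)) =
  inner (X (tens (tp H H) h1 h2)) (tens (tp H H) h1' h2') *: n.
Proof.
move=> bX bn; have [bT T1 T2] := unitary_tassoc tp H H E; apply/funext => l.
apply: in_inj => z; rewrite /slice2 /= adj_tassocE optensE //.
rewrite (adjEr _ _ (bop_tensr _ h2')) (adjEr _ _ (bop_tensr _ h1')) (adjE _ _ bT).
by rewrite adj_tassocE tens_inner -[(_ *: n) l]/(_ *: n l) inZl.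
Qed.

End Legs.

(** * The homogeneous space *)
Section Homogeneous.
Variable R : realType.
Variable tp : forall H K : hilbert R, htensor H K.
Local Notation C := R[i].
Local Notation ot := (@optens R tp _ _ _ _).
Local Notation ct := (@ctens R tp _ _).
Variables (H : hilbert R) (A : set (H -> H)) (L1 : H).
Hypotheses (cA : cstar_algebra A) (A1 : A id).
Hypothesis L1_unit : inner L1 L1 = 1.
Hypothesis A_cyclic : closure [set a L1 | a in A] = setT.
Hypothesis L1_cyclic : closure [set a' L1 | a' in commutant A] = setT.
Variables (K : hilbert R) (D : set (K -> K)) (DeltaD : (K -> K) -> (tp H K -> tp H K)).
Hypotheses (cD : cstar_algebra D) (D1 : D id).
Hypotheses (sD : star_hom D DeltaD) (DD1 : DeltaD id = id).
Hypothesis (DA : forall d, D d -> ct A D (DeltaD d)).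
Hypothesis D_inj : set_inj D DeltaD.
Variable F2 : (tp H K -> tp H K) -> (tp H (tp H K) -> tp H (tp H K)).
Hypotheses (sF2 : star_hom (ct A D) F2).
Hypothesis F2E : forall a d, A a -> D d -> F2 (ot a d) = ot a (DeltaD d).
Variable rho : (K -> K) -> C.
Hypothesis D_slice : forall d, D d ->
  adj (tens (tp H K) L1) \o DeltaD d \o tens (tp H K) L1 = rho d *: id.
Hypothesis D_dense : cspan (opmul (DeltaD @` D) [set ot a id | a in A]) = ct A D.
Variable k0 : K.
Hypothesis k0_unit : inner k0 k0 = 1.
Variables (L : hilbert R) (xi : L) (pi : (K -> K) -> (L -> L)).
Hypotheses (spi : star_hom D pi) (pi1 : pi id = id).
Hypothesis pi_xi : forall d, D d -> inner (pi d xi) xi = rho d.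
Hypothesis pi_cyclic : closure [set pi d xi | d in D] = setT.
Local Notation thK h := (tens (tp H K) h).
Local Notation thL h := (tens (tp H L) h).
Local Notation B := (pi @` D).
Local Notation N := (sclosure B).

Let nD : nalg D. Proof. exact: cstar_nalg. Qed.
Let bD : D `<=` @bop R K K. Proof. by case: nD => [[]]. Qed.
Let bA : A `<=` @bop R H H. Proof. by case: cA => [[]]. Qed.
Let bct : ct A D `<=` @bop R (tp H K) (tp H K).
Proof. by case: (nsub_ctens tp cA cD). Qed.
Let cct : cstar_algebra (ct A D). Proof. exact: ctens_cstar. Qed.
Let cct1 : ct A D id. Proof. exact: ctens1. Qed.
Let pib d : D d -> bop (pi d). Proof. by case: spi => h _ _ _; exact: h. Qed.
Let pib_sub : B `<=` @bop R L L. Proof. by move=> _ [d Dd <-]; exact: pib. Qed.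

Lemma pi_total : closure (lspan [set pi d xi | d in D]) = setT.
Proof. by rewrite -subTset -pi_cyclic; apply: closureS; exact: lspan_self. Qed.

(** The L1-slice of Delta_D being rho, the vectors Delta_D(d)(L1 (x) k0) have the inner products of
    the GNS vectors pi(d) xi. So pi is a subrepresentation of Delta_D, and F2 = iota (x) Delta_D
    yields iota (x) pi on the whole of A (x) D. *)
Lemma embed_ex : exists j : L -> tp H K, isometry j /\
  forall d, D d -> j (pi d xi) = DeltaD d (thK L1 k0).
Proof.
have [_ _ _ DM Ds] : star_algebra D by case: cD.
have [_ _ pM pa] := spi; have [Db _ dM da] := sD.
pose I := {d | D d}.
have te : closure (lspan (range (fun p : I => pi (sval p) xi))) = setT.
  rewrite -[RHS]pi_total; congr (closure (lspan _)); apply/seteqP; split=> v.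
    by move=> [[d Dd] _ <-]; exists d.
  by move=> [d Dd <-]; exists (exist _ d Dd).
have [|j [ij je]] := isometry_extend te (f := fun p : I => DeltaD (sval p) (thK L1 k0)).
  move=> [d Dd] [e De] /=.
  have Ded := DM _ _ (Ds _ De) Dd.
  rewrite (inC (DeltaD e _)) (adjE _ _ (Db _ De)) -(da _ De).
  rewrite -[DeltaD (adj e) _]/((DeltaD (adj e) \o DeltaD d) (thK L1 k0)).
  rewrite -(dM _ _ (Ds _ De) Dd) -inC -(adjEr _ _ (bop_tensr _ L1)).
  have := congr1 (fun X => X k0) (D_slice Ded); rewrite /= => ->.
  rewrite -[(rho _ *: id) k0]/(rho _ *: k0) inZl k0_unit mulr1.
  rewrite -(pi_xi Ded) (pM _ _ (Ds _ De) Dd) (pa _ De) /=.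
  by rewrite (adjEr _ _ (pib De)).
by exists j; split=> // d Dd; exact: (je (exist _ d Dd)).
Qed.

Definition embed : L -> tp H K := sval (cid embed_ex).

Lemma isometry_embed : isometry embed.
Proof. by rewrite /embed; case: cid => j []. Qed.

Let bj : bop embed. Proof. by case: isometry_embed. Qed.

Lemma embed_pi d : D d -> embed \o pi d = DeltaD d \o embed.
Proof.
move=> Dd; have [Db _ dM _] := sD; have [_ _ pM _] := spi.
have [_ _ _ DM _] : star_algebra D by case: cD.
have je e : D e -> embed (pi e xi) = DeltaD e (thK L1 k0).
  by rewrite /embed; case: cid => j /= [_ h]; exact: h.
have bpd := pib Dd; have bdd := Db _ Dd.
apply: (bop_total_eq pi_total); [exact: bop_comp|exact: bop_comp|].
move=> _ [e De <-] /=; rewrite (je _ De) -[pi d (pi e xi)]/((pi d \o pi e) xi).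
by rewrite -(pM _ _ Dd De) je ?(dM _ _ Dd De) //; exact: DM.
Qed.

(* iota (x) pi, as a corner of iota (x) Delta_D. *)
Definition idpi (x : tp H K -> tp H K) : tp H L -> tp H L :=
  adj (ot id embed) \o F2 x \o ot id embed.

Let bJ : bop (ot id embed : tp H L -> tp H (tp H K)).
Proof. by apply: bop_optens => //; exact: bop_id. Qed.

Let blF2 : blin (ct A D) F2. Proof. exact: star_hom_blin cct cct1 sF2. Qed.

Lemma blin_idpi : blin (ct A D) idpi.
Proof.
have [F2b _ _ _] := sF2; have bJ' := bop_adj bJ.
exact: (blin_comp blF2 F2b (blin_conj (fun=> id) bJ bJ')).
Qed.

Lemma idpi_gen a d : A a -> D d -> idpi (ot a d) = ot a (pi d).
Proof.
move=> Aa Dd; have ba := bA Aa; have bd := bD Dd; have bi := bop_id H.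
have bdd : bop (DeltaD d) by case: sD => h _ _ _; exact: h.
have bj' := bop_adj bj; have bpd := pib Dd.
rewrite /idpi F2E // adj_optens // adj_id optens_comp // optens_comp //; last first.
  exact: bop_comp.
by rewrite -[(adj embed \o _) \o embed]compA -(embed_pi Dd) compA (isometry_adjK isometry_embed).
Qed.

(** The range of 1 (x) [embed] is invariant under F2(x), which is what makes the corner
    multiplicative. *)
Lemma idpi_intertwine x : ct A D x -> F2 x \o ot id embed = ot id embed \o idpi x.
Proof.
have [F2b _ _ _] := sF2; have bJ' := bop_adj bJ.
have eb := elem_tens_bop (tp := tp) cA cD.
have [Fb _ _] := blin_idpi.
have bl1 := blin_comp blF2 F2b (blin_prec (fun=> id) bJ).
have bl2 := blin_comp blin_idpi Fb (blin_postc (fun=> id) bJ).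
apply: (blin_cspan_eq (nsub_ctens tp cA cD) (cspan_self eb) bl1 bl2).
move=> _ [a [d [Aa Dd ->]]]; have ba := bA Aa; have bd := bD Dd; have bi := bop_id H.
have bdd : bop (DeltaD d) by case: sD => h _ _ _; exact: h.
have bpd := pib Dd.
by rewrite idpi_gen // F2E // !optens_comp // embed_pi.
Qed.

Lemma idpi_star : star_hom (ct A D) idpi.
Proof.
have [F2b F2l F2M F2a] := sF2; have [Fb Fl _] := blin_idpi; split=> //.
- move=> x y cx cy; rewrite {1}/idpi F2M // -[_ \o ot id embed]compA.
  rewrite -(compA (F2 x)) idpi_intertwine // !compA; congr (_ \o _).
- move=> x cx; have bJ' := bop_adj bJ; have b2 := F2b _ cx.
  rewrite /idpi F2a // (adj_comp (bop_comp bJ' b2) bJ) (adj_comp bJ' b2) (adjK bJ).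
  by rewrite compA.
Qed.

Lemma idpi_ctens x : ct A D x -> ct A B (idpi x).
Proof.
have eb := elem_tens_bop (tp := tp) cA cD.
have gb : @elem_tens R tp _ _ A B `<=` @bop R (tp H L) (tp H L).
  by move=> _ [a [b [Aa Bb ->]]]; apply: bop_optens; [exact: bA|exact: pib_sub].
apply: (blin_cspan_sub (nsub_ctens tp cA cD) (cspan_self eb) blin_idpi (nsub_cspan gb)).
move=> _ [a [d [Aa Dd ->]]]; rewrite idpi_gen //; apply: cspan_self => //.
by exists a, (pi d); split=> //; exists d.
Qed.

Lemma slice_D x h h' : ct A D x -> D (adj (thK h') \o x \o thK h).
Proof.
move=> cx; rewrite -compA; apply: (hmodule_slice cD D1).
exact: (ctens_tensr cA cD D1).
Qed.

Let blpi : blin D pi. Proof. exact: star_hom_blin cD D1 spi. Qed.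

Lemma idpi_slice x h h' : ct A D x ->
  adj (thL h') \o idpi x \o thL h = pi (adj (thK h') \o x \o thK h).
Proof.
move=> cx; have eb := elem_tens_bop (tp := tp) cA cD.
have [Fb Fl _] := blin_idpi.
have bl1 := blin_comp blin_idpi Fb (blin_slice h h' (fun=> id)).
have bl2 := blin_comp (blin_slice h h' bct) (fun y => @slice_D y h h') blpi.
move: x cx; apply: (blin_cspan_eq (nsub_ctens tp cA cD) (cspan_self eb) bl1 bl2).
move=> _ [a [d [Aa Dd ->]]]; have ba := bA Aa; have bd := bD Dd.
rewrite idpi_gen //.
have -> : adj (thK h') \o ot a d \o thK h = inner (a h) h' *: d.
  by apply/funext => k /=; rewrite optensE // adj_tensr.
rewrite (star_homZ cD D1 spi) //; apply/funext => k /=.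
by rewrite optensE ?adj_tensr //; exact: pib.
Qed.

Lemma ctens_comm x a' : ct A D x -> commutant A a' -> x \o ot a' id = ot a' id \o x.
Proof.
move=> cx [ba' ca']; have bi := bop_id K; have bo := bop_optens tp ba' bi.
have bE := elem_tens_bop (tp := tp) cA cD.
move: x cx; apply: (blin_cspan_eq (nsub_bop _ _) bE
  (blin_prec (fun=> id) bo) (blin_postc (fun=> id) bo)).
move=> _ [a [c [Aa Dc ->]]]; have ba := bA Aa; have bc := bD Dc.
by rewrite !optens_comp // ca'.
Qed.

(** Faithfulness of rho in another form. If pi(d) = 0, then |Delta_D(d)(L1 (x) k)|^2 = rho(d^*
    d)|k|^2 = 0. Since Delta_D(d) commutes with A' (x) 1 and L1 is cyclic for A', Delta_D(d) = 0,
    and d = 0 by injectivity. *)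
Lemma pi_inj : set_inj D pi.
Proof.
have [_ _ _ DM Ds] : star_algebra D by case: cD.
have [Db _ dM da] := sD; have [_ _ pM pa] := spi.
have [nsD _ _] := nD; have [_ D0 _ _] := nsD.
have z d : D d -> pi d = 0 -> d = 0.
  move=> Dd pd0; have bdd := Db _ Dd.
  have h1 k : DeltaD d (thK L1 k) = 0.
    have Ddd := DM _ _ (Ds _ Dd) Dd.
    apply: nrm_eq0; apply/eqP; rewrite -sqrf_eq0 nrm_adjM // -(da _ Dd) -(dM _ _ (Ds _ Dd) Dd).
    rewrite /rin -(adjEr _ _ (bop_tensr _ L1)).
    have := congr1 (fun X => X k) (D_slice Ddd); rewrite /= => ->.
    rewrite -(pi_xi Ddd) (pM _ _ (Ds _ Dd) Dd) pd0 /=.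
    rewrite (bop0 (pib (Ds _ Dd))) in0l.
    by rewrite -[(0 *: id) k]/(0 *: k) scale0r in0l.
  apply: D_inj; rewrite ?inE //.
  rewrite (star_hom0 cD D1 sD).
  have LT : closure (lspan [set a' L1 | a' in commutant A]) = setT.
    by rewrite -subTset -L1_cyclic; apply: closureS; exact: lspan_self.
  have KT : closure (lspan [set: K]) = setT.
    by rewrite -subTset => v _; apply: subset_closure; exact: lspan_self.
  apply: (bop_total_eq (tens_total2 (tp H K) LT KT)) => //; first exact: bop_cst0.
  move=> _ [_ [k [[a' ca' <-] _ ->]]]; have [ba' _] := ca'; have bi := bop_id K.
  have := congr1 (fun X => X (thK L1 k)) (ctens_comm (DA Dd) ca').
  by rewrite /= optensE // h1 => ->; rewrite (bop0 (bop_optens tp ba' bi)).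
move=> d e; rewrite !inE => Dd De de; apply/eqP; rewrite -subr_eq0; apply/eqP.
apply: z; first exact: nsubB.
by rewrite (star_homB spi Dd De) de subrr.
Qed.

Lemma pi_isometric d : D d -> opnorm (pi d) = opnorm d.
Proof. exact: (star_hom_isometric cD D1 spi pi_inj pi1). Qed.

(** An injective unital representation is isometric, so the preimages of a Cauchy sequence in pi(D)
    converge in D. *)
Lemma pi_cstar : cstar_algebra B.
Proof.
have [_ D0 Dl DM Ds] : star_algebra D by case: cD.
have [_ Dc] := cD; have [pb pl pM pa] := spi.
split.
  split=> //.
  - by exists 0 => //; exact: (star_hom0 cD D1 spi).
  - by move=> c _ _ [d Dd <-] [e De <-]; exists (c *: d + e); [exact: Dl|exact: pl].
  - by move=> _ _ [d Dd <-] [e De <-]; exists (d \o e); [exact: DM|exact: pM].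
  - by move=> _ [d Dd <-]; exists (adj d); [exact: Ds|exact: pa].
move=> T [bT hT].
have hn (n : nat) : exists d, D d /\ opnorm (T - pi d) < n.+1%:R^-1.
  by have [|_ [d Dd <-] h] := hT n.+1%:R^-1; [rewrite invr_gt0|exists d].
have [u hu] := choice hn.
have bu n : bop (u n) by apply: bD; case: (hu n).
have bpu n : bop (pi (u n)) by apply: pb; case: (hu n).
have arch (e : R) : 0 < e -> exists M, forall n, (M <= n)%N -> n.+1%:R^-1 < e.
  move=> e0; pose M := Num.truncn e^-1; exists M => n Mn.
  have h1 : e^-1 < M.+1%:R by exact: truncnS_gt.
  rewrite -(invrK e) ltf_pV2 ?posrE ?invr_gt0 //.
  by apply: lt_le_trans h1 _; rewrite ler_nat.
have [|d bd hd] := op_complete bu.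
  move=> e e0; have [|M hM] := arch (e / 2); first by rewrite divr_gt0.
  exists M => m n Mm Mn; have [Dm hm] := hu m; have [Dn hn'] := hu n.
  have [nsD _ _] := nD.
  rewrite -pi_isometric; last exact: nsubB.
  rewrite (star_homB spi Dm Dn).
  apply: le_lt_trans (opnorm_trans (bpu m) bT (bpu n)) _.
  rewrite (opnormBC _ T).
  by rewrite (splitr e); apply: ltrD; [exact: lt_trans hm (hM m Mm)|exact: lt_trans hn' (hM n Mn)].
have Dd : D d.
  apply: Dc; split=> // e e0; have [M hM] := hd e e0.
  by exists (u M); [case: (hu M)|exact: hM].
exists d => //; apply/eqP; rewrite -subr_eq0; apply/eqP/opnorm_le0.
  by apply: bop_sub => //; exact: pb.
move=> e e0; have [|M hM] := arch (e / 2); first by rewrite divr_gt0.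
have [|M' hM'] := hd (e / 2); first by rewrite divr_gt0.
pose n := maxn M M'.
have {}hM := hM n (leq_maxl _ _); have {}hM' := hM' n (leq_maxr _ _).
have [Dn hn'] := hu n; have [nsD _ _] := nD.
apply: le_trans (opnorm_trans (pb _ Dd) (bpu n) bT) _.
rewrite (opnormBC _ T) -(star_homB spi Dd Dn) pi_isometric; last exact: nsubB.
by rewrite (splitr e); apply: lerD; apply: ltW => //; exact: lt_trans hn' hM.
Qed.

(** [gns_tens] is determined on A (x) D by linearity, boundedness and its values on elementary
    tensors, and evaluation of iota (x) pi at L1 (x) xi has all these properties. *)
Lemma gns_tensE (Lphi : (H -> H) -> H) (Lrho : (K -> K) -> L) :
  (forall a, A a -> Lphi a = a L1) -> (forall d, D d -> Lrho d = pi d xi) ->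
  forall x, ct A D x -> @gns_tens R tp _ _ _ _ A D Lphi Lrho x = idpi x (thL L1 xi).
Proof.
move=> hphi hrho; have eb := elem_tens_bop (tp := tp) cA cD.
have [Fb Fl [c c0 Fc]] := blin_idpi.
have hl : forall (e : C) x y, ct A D x -> ct A D y -> idpi (e *: x + y) (thL L1 xi) =
    e *: idpi x (thL L1 xi) + idpi y (thL L1 xi) by move=> e x y cx cy; rewrite Fl.
have hc : exists e : R, forall x, ct A D x -> nrm (idpi x (thL L1 xi)) <= e * opnorm x.
  exists (c * nrm (thL L1 xi)) => x cx.
  apply: le_trans (ler_opnorm _ (Fb _ cx)) _; rewrite mulrAC.
  by apply: ler_wpM2r; [exact: nrm_ge0|exact: Fc].
have hg a d : A a -> D d -> idpi (ot a d) (thL L1 xi) = tens (tp H L) (Lphi a) (Lrho d).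
  move=> Aa Dd; have ba := bA Aa; have bpd := pib Dd.
  by rewrite (idpi_gen Aa Dd) (optensE _ _ _ ba bpd) (hphi _ Aa) (hrho _ Dd).
have /(xgetPex (fun=> 0)) : exists E : (tp H K -> tp H K) -> tp H L,
   [/\ forall (e : C) x y, ct A D x -> ct A D y -> E (e *: x + y) = e *: E x + E y,
       exists e : R, forall x, ct A D x -> complex.Re `|E x| <= e * opnorm x &
       forall a d, A a -> D d -> E (ot a d) = tens (tp H L) (Lphi a) (Lrho d)].
  by exists (fun x => idpi x (thL L1 xi)).
rewrite -/(gns_tens A D Lphi Lrho) => -[gl gc gg].
apply: (vec_cspan_eq eb gl hl gc hc) => [_ [a [d [Aa Dd ->]]]|].
  by rewrite (gg _ _ Aa Dd) (hg _ _ Aa Dd).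
exists (thL L1 xi); rewrite tens_inner L1_unit mul1r.
have := pi_xi D1; rewrite pi1 => ->.
have := congr1 (fun X => inner (X k0) k0) (D_slice D1); rewrite DD1 /=.
rewrite tens_inj_unit // -[(_ *: id) k0]/(_ *: k0) inZl k0_unit mulr1 => <-.
by [].
Qed.

Let B1 : B id. Proof. by exists id. Qed.

Variable U : tp H L -> tp H L.
Hypothesis uU : unitary U.
Hypothesis UE : forall a d, A a -> D d ->
  U (tens (tp H L) (a L1) (pi d xi)) = idpi (DeltaD d \o ot a id) (thL L1 xi).

Definition DN (x : L -> L) : tp H L -> tp H L := U \o ot id x \o adj U.

Lemma ampl_DN : ampl DN.
Proof. exact: ampl_comp (ampl_optens tp H L) (ampl_conj uU). Qed.

Lemma DN_U x : DN x \o U = U \o ot id x.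
Proof. by have [_ _ U2] := uU; rewrite /DN -compA U2. Qed.

Lemma UE2 a d : A a -> D d ->
  U (tens (tp H L) (a L1) (pi d xi)) = idpi (DeltaD d) (tens (tp H L) (a L1) xi).
Proof.
move=> Aa Dd; have ba := bA Aa; have [_ _ Fm _] := idpi_star.
rewrite UE // Fm; [|exact: DA|exact: ctens_gen].
by rewrite /= idpi_gen // pi1 optensE //; exact: bop_id.
Qed.

Lemma DN_pi d : D d -> DN (pi d) = idpi (DeltaD d).
Proof.
move=> Dd; have [bU U1 _] := uU; have bi := bop_id H; have bpd := pib Dd.
have [Fb _ Fm _] := idpi_star; have [_ _ dM _] := sD; have [_ _ pM _] := spi.
have [_ _ _ DM _] : star_algebra D by case: cD.
have bFd := Fb _ (DA Dd).
have AT : closure (lspan [set a L1 | a in A]) = setT.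
  by rewrite -subTset -A_cyclic; apply: closureS; exact: lspan_self.
suff e : U \o ot id (pi d) = idpi (DeltaD d) \o U by rewrite /DN e -compA U1.
have bo := bop_optens tp bi bpd.
apply: (bop_total_eq (tens_total2 (tp H L) AT pi_total)); [exact: bop_comp|exact: bop_comp|].
move=> _ [_ [_ [[a Aa <-] [e De <-] ->]]] /=; rewrite optensE //=.
rewrite -[pi d (pi e xi)]/((pi d \o pi e) xi) -(pM _ _ Dd De) UE2 //; last exact: DM.
by rewrite (dM _ _ Dd De) Fm; [rewrite UE2|exact: DA|exact: DA].
Qed.

Definition DNV : L -> tp H L := U \o thL L1.

Lemma isometry_DNV : isometry DNV.
Proof.
have [bU hU] := unitary_isometry uU.
split; first by apply: bop_comp => //; exact: bop_tensr.
by move=> x y; rewrite /DNV /= hU tens_inner L1_unit mul1r.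
Qed.

Lemma DN_DNV x : bop x -> DN x \o DNV = DNV \o x.
Proof.
move=> bx; rewrite /DNV compA DN_U //; apply/funext => k /=.
by rewrite optensE //; exact: bop_id.
Qed.

Lemma DN_ctens b : B b -> ct A B (DN b).
Proof. by move=> [d Dd <-]; rewrite DN_pi //; apply: idpi_ctens; exact: DA. Qed.

Lemma DN_slice b : B b -> adj (thL L1) \o DN b \o thL L1 = inner (b xi) xi *: id.
Proof.
move=> [d Dd <-]; rewrite DN_pi // idpi_slice ?D_slice //; last exact: DA.
by rewrite (star_homZ cD D1 spi) // pi1 pi_xi.
Qed.

Lemma B_cyclic : closure [set b xi | b in B] = setT.
Proof.
rewrite -pi_cyclic; congr closure; apply/seteqP; split=> v.
  by move=> [_ [d Dd <-] <-]; exists d.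
by move=> [d Dd <-]; exists (pi d) => //; exists d.
Qed.

Lemma DN_dense : cspan (opmul (DN @` B) [set ot a id | a in A]) = ct A B.
Proof.
have bi := bop_id L.
have Sb : opmul (DN @` B) [set ot a id | a in A] `<=` @bop R (tp H L) (tp H L).
  move=> _ [_ [_ [[b Bb <-] [a Aa <-] ->]]]; apply: bop_comp.
    by apply: (ampl_bop ampl_DN); exact: pib_sub.
  by apply: bop_optens => //; exact: bA.
have eb := elem_tens_bop (tp := tp) cA pi_cstar.
apply/seteqP; split.
  apply: cspan_min; first exact: nsub_ctens cA pi_cstar.
  move=> _ [_ [_ [[b Bb <-] [a Aa <-] ->]]].
  by apply: (ctens_mul cA pi_cstar); [exact: DN_ctens|exact: (ctens_gen tp cA pi_cstar Aa B1)].
have key x : ct A D x -> cspan (opmul (DN @` B) [set ot a id | a in A]) (idpi x).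
  rewrite -D_dense => cx.
  have Db' : opmul (DeltaD @` D) [set ot a id | a in A] `<=` ct A D.
    move=> _ [_ [_ [[d Dd <-] [a Aa <-] ->]]].
    by apply: (ctens_mul cA cD); [exact: DA|exact: (ctens_gen tp cA cD Aa D1)].
  apply: (blin_cspan_sub (nsub_ctens tp cA cD) Db' blin_idpi (nsub_cspan Sb) _ cx).
  move=> _ [_ [_ [[d Dd <-] [a Aa <-] ->]]]; have [_ _ Fm _] := idpi_star.
  apply: cspan_self => //; exists (DN (pi d)), (ot a id); split.
  - by exists (pi d) => //; exists d.
  - by exists a.
  - rewrite Fm ?DN_pi ?idpi_gen ?pi1 //; [exact: DA|exact: (ctens_gen tp cA cD Aa D1)].
apply: cspan_min; first exact: nsub_cspan.
move=> _ [a [_ [Aa [d Dd <-] ->]]]; rewrite -idpi_gen //; apply: key.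
exact: (ctens_gen tp cA cD Aa Dd).
Qed.

(** * Coassociativity on N *)

Section Coassociativity.
Variable DeltaG : (H -> H) -> (tp H H -> tp H H).
Variable F1 : (tp H K -> tp H K) -> (tp (tp H H) K -> tp (tp H H) K).
Hypotheses (sF1 : star_hom (ct A D) F1) (bDG : forall a, A a -> bop (DeltaG a)).
Hypothesis F1E : forall a d, A a -> D d -> F1 (ot a d) = ot (DeltaG a) d.
Hypothesis coassD : forall d, D d ->
  @tassoc R tp H H K \o F1 (DeltaD d) = F2 (DeltaD d) \o @tassoc R tp H H K.
Variable F1L : (tp H L -> tp H L) -> (tp (tp H H) L -> tp (tp H H) L).
Variable F2L : (tp H L -> tp H L) -> (tp H (tp H L) -> tp H (tp H L)).
Hypotheses (aF1L : ampl F1L) (aF2L : ampl F2L).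
Hypothesis F1LE : forall a b, A a -> B b -> F1L (ot a b) = ot (DeltaG a) b.
Hypothesis F2LE : forall a b, A a -> B b -> F2L (ot a b) = ot a (DN b).
Local Notation taL := (@tassoc R tp H H L).

(** Coassociativity of Delta_D is an identity on H (x) H (x) K. Slicing the two H legs leaves
    elements of D, to which pi applies, so the identity moves to L^2(D) without a map iota (x) iota
    (x) pi. *)
Lemma slice2_transfer (G : (tp H K -> tp H K) -> (tp H (tp H K) -> tp H (tp H K)))
    (G' : (tp H K -> tp H K) -> (tp H (tp H L) -> tp H (tp H L))) h1' h2' h1 h2 :
  blin (ct A D) G -> blin (ct A D) G' ->
  (forall a d, A a -> D d -> D (slice2 h1' h2' h1 h2 (G (ot a d)))) ->
  (forall a d, A a -> D d -> slice2 h1' h2' h1 h2 (G' (ot a d)) =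
     pi (slice2 h1' h2' h1 h2 (G (ot a d)))) ->
  forall y, ct A D y ->
    slice2 h1' h2' h1 h2 (G' y) = pi (slice2 h1' h2' h1 h2 (G y)).
Proof.
move=> bG bG' GD GE; have eb := elem_tens_bop (tp := tp) cA cD.
have [Gb _ _] := bG; have [Gb' _ _] := bG'; have [nsD _ _] := nD.
have nC := nsub_ctens tp cA cD; have sC := cspan_self eb.
have b1 := blin_comp bG Gb (@blin_slice2 R tp H K h1' h2' h1 h2).
have b2 := blin_comp bG' Gb' (@blin_slice2 R tp H L h1' h2' h1 h2).
have D2 y : ct A D y -> D (slice2 h1' h2' h1 h2 (G y)).
  by apply: (blin_cspan_sub nC sC b1 nsD) => _ [a [d [Aa Dd ->]]]; exact: GD.
apply: (blin_cspan_eq nC sC b2 (blin_comp b1 D2 blpi)) => _ [a [d [Aa Dd ->]]].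
exact: GE.
Qed.

Lemma coassoc_B d : D d -> taL \o F1L (DN (pi d)) \o adj taL = F2L (DN (pi d)).
Proof.
move=> Dd; rewrite DN_pi //; have Cd := DA Dd.
have [Ib _ _] := blin_idpi.
have nC := nsub_ctens tp cA cD.
have blF1 := star_hom_blin cct cct1 sF1.
have [F1b _ _] := blF1; have [F2b _ _] := blF2.
have [bTK TK1 TK2] := unitary_tassoc tp H H K; have bTK' := bop_adj bTK.
have [bTL TL1 TL2] := unitary_tassoc tp H H L; have bTL' := bop_adj bTL.
have bF1L := ampl_bop aF1L; have bF2L := ampl_bop aF2L.
have bl1 := blin_comp blF1 F1b (blin_conj (fun=> id) bTK' bTK).
have bI1 := blin_comp blin_idpi Ib (ampl_blin aF1L).
have [bI1b _ _] := bI1.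
have bl1' := blin_comp bI1 bI1b (blin_conj (fun=> id) bTL' bTL).
have bl2' := blin_comp blin_idpi Ib (ampl_blin aF2L).
have [bl1b _ _] := bl1'; have [bl2b _ _] := bl2'.
have [nsD _ _] := nD.
apply: slice2_ext; [exact: bl1b|exact: bl2b|move=> h1' h2' h1 h2].
have Bpi e : D e -> B (pi e) by exists e.
rewrite (@slice2_transfer _ _ h1' h2' h1 h2 bl1 bl1' _ _ _ Cd); first last.
- move=> a e Aa De; have be := bD De; have bpe := pib De.
  rewrite (idpi_gen Aa De) (F1LE Aa (Bpi _ De)) (F1E Aa De).
  rewrite (slice2_tassoc _ _ _ _ (bDG Aa) bpe) (slice2_tassoc _ _ _ _ (bDG Aa) be).
  by rewrite (star_homZ cD D1 spi).
- move=> a e Aa De; have be := bD De.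
  by rewrite (F1E Aa De) (slice2_tassoc _ _ _ _ (bDG Aa) be); exact: nsubZ.
rewrite (@slice2_transfer _ _ h1' h2' h1 h2 blF2 bl2' _ _ _ Cd); first last.
- move=> a e Aa De; have be := bD De; have ba := bA Aa; have bpe := pib De.
  have [Db _ _ _] := sD.
  rewrite (idpi_gen Aa De) (F2LE Aa (Bpi _ De)) (F2E Aa De).
  rewrite (slice2_optens _ _ _ _ ba (Db _ De)) (slice2_optens _ _ _ _ ba (ampl_bop ampl_DN bpe)).
  rewrite DN_pi // idpi_slice; last exact: DA.
  by rewrite (star_homZ cD D1 spi) //; apply: slice_D; exact: DA.
- move=> a e Aa De; have be := bD De; have ba := bA Aa.
  have [Db _ _ _] := sD.
  rewrite (F2E Aa De) (slice2_optens _ _ _ _ ba (Db _ De)); apply: nsubZ => //.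
  by apply: slice_D; exact: DA.
by rewrite coassD // -compA TK1.
Qed.

Lemma coassoc_N x : N x -> taL \o F1L (DN x) = F2L (DN x) \o taL.
Proof.
move=> Nx; have uT := unitary_tassoc tp H H L; have [bT T1 T2] := uT.
have e : taL \o F1L (DN x) \o adj taL = F2L (DN x).
  apply: (ampl_eq_sclosure (f := fun x => taL \o F1L (DN x) \o adj taL)
    (g := fun x => F2L (DN x)) pib_sub _ _ _ Nx).
  - exact: ampl_comp (ampl_comp ampl_DN aF1L) (ampl_conj uT).
  - exact: ampl_comp ampl_DN aF2L.
  - by move=> _ [d Dd <-]; exact: coassoc_B.
by rewrite -e -compA T2.
Qed.

End Coassociativity.

End Homogeneous.

(** * The coaction on N, its C*-version and uniqueness *)

Section Implemented_coaction.
Variable R : realType.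
Variable tp : forall H K : hilbert R, htensor H K.
Local Notation ot := (@optens R tp _ _ _ _).
Local Notation ct := (@ctens R tp _ _).
Variables (H : hilbert R) (A : set (H -> H)) (DeltaG : (H -> H) -> (tp H H -> tp H H)).
Variable L1 : H.
Hypotheses (cA : cstar_algebra A) (A1 : A id).
Hypothesis L1_unit : inner L1 L1 = 1.
Hypothesis L1_cyclic : closure [set a' L1 | a' in commutant A] = setT.
Variables (L : hilbert R) (xi : L) (B : set (L -> L)).
Local Notation hmod := (@hmodule R tp H L).
Local Notation th h := (tens (tp H L) h).
Local Notation N := (sclosure B).
Hypothesis xi_unit : inner xi xi = 1.
Hypotheses (cB : cstar_algebra B) (B1 : B id).
Variables (f : (L -> L) -> (tp H L -> tp H L)) (Vz : L -> tp H L).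
Hypotheses (af : ampl f) (fB : forall b, B b -> ct A B (f b)).
Hypothesis f_slice : forall b, B b -> adj (th L1) \o f b \o th L1 = inner (b xi) xi *: id.
Hypothesis B_cyclic : closure [set b xi | b in B] = setT.
Hypotheses (iVz : isometry Vz) (fVz : forall x, bop x -> f x \o Vz = Vz \o x).
Hypothesis B_dense : cspan (opmul (f @` B) [set ot a id | a in A]) = ct A B.
Variable g : (H -> H) -> (tp H H -> tp H H).
Hypotheses (ag : ampl g) (gE : forall a, A a -> g a = DeltaG a).
Variable F1 : (tp H L -> tp H L) -> (tp (tp H H) L -> tp (tp H H) L).
Variable F2 : (tp H L -> tp H L) -> (tp H (tp H L) -> tp H (tp H L)).
Hypotheses (aF1 : ampl F1) (aF2 : ampl F2).
Hypothesis F1E : forall m n, bop m -> bop n -> F1 (ot m n) = ot (g m) n.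
Hypothesis F2E : forall m n, bop m -> bop n -> F2 (ot m n) = ot m (f n).
Hypothesis coass : forall x, N x ->
  @tassoc R tp H H L \o F1 (f x) = F2 (f x) \o @tassoc R tp H H L.
Variable DeltaN : (L -> L) -> (tp H L -> tp H L).
Hypothesis DeltaNE : forall x, N x -> DeltaN x = f x.

Let sB : star_algebra B. Proof. by case: cB. Qed.
Let bB : B `<=` @bop R L L. Proof. by case: sB. Qed.
Let bA : A `<=` @bop R H H. Proof. by case: cA => [[]]. Qed.
Let bN : N `<=` @bop R L L. Proof. by move=> x []. Qed.
Let BN : B `<=` N. Proof. exact: sclosure_self. Qed.
Let vN : von_neumann_algebra N. Proof. exact: sclosure_vn. Qed.
Let nB : nalg B. Proof. exact: cstar_nalg. Qed.
Let bth (h : H) : bop (th h). Proof. exact: bop_tensr. Qed.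

(** [DeltaN] is prescribed only on N, whereas f is controlled on all bounded operators; this moves
    properties of f to [DeltaN]. *)
Lemma star_hom_ext (K E : hilbert R) (M : set (K -> K)) (u v : (K -> K) -> (E -> E)) :
  star_algebra M -> (forall x, M x -> u x = v x) -> star_hom M v -> star_hom M u.
Proof.
move=> [_ _ Ml MM Ma] uv [vb vl vM va]; split.
- by move=> x Mx; rewrite uv //; exact: vb.
- by move=> c x y Mx My; rewrite (uv _ (Ml c _ _ Mx My)) (uv _ Mx) (uv _ My); exact: vl.
- by move=> x y Mx My; rewrite (uv _ (MM _ _ Mx My)) (uv _ Mx) (uv _ My); exact: vM.
- by move=> x Mx; rewrite (uv _ (Ma _ Mx)) (uv _ Mx); exact: va.
Qed.

Let sN : star_algebra N. Proof. by case: vN. Qed.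

Lemma star_hom_DeltaN : star_hom N DeltaN.
Proof. exact: star_hom_ext sN DeltaNE (ampl_star_hom bN af). Qed.

Lemma DeltaN_id : DeltaN id = id.
Proof. by rewrite DeltaNE ?(ampl1 af) //; exact: BN. Qed.

Lemma DeltaN_inj : set_inj N DeltaN.
Proof.
move=> x y; rewrite !inE => Nx Ny; rewrite !DeltaNE // => e.
have := fVz (bN Nx); rewrite e fVz; last exact: bN.
move=> h; apply/funext => k; apply/eqP; rewrite -subr_eq0; apply/eqP; apply: nrm_eq0.
have [bV _] := iVz.
rewrite -(isometry_nrm _ iVz) (bopB _ _ bV).
by have := congr1 (fun X => X k) h => /= ->; rewrite subrr nrm0.
Qed.

Lemma DeltaN_normal : normal_map N DeltaN.
Proof.
move=> X T X0 XN Xd NT lT; rewrite DeltaNE //.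
have -> : DeltaN @` X = f @` X.
  by apply: eq_imagel => x Xx; apply: DeltaNE; case: (XN _ Xx).
exact: (ampl_normal af X0 XN Xd NT lT).
Qed.

Lemma DeltaN_vntens x : N x -> vntens (tp := tp) (Linf A) N (DeltaN x).
Proof.
move=> Nx; rewrite DeltaNE //.
have := ampl_sclosure sB B1 af Nx.
have eb := elem_tens_bop (tp := tp) cA cB.
have h : f @` B `<=` sclosure (lspan (elem_tens (tp := tp) A B)).
  move=> _ [b Bb <-]; apply: nclosure_sclosure; first exact: lspan_bop.
  exact: fB.
move=> /(sclosure_mono h) /sclosure_idem; apply: sclosure_mono; apply: lspan_mono.
by move=> _ [a [b [Aa Bb ->]]]; exists a, b; split=> //; [exact: sclosure_self|exact: BN].
Qed.

Lemma vn_coaction_N : vn_coaction A DeltaG N DeltaN.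
Proof.
split=> //; [by split; [exact: star_hom_DeltaN|exact: DeltaN_id]|
  by split; [exact: DeltaN_inj|exact: DeltaN_normal]|exact: DeltaN_vntens|].
have bV : vntens (tp := tp) (Linf A) N `<=` @bop R (tp H L) (tp H L) by move=> x [].
have bL : Linf A `<=` @bop R H H by move=> x [].
exists g, F1, F2; split.
- by split=> //; [exact: ampl_star_hom|exact: ampl_normal].
- split; [exact: ampl_star_hom|exact: ampl_normal|].
  by move=> m n /bL bm /bN bn; exact: F1E.
- split; [exact: ampl_star_hom|exact: ampl_normal|].
  by move=> m n /bL bm Nn; rewrite DeltaNE // F2E //; exact: bN.
- by move=> x Nx; rewrite DeltaNE // coass.
Qed.

(** If f(x) = 1 (x) x, the L1-slice of f(x) is x itself, and it is also the scalar (x xi, xi). *)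
Lemma ergodic_N : ergodic N DeltaN.
Proof.
have bi := bop_id H; have biL := bop_id L.
apply/seteqP; split=> x.
  move=> [Nx]; rewrite DeltaNE // => e; exists (inner (x xi) xi).
  rewrite -(impl_slice_N L1_unit cB B1 af f_slice iVz fVz Nx) e.
  apply/funext => k /=; rewrite optensE //; last exact: bN.
  by rewrite tens_inj_unit.
move=> [c ->]; have Nc : N (c *: id) by apply: BN; case: nB => nsB _ _; exact: nsubZ.
split=> //; rewrite DeltaNE //.
rewrite (star_homZ cB B1 (ampl_star_hom bB af)) // (ampl1 af).
apply: optens_uniq => //; [exact: bop_scale|exact/bop_scale/bop_id|].
by move=> h k; rewrite -[LHS]/(c *: _) -[(c *: id) k]/(c *: k) tensZr.
Qed.

Lemma coassociative_B : coassociative A DeltaG B DeltaN.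
Proof.
have bM : mult (ct A B) `<=` @bop R (tp H L) (tp H L) by move=> x [].
exists F1, F2; split.
- split; first exact: ampl_star_hom.
  by move=> a b Aa Bb; rewrite F1E ?gE //; [exact: bA|exact: bB].
- split; first exact: ampl_star_hom.
  by move=> a b Aa Bb; rewrite F2E ?DeltaNE //; [exact: BN|exact: bA|exact: bB].
- by move=> b Bb; rewrite DeltaNE ?coass //; exact: BN.
Qed.

Lemma G_cstar_algebra_B : G_cstar_algebra A DeltaG B DeltaN.
Proof.
have DB b : B b -> DeltaN b = f b by move=> Bb; apply: DeltaNE; exact: BN.
have DB' : DeltaN @` B = f @` B by exact: eq_imagel.
split.
- split=> //; rewrite /nondegenerate_on -subTset => v _; apply: subset_closure.
  by apply: lspan_self; exists id, v.
- split.
  + exact: (star_hom_ext sB DB (ampl_star_hom bB af)).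
  + by move=> b Bb; rewrite (mult_ctens tp cA A1 cB B1) DB //; exact: fB.
  + have [cb _ _ _] := nsub_ctens tp cA cB.
    have ob : opmul (DeltaN @` B) (ct A B) `<=` ct A B.
      rewrite DB' => _ [_ [x [[b Bb <-] cx ->]]]; apply: (ctens_mul cA cB) => //.
      exact: fB.
    apply/seteqP; split; first by apply: cspan_min => //; exact: nsub_ctens.
    move=> x cx; apply: cspan_self; first by move=> y /ob /cb.
    by exists id, x; split=> //; exists id => //; rewrite DB // (ampl1 af).
- by move=> x y; rewrite !inE => Bx By; apply: DeltaN_inj; rewrite inE; exact: BN.
- exact: coassociative_B.
- by rewrite DB'.
Qed.

Let hmodN (B' : set (L -> L)) (cB' : cstar_algebra B') (B1' : B' id) (BN' : B' `<=` N)
  (fB' : forall b, B' b -> ct A B' (f b)) (cyc : closure [set b xi | b in B'] = setT) x h :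
  N x -> hmod B' (f x \o th h).
Proof.
exact: (impl_hmodule cA cB B1 af fB f_slice B_cyclic iVz fVz cB' B1' BN' fB' cyc L1_cyclic).
Qed.

Lemma DeltaN_mult x : N x -> mult (ctens (tp := tp) (@compact_op R H H) B) (DeltaN x).
Proof.
move=> Nx; rewrite DeltaNE //; have bx := bN Nx.
have [_ _ _ _ Na] := sN; have [_ _ _ _ Ba] := sB.
apply: (mult_compact nB Ba (ampl_bop af bx)) => h; first exact: hmodN.
by rewrite -(ampl_adj af bx); apply: hmodN => //; exact: Na.
Qed.

(** * Strictness *)

Section Strict.
Variables (I : Type) (F : set_system I) (z : I -> L -> L) (M : R).
Hypotheses (PF : ProperFilter F) (Nz : forall i, N (z i)) (zM : forall i, opnorm (z i) <= M).
Hypothesis z0 : forall e : R, 0 < e -> F [set i | nrm (z i xi) < e].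

(** The operators v with f(z_i) v tending to 0 in norm. They form a closed subspace because the
    f(z_i) are uniformly bounded by M. *)
Let small : set (L -> tp H L) := [set v | bop v /\
  forall e : R, 0 < e -> F [set i | opnorm (f (z i) \o v) < e]].

Let M0 : 0 <= M.
Proof.
have [i _] := @filter_ex _ F _ _ (filterT : F setT).
by apply: le_trans (zM i); apply: opnorm_ge0; exact: bN.
Qed.

Lemma nsub_small : nsub small.
Proof.
have bfz i := ampl_bop af (bN (Nz i)).
split.
- by move=> v [].
- split=> [|e e0]; first exact: bop_cst0.
  apply: filterS filterT => i _ /=.
  have -> : f (z i) \o (0 : L -> tp H L) = 0 by apply/funext => k; exact: bop0 (bfz i).
  by rewrite opnorm0.
- move=> c S T [bS hS] [bT hT]; split=> [|e e0]; first exact: bop_lc.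
  have c1 : 0 < nrm c + 1 by have := nrm_ge0 c; lra.
  have d0 : 0 < e / 2 / (nrm c + 1) by rewrite !divr_gt0.
  have e2 : 0 < e / 2 by rewrite divr_gt0.
  apply: filterS2 (hS _ d0) (hT _ e2) => i /=; rewrite ltr_pdivlMr // => h1 h2.
  have -> : f (z i) \o (c *: S + T) = c *: (f (z i) \o S) + (f (z i) \o T).
    by apply/funext => k; rewrite /= !fctE (bopD _ _ (bfz i)) (bopZ _ _ (bfz i)).
  have bfS := bop_comp (bfz i) bS; have bfT := bop_comp (bfz i) bT.
  apply: le_lt_trans (opnormD (bop_scale _ bfS) bfT) _.
  have := opnormZ c bfS; have := opnorm_ge0 bfS; have := nrm_ge0 c; nra.
- move=> T [bT hT]; split=> // e e0.
  have M1 : 0 < M + 1 by have := M0; lra.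
  have [|S [bS hS] TS] := hT (e / 2 / (M + 1)); first by rewrite !divr_gt0.
  have e2 : 0 < e / 2 by rewrite divr_gt0.
  apply: filterS (hS _ e2) => i /= h.
  have bTS := bop_sub bT bS.
  have -> : f (z i) \o T = (f (z i) \o (T - S)) + (f (z i) \o S).
    by apply/funext => k; rewrite /= !fctE -(bopD _ _ (bfz i)) subrK.
  apply: le_lt_trans (opnormD (bop_comp (bfz i) bTS) (bop_comp (bfz i) bS)) _.
  have := opnormM (bfz i) bTS; have := ampl_opnorm af (bN (Nz i)); have := zM i.
  move: TS; rewrite ltr_pdivlMr //; have := opnorm_ge0 bTS; have := opnorm_ge0 (bfz i).
  set p := opnorm (T - S); set q := opnorm (f (z i)); set r := opnorm (z i).
  move=> q0 p0 TS zr qr hm.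
  have : q * p <= M * p by apply: ler_wpM2r => //; exact: le_trans qr zr.
  move: TS h; rewrite mulrDr mulr1 => TS h h'; lra.
Qed.

Lemma hmodule_small v : hmod B v -> small v.
Proof.
have nS := nsub_small; apply: (cspan_min nS) => _ [h [b [Bb ->]]].
have bb := bB Bb; have [_ _ _ Sc] := nS.
have bg (h0 : H) : bop (fun k => th h0 (b k)) by exact: (bop_comp (bth h0) bb).
apply: Sc; split; first exact: bg.
move=> e e0; have b1 : 0 < opnorm b + 1 by have := opnorm_ge0 bb; lra.
(* A generator h (x) b is approximated by one with h in A' L1, where the bound by |z_i xi| is
   available. *)
have /closureT_nrmP /(_ h (e / (opnorm b + 1))) [|_ [a' ca' <-] hh] := L1_cyclic.
  by rewrite divr_gt0.
have [ba' _] := ca'; exists (fun k => th (a' L1) (b k)).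
  split=> [|d d0]; first exact: bg.
  pose c := opnorm a' * opnorm b.
  have c0 : 0 <= c by rewrite mulr_ge0 // opnorm_ge0.
  have c1 : 0 < c + 1 by lra.
  have dc : 0 < d / (c + 1) by rewrite divr_gt0.
  apply: filterS (z0 dc) => i /=; rewrite ltr_pdivlMr // => hi.
  have := impl_strict_bound cA cB B1 af fB f_slice B_cyclic iVz fVz cB B1 (Nz i) ca' Bb.
  move=> /le_lt_trans; apply; rewrite -/c; have := nrm_ge0 (z i xi); lra.
have -> : (fun k => th h (b k)) - (fun k => th (a' L1) (b k)) = fun k => th (h - a' L1) (b k).
  by apply/funext => k; rewrite !fctE tensBl.
have /le_lt_trans : opnorm (fun k => th (h - a' L1) (b k)) <= nrm (h - a' L1) * opnorm b.
  apply: opnorm_le => [|k]; first by rewrite mulr_ge0 ?nrm_ge0 ?opnorm_ge0.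
  by rewrite nrm_tens -mulrA; apply: ler_wpM2l; [exact: nrm_ge0|exact: ler_opnorm].
apply; move: hh; rewrite ltr_pdivlMr //; have := nrm_ge0 (h - a' L1); lra.
Qed.

End Strict.

Lemma strict_cvg (I : Type) (F : set_system I) (x : I -> L -> L) (y : L -> L) (M : R) v :
  ProperFilter F -> (forall i, N (x i)) -> N y -> (forall i, opnorm (x i) <= M) ->
  x i xi @[i --> F] --> y xi -> hmod B v ->
  opnorm ((DeltaN (x i) \o v) - (DeltaN y \o v)) @[i --> F] --> (0 : R).
Proof.
move=> PF Nx Ny xM /cvg_nrmP cx hv; have by_ := bN Ny.
have [_ _ Nl _ _] := sN.
have Nz i : N (x i - y).
  by rewrite addrC -scaleN1r; apply: Nl.
have zM i : opnorm (x i - y) <= M + opnorm y.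
  apply: le_trans (opnormD (bN (Nx i)) (bop_opp by_)) _; rewrite opnormN.
  by rewrite lerD2r.
have z0 (e : R) : 0 < e -> F [set i | nrm ((x i - y) xi) < e].
  move=> e0; have h : F [set i | nrm (y xi - x i xi) < e] := cx e e0.
  by apply: filterS h => i /=; rewrite nrmB.
have [_ hs] := hmodule_small PF Nz zM z0 hv.
apply/cvgrPdist_lt => e e0; apply: filterS (hs e e0) => i /=.
have bx := bN (Nx i).
rewrite sub0r normrN !DeltaNE // (amplB af bx by_) => h.
have -> : (f (x i) \o v) - (f y \o v) = (f (x i) - f y) \o v by [].
rewrite ger0_norm //; apply: opnorm_ge0; apply: bop_comp.
  by rewrite -(amplB af bx by_); apply: (ampl_bop af); exact: bop_sub.
by have [hb _ _ _] := nsub_hmodule tp H nB; exact: hb.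
Qed.

Lemma strict_N : strict N B DeltaN.
Proof.
move=> I F PF x y M Nx Ny xM cx cax v hv; have [_ _ _ _ Na] := sN; split.
  exact: strict_cvg xM (cx xi) hv.
have xM' i : opnorm (adj (x i)) <= M by rewrite opnorm_adj //; exact: bN.
exact: (strict_cvg PF (fun i => Na _ (Nx i)) (Na _ Ny) xM' (cax xi) hv).
Qed.

Lemma cstar_version_B : cstar_version A DeltaG N DeltaN B DeltaN.
Proof.
by split=> //; [exact: G_cstar_algebra_B|exact: DeltaN_mult|exact: strict_N].
Qed.

(* b is the L1-slice of 1 (x) b, a limit of sums of terms f b_j (a_j (x) 1), and
   the L1-slices of such terms lie in every algebra through which f acts. *)
Lemma version_sub (P Q : set (L -> L)) : cstar_algebra P -> P id -> P `<=` N ->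
  cspan (opmul (f @` P) [set ot a id | a in A]) = ct A P ->
  cstar_algebra Q -> Q id -> Q `<=` N -> (forall b, Q b -> ct A Q (f b)) ->
  closure [set b xi | b in Q] = setT -> P `<=` Q.
Proof.
move=> cP P1 PN Pd cQ Q1 QN fQ Qc b Pb.
have bP : P `<=` @bop R L L by case: cP => [[]].
have [nQ _ _] := cstar_nalg cQ Q1; have bi := bop_id L.
have Sb : opmul (f @` P) [set ot a id | a in A] `<=` @bop R (tp H L) (tp H L).
  move=> _ [_ [_ [[c Pc <-] [a Aa <-] ->]]]; apply: bop_comp.
    by apply: (ampl_bop af); exact: bP.
  by apply: bop_optens => //; exact: bA.
have -> : b = adj (th L1) \o ot id b \o th L1.
  apply/funext => k /=; rewrite optensE ?tens_inj_unit //; [exact: bop_id|exact: bP].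
have : ct A P (ot id b) by exact: (ctens_gen tp cA cP A1 Pb).
rewrite -Pd; apply: (blin_cspan_sub (nsub_bop _ _) Sb (blin_slice L1 L1 (fun=> id)) nQ).
move=> _ [_ [_ [[c Pc <-] [a Aa <-] ->]]].
have -> : adj (th L1) \o (f c \o ot a id) \o th L1 = adj (th L1) \o (f c \o th (a L1)).
  by apply/funext => k /=; rewrite optensE //; exact: bA.
apply: (hmodule_slice cQ Q1); apply: hmodN => //; exact: PN.
Qed.

Lemma cstar_version_uniq D' DeltaD' : cstar_version A DeltaG N DeltaN D' DeltaD' ->
  D' = B /\ forall d, B d -> DeltaD' d = f d.
Proof.
move=> [[[cD _] _ _ _ Dd] [DN sD] DE _ _].
have DfE d : D' d -> DeltaD' d = f d by move=> Dd'; rewrite DE // DeltaNE //; exact: DN.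
have [[bD D0 Dl DM Ds] Dc] := cD.
have nD : nsub D' by split.
rewrite (eq_imagel DfE) in Dd.
have bi := bop_id L.
have Sb : opmul (f @` D') [set ot a id | a in A] `<=` @bop R (tp H L) (tp H L).
  move=> _ [_ [_ [[c Pc <-] [a Aa <-] ->]]]; apply: bop_comp.
    by apply: (ampl_bop af); exact: bD.
  by apply: bop_optens => //; exact: bA.
(* f(d) is itself one of the generating products, with a = 1. *)
have fD d : D' d -> ct A D' (f d).
  move=> Dd'; rewrite -Dd; apply: cspan_self => //.
  by exists (f d), id; split=> //; exists id => //; rewrite optens_id.
(* The slice is scalar because d lies in N, and it stays in D' because f(d) lies in A (x) D'. *)
have Dslice d : D' d -> D' (inner (d xi) xi *: id).
  move=> Dd'; have Nd := DN _ Dd'.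
  rewrite -(impl_slice_N L1_unit cB B1 af f_slice iVz fVz Nd).
  have eb := elem_tens_bop (tp := tp) cA cD.
  apply: (blin_cspan_sub (nsub_bop _ _) eb (blin_slice L1 L1 (fun=> id)) nD _ (fD _ Dd')).
  move=> _ [a [c [Aa Dc' ->]]].
  have -> : adj (th L1) \o ot a c \o th L1 = inner (a L1) L1 *: c.
    by apply/funext => k /=; rewrite optensE ?adj_tensr //; [exact: bA|exact: bD].
  exact: nsubZ.
have xin : nrm xi = 1.
  have := xi_unit; rewrite in_nrm => /complexI h; have := nrm_ge0 xi => h0.
  by apply/eqP; rewrite -(eqrXn2 (n := 2)) // h expr1n.
(* Strong density of D' gives d with |xi - d xi| < 1, so the scalar (d xi, xi) is nonzero and can be
   divided out. *)
have D1 : D' id.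
  have : sclosure D' id by rewrite sD; exact: BN.
  move=> /sclosureP [_ /(_ 1%N (fun=> xi) 1 ltr01)] [d Dd' /(_ ord0) hd].
  have c0 : inner (d xi) xi != 0.
    apply/eqP => c0; have := in_CS (xi - d xi) xi; rewrite inBl c0 subr0 xi_unit xin mulr1.
    by rewrite -(rmorph1 (real_complex R)) nrmR normr1 leNgt hd.
  rewrite -[id]scale1r -(mulVf c0) -scalerA.
  by apply: nsubZ => //; exact: Dslice.
have Dcyc : closure [set d xi | d in D'] = setT.
  rewrite -subTset => v _; apply/closure_nrmP => e e0.
  have /closureT_nrmP /(_ v (e / 2)) [|_ [b Bb <-] vb] := B_cyclic; first by rewrite divr_gt0.
  have : sclosure D' b by rewrite sD; exact: BN.
  move=> /sclosureP [_ /(_ 1%N (fun=> xi) (e / 2))] [|d Dd' /(_ ord0) hd]; first by rewrite divr_gt0.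
  exists (d xi); first by exists d.
  by apply: le_lt_trans (ler_nrm_trans (b xi) v (d xi)) _; rewrite (splitr e) ltrD.
have DB : D' = B.
  by apply/seteqP; split; exact: version_sub.
by split=> // d Bd; apply: DfE; rewrite DB.
Qed.

End Implemented_coaction.

Theorem theorem6p7 (R : realType) (tp : forall H K : hilbert R, htensor H K)
  (* the compact quantum group, acting on L2G = L^2(G) *)
  (L2G : hilbert R) (A : set (L2G -> L2G))
  (DeltaG : (L2G -> L2G) -> (tp L2G L2G -> tp L2G L2G))
  (phi : (L2G -> L2G) -> R[i]) (Lphi : (L2G -> L2G) -> L2G)
  (G_cqg : compact_quantum_group A DeltaG)
  (phi_haar : haar_state A DeltaG phi)
  (phi_faithful : faithful A phi)
  (A_gns : is_gns A phi Lphi id)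
  (* the quantum homogeneous space in the sense of Podles *)
  (K : hilbert R) (D : set (K -> K)) (DeltaD : (K -> K) -> (tp L2G K -> tp L2G K))
  (D_podles : podles_QHS A DeltaG D DeltaD)
  (* its von Neumann version, acting on L2D = L^2(D) *)
  (L2D : hilbert R) (pi : (K -> K) -> (L2D -> L2D))
  (N : set (L2D -> L2D)) (DeltaN : (L2D -> L2D) -> (tp L2G L2D -> tp L2G L2D))
  (N_version : von_neumann_version A phi Lphi D DeltaD pi N DeltaN) :
  QHS A DeltaG N DeltaN /\
  forall D' DeltaD', cstar_version A DeltaG N DeltaN D' DeltaD' ->
    equivariant_iso A D DeltaD D' DeltaD' pi.
Proof.
have [[cA A1] [sG G1 GA] _ dense_l dense_r] := G_cqg.
have [[phi_lin _ phi1] phi_inv] := phi_haar.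
have [_ Lphi_in Lphi_dense _ Lphi_mul] := A_gns.
have [[[cD _] [sD multD _] D_inj [F1 [F2 [[sF1 F1E] [sF2 F2E] coassD]]] D_dense] D1 D_fix] := D_podles.
have [rho [Lrho [U [[[rho_lin _ rho1] rho_slice] [_ Lrho_in Lrho_dense spi Lrho_mul] [uU UL] NE DeltaNE]]]] := N_version.
pose L1 := Lphi id.
have LphiE a : A a -> Lphi a = a L1 by move=> Aa; rewrite -(Lphi_mul _ _ Aa A1).
have phiE a : A a -> phi a = inner (a L1) L1.
  by move=> Aa; rewrite -LphiE // (Lphi_in _ _ Aa A1) adj_id.
have L1_unit : inner L1 L1 = 1 by rewrite -phi1 phiE.
have L1_cyclic : closure [set a L1 | a in A] = setT.
  by rewrite -Lphi_dense (eq_imagel LphiE).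
have L1_sep a : A a -> a L1 = 0 -> a = 0.
  move=> Aa a0; apply: phi_faithful => //.
  by rewrite -(Lphi_in _ _ Aa Aa) LphiE // a0 in0l.
have G_lslice a : A a ->
    adj (tens (tp L2G L2G) L1) \o DeltaG a \o tens (tp L2G L2G) L1 = inner (a L1) L1 *: id.
  by move=> Aa; rewrite -(lsliceE cA A1 cA A1 phiE (GA _ Aa)) -phiE //; case: (phi_inv _ Aa).
have G_rslice a : A a ->
    adj (tens (tp L2G L2G) ^~ L1) \o DeltaG a \o tens (tp L2G L2G) ^~ L1 = inner (a L1) L1 *: id.
  by move=> Aa; rewrite -(rsliceE cA A1 cA A1 phiE (GA _ Aa)) -phiE //; case: (phi_inv _ Aa).
have L1_cocyclic := commutant_cyclic cA A1 sG G1 GA dense_l dense_r L1_unit L1_cyclic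
  L1_sep G_lslice G_rslice.
have bA : A `<=` @bop R L2G L2G by case: cA => [[]].
(* A (x) D is unital, hence its own multiplier algebra, and the maps F1 and F2 of coassociativity
   become homomorphisms of A (x) D. *)
have mctD : mult (ctens (tp := tp) A D) = ctens A D by exact: mult_ctens.
have DA d : D d -> ctens (tp := tp) A D (DeltaD d) by rewrite -mctD; exact: multD.
rewrite mctD in sF1 sF2.
(* Scalars are the fixed points of Delta_D, and for 1 this reads Delta_D(1) = 1 (x) 1. *)
have DD1 : DeltaD id = id.
  have : scalars (@id K) by exists 1; rewrite scale1r.
  by rewrite -D_fix => -[_ ->]; exact: optens_id.
have rhoD d : D d -> adj (tens (tp L2G K) L1) \o DeltaD d \o tens (tp L2G K) L1 = rho d *: id.
  by move=> Dd; rewrite -(lsliceE cA A1 cD D1 phiE (DA _ Dd)); exact: rho_slice.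
(* K is nonzero: on the zero space the identity is 0, and additivity of rho would give 1 = 1 + 1. *)
have [k0 k0_unit] : exists k : K, inner k k = 1.
  have [k0 kn0] : exists k : K, k != 0.
    apply: contrapT => h; have id0 : @id K = 0.
      apply/funext => k; apply: contrapT => kn0; apply: h; exists k; exact/eqP.
    have D0 : D 0 by case: cD => [[]].
    have := rho_lin 1 0 0 D0 D0; rewrite -id0 rho1 scale1r mul1r.
    rewrite id0 addr0 -id0 rho1 => /eqP.
    by rewrite -subr_eq0 opprD addrA subrr sub0r oppr_eq0 oner_eq0.
  exists ((nrm k0)^-1%:C *: k0); have := nrm_gt0 kn0 => n0.
  by rewrite in_nrm nrmZR ?invr_ge0 ?ltW // mulVf ?gt_eqF // expr1n.
pose xi := Lrho id.
have LrhoE d : D d -> Lrho d = pi d xi.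
  by move=> Dd; rewrite /xi (Lrho_mul _ _ Dd D1).
have pi_xi d : D d -> inner (pi d xi) xi = rho d.
  by move=> Dd; rewrite -LrhoE // (Lrho_in _ _ Dd D1) adj_id.
have pi_cyclic : closure [set pi d xi | d in D] = setT.
  by rewrite -Lrho_dense (eq_imagel LrhoE).
have [bpi _ _ _] := spi.
have pi1 : pi id = id.
  apply: (bop_total_eq (S := Lrho @` D)); [|exact: bpi|exact: bop_id|].
    by rewrite -subTset -Lrho_dense; apply: closureS; exact: lspan_self.
  by move=> _ [d Dd <-]; rewrite (Lrho_mul _ _ D1 Dd).
have xi_unit : inner xi xi = 1 by rewrite -rho1 -pi_xi // pi1.
(* The concrete iota (x) pi, which is also the witness of equivariance at the end. *)
pose I := idpi cD sD F2 rhoD k0_unit spi pi_xi pi_cyclic.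
have UE a d : A a -> D d -> U (tens (tp L2G L2D) (a L1) (pi d xi)) =
    I (DeltaD d \o optens a id) (tens (tp L2G L2D) L1 xi).
  move=> Aa Dd; rewrite -LphiE // -LrhoE // UL //.
  apply: (gns_tensE cA A1 L1_unit cD D1 sD DD1 sF2 F2E rhoD k0_unit spi pi1 pi_xi
    pi_cyclic LphiE LrhoE).
  by apply: (ctens_mul cA cD (DA _ Dd)); exact: (ctens_gen tp cA cD Aa D1).
have cB := pi_cstar cA L1_cocyclic cD D1 sD DA D_inj rhoD spi pi1 pi_xi.
have B1 : (pi @` D) id by exists id.
have bB : pi @` D `<=` @bop R L2D L2D by case: cB => [[]].
have aDN := ampl_DN (tp := tp) uU.
have DN_B := @DN_ctens _ _ _ _ _ cA A1 L1_cyclic _ _ _ _ D1 _ DA _ sF2 F2E _ _ _ _ _ _ _ _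
  pi1 _ _ _ uU UE.
have DN_s := @DN_slice _ _ _ _ _ cA A1 L1_cyclic _ _ _ _ D1 _ DA _ sF2 F2E _ _ _ _ _ _ _ _
  pi1 _ _ _ uU UE.
have DN_d := @DN_dense _ _ _ _ _ cA A1 L1_cyclic L1_cocyclic _ _ _ _ D1 _ DA D_inj _ sF2 F2E
  _ _ D_dense _ _ _ _ _ _ pi1 _ _ _ uU UE.
have iV := isometry_DNV (tp := tp) L1_unit uU.
have DN_V := DN_DNV (tp := tp) L1 uU.
have Bc := B_cyclic pi_cyclic.
have uW := unitary_groupU cA sG dense_l L1_cyclic G_rslice.
have ag := ampl_DG cA sG dense_l L1_cyclic G_rslice.
have gE := DGE cA sG dense_l L1_cyclic G_rslice.
(* The normal maps Delta_G (x) iota and iota (x) Delta_N asked for by the coassociativity of the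
   coaction. *)
have [E1 aE1 E1E] := leg1_ex L2D uW.
have [E2 aE2 E2E] := leg2_ex uU.
have bDG a : A a -> bop (DeltaG a) by have [h _ _ _] := sG; exact: h.
have coassN : forall x, sclosure (pi @` D) x ->
    @tassoc R tp L2G L2G L2D \o E1 (DN U x) = E2 (DN U x) \o @tassoc R tp L2G L2G L2D.
  apply: (@coassoc_N _ _ _ _ _ cA A1 L1_cyclic _ _ _ _ D1 _ DA _ sF2 F2E _ _ _ _ _ _ _ _
    pi1 _ _ _ uU UE _ _ sF1 bDG F1E coassD _ _ aE1 aE2).
  - move=> a b Aa Bb; rewrite E1E; [|exact: bA|exact: bB].
    by rewrite -/(DG cA sG dense_l L1_cyclic G_rslice a) gE.
  - by move=> a b Aa Bb; rewrite E2E //; [exact: bA|exact: bB].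
rewrite NE in DeltaNE *; split; first split.
- exact: (vn_coaction_N cA cB B1 aDN DN_B iV DN_V ag gE aE1 aE2 E1E E2E coassN DeltaNE).
- exact: (ergodic_N L1_unit cB B1 aDN DN_s iV DN_V DeltaNE).
- exists (pi @` D), DeltaN.
  exact: (cstar_version_B cA A1 L1_cocyclic cB B1 aDN DN_B DN_s Bc iV DN_V DN_d gE
    aE1 aE2 E1E E2E coassN DeltaNE).
move=> D' DeltaD' vD'.
have [-> D'E] := cstar_version_uniq cA A1 L1_unit L1_cocyclic xi_unit cB B1 aDN DN_B DN_s
  Bc iV DN_V DN_d DeltaNE vD'.
split=> //; first exact: (pi_inj cA L1_cocyclic cD D1 sD DA D_inj rhoD spi pi_xi).
exists I; split.
  split; first by rewrite mctD; exact: (idpi_star cA A1 cD D1 sD sF2 F2E).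
  by move=> a d Aa Dd; exact: (idpi_gen cA cD D1 sD F2E).
move=> d Dd; rewrite D'E; last by exists d.
exact: (DN_pi cA A1 L1_cyclic D1 DA sF2 F2E pi1 uU UE).
Qed.
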